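(* Let $\chi_1,\chi_2:F^\times\to E^\times$ be smooth characters such that $\sigma=\mathrm{Ind}_B^G(\chi_1,\chi_2)$ is irreducible, let $m\in\mathbb{Z}$ and $n\ge 0$ be integers, let $\tau=\det(\cdot)^m\otimes \mathrm{Sym}^n$, and let $\rho=\tau\otimes\sigma$. Put $\tilde\lambda=\chi_1(\pi)\pi^m$ and $\tilde\mu=\omega(\pi)\chi_2(\pi)\pi^m$. Assume that (i) $|\tilde\lambda\tilde\mu q\pi^n|=1$, and (ii) $|\tilde\lambda|\le|q^{-1}\pi^{-n}|$ and $|\tilde\mu|\le|q^{-1}\pi^{-n}|$. Assume in addition that either (1) $\chi_1$ and $\chi_2$ are unramified and $n<q$, or (2) $\chi_1$ and $\chi_2$ are tamely ramified and $n=0$. Then $\rho$ has an integral structure.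
   Context: $F$ is a non-archimedean local field of characteristic $0$ and residue characteristic $p$, $\mathcal{O}_F$ its ring of integers, $\pi$ a fixed uniformizer, $q$ the cardinality of $\mathcal{O}_F/\pi\mathcal{O}_F$. $E$ is an algebraic closure of $F$, with the absolute value $|\cdot|$ extending that of $F$, and $\mathcal{O}_E=\{x\in E:|x|\le1\}$. $G=GL_2(F)$ and $B\subset G$ is the subgroup of upper triangular matrices. $\omega:F^\times\to E^\times$ is the unramified character with $\omega(\pi)=q^{-1}$. A character of $F^\times$ is unramified if it is trivial on $\mathcal{O}_F^\times$, and tamely ramified if it is trivial on $1+\pi\mathcal{O}_F$. $\mathrm{Ind}_B^G(\chi_1,\chi_2)$ is the (unnormalized) space of functions $f:G\to E$ with $f\left(\begin{pmatrix}t_1&s\\0&t_2\end{pmatrix}g\right)=\chi_1(t_1)\chi_2(t_2)f(g)$ that are right invariant under some open subgroup of $G$ (depending on $f$); $G$ acts by right translation. $\mathrm{Sym}^n$ is the $n$-th symmetric power of the standard representation of $GL_2$ on $E^2$. An integral structure in a representation $V$ of $G$ over $E$ is an $\mathcal{O}_E[G]$-submodule $V^0\subset V$ that spans $V$ over $E$ and contains no $E$-line. *)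

(* Defs.v *)
From HB Require Import structures.
From mathcomp Require Import all_boot all_order all_algebra.
From mathcomp Require Import sesquilinear.
From mathcomp Require Import boolp classical_sets functions cardinality reals.
From mathcomp Require Import mpoly.

Set Implicit Arguments.
Unset Strict Implicit.
Unset Printing Implicit Defensive.

Import Order.TTheory GRing.Theory Num.Theory.

Local Open Scope classical_set_scope.
Local Open Scope ring_scope.

(* mathcomp's {unit A} is restricted to finite rings. *)
Section UnitGroup.
Variable A : unitRingType.

Record unitg : Type := Unitg { uval :> A; uvalP : uval \is a GRing.unit }.

HB.instance Definition _ := [isSub for uval].
HB.instance Definition _ := [Choice of unitg by <:].

Fact unitg_mul_subproof (x y : unitg) : uval x * uval y \is a GRing.unit.
Proof. by rewrite unitrMl uvalP. Qed.

Fact unitg_inv_subproof (x : unitg) : (uval x)^-1 \is a GRing.unit.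
Proof. by rewrite unitrV uvalP. Qed.

Definition unitg_one : unitg := Unitg (unitr1 A).
Definition unitg_mul (x y : unitg) : unitg := Unitg (unitg_mul_subproof x y).
Definition unitg_inv (x : unitg) : unitg := Unitg (unitg_inv_subproof x).

Fact unitg_mulA : associative unitg_mul.
Proof. by move=> x y z; apply/val_inj/mulrA. Qed.

Fact unitg_mul1g : left_id unitg_one unitg_mul.
Proof. by move=> x; apply/val_inj/mul1r. Qed.

Fact unitg_mulg1 : right_id unitg_one unitg_mul.
Proof. by move=> x; apply/val_inj/mulr1. Qed.

Fact unitg_mulVg : left_inverse unitg_one unitg_inv unitg_mul.
Proof. by move=> x; apply/val_inj/mulVr/uvalP. Qed.

Fact unitg_mulgV : right_inverse unitg_one unitg_inv unitg_mul.
Proof. by move=> x; apply/val_inj/mulrV/uvalP. Qed.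

HB.instance Definition _ := isGroup.Build unitg
  unitg_mulA unitg_mul1g unitg_mulg1 unitg_mulVg unitg_mulgV.

End UnitGroup.

Notation GL2 K := (unitg 'M[K]_2).

Record nonarch_absval (R : realType) (K : fieldType) : Type := NonarchAbsval {
  absval :> K -> R;
  absval_ge0 : forall x, 0 <= absval x;
  absval_eq0 : forall x, absval x = 0 <-> x = 0;
  absvalM : forall x y, absval (x * y) = absval x * absval y;
  absvalD : forall x y, absval (x + y) <= Num.max (absval x) (absval y)
}.

Section AbsoluteValue.
Variables (R : realType) (K : fieldType) (v : nonarch_absval R K).

Lemma absval_sum_lt (I : finType) (x : I -> K) (e : R) :
  0 < e -> (forall i, v (x i) < e) -> v (\sum_i x i) < e.
Proof.
move=> e0 xe; elim/big_ind: _ => [|y z ye ze|i _] //.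
  by rewrite (absval_eq0 v 0).2.
by apply: (le_lt_trans (absvalD v y z)); rewrite gt_max ye.
Qed.

Definition integers : set K := [set x | v x <= 1].

Definition uniformizer (pi : K) : Prop :=
  [/\ pi != 0, v pi < 1 & forall x, v x < 1 -> v x <= v pi].

(* The quotient O_K / pi O_K, as the set of cosets x + pi O_K with x in O_K. *)
Definition residue_ring (pi : K) : set (set K) :=
  [set [set x + pi * z | z in integers] | x in integers].

Definition cauchy_complete : Prop :=
  forall u : nat -> K,
    (forall e : R, 0 < e ->
       exists N, forall i j, (N <= i)%N -> (N <= j)%N -> v (u i - u j) < e) ->
    exists l, forall e : R, 0 < e ->
       exists N, forall i, (N <= i)%N -> v (u i - l) < e.

(* Complete and discretely valued with finite residue field. *)
Definition nonarch_local_field : Prop :=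
  (exists2 pi, uniformizer pi & finite_set (residue_ring pi)) /\
  cauchy_complete.

End AbsoluteValue.

Section Characters.
Variables (R : realType) (F : fieldType) (absF : nonarch_absval R F) (E : fieldType).
Variable chi : {multiplicative unitg F -> unitg E}.

Definition smooth_character : Prop :=
  exists2 e : R, 0 < e &
    forall x : unitg F, absF (uval x - 1) < e -> chi x = 1%g.

Definition unramified : Prop :=
  forall x : unitg F, absF (uval x) = 1 -> chi x = 1%g.

Definition tamely_ramified (pi : F) : Prop :=
  forall x : unitg F, (exists2 z, integers absF z & uval x = 1 + pi * z) ->
    chi x = 1%g.

End Characters.

Record repn (G : groupType) (E : fieldType) (V : lmodType E) : Type := Repn {
  ract :> G -> V -> V;
  ract_linear : forall g, linear (ract g);
  ract1 : forall v, ract 1%g v = v;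
  ractM : forall g h v, ract (g * h)%g v = ract g (ract h v)
}.

Section Representations.
Variables (G : groupType) (E : fieldType) (V : lmodType E) (r : repn G V).

Lemma ractZ g a v : r g (a *: v) = a *: r g v.
Proof.
have r0 : r g 0 = 0.
  by have := ract_linear r g (-1) 0 0; rewrite scaleN1r oppr0 addr0 scaleN1r addNr.
by have := ract_linear r g a v 0; rewrite r0 !addr0.
Qed.

(* W is an A[G]-submodule, A being a subset (in practice a subring) of E. *)
Record submodule (A : set E) (W : set V) : Prop := Submodule {
  submodule0 : W 0;
  submoduleD : forall v w, W v -> W w -> W (v + w);
  submoduleZ : forall a v, A a -> W v -> W (a *: v);
  submoduleG : forall g v, W v -> W (r g v)
}.

Definition irreducible : Prop :=
  (exists v : V, v != 0) /\
  (forall W : set V, submodule setT W -> W = [set 0] \/ W = setT).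

Definition linear_span (W : set V) : set V :=
  [set v | exists (k : nat) (a : 'I_k -> E) (w : 'I_k -> V),
     (forall i, W (w i)) /\ v = \sum_(i < k) a i *: w i].

Definition line (v : V) : set V := [set a *: v | a in setT].

Definition integral_structure (R : realType) (absE : nonarch_absval R E) (V0 : set V) :
    Prop :=
  [/\ submodule (integers absE) V0,
      linear_span V0 = setT &
      ~ exists2 v : V, v != 0 & line v `<=` V0].

End Representations.

Definition tensor_product (E : fieldType) (V W T : lmodType E)
    (t : {bilinear V -> W -> T}) : Prop :=
  forall (Z : lmodType E) (b : {bilinear V -> W -> Z}),
    exists f : {linear T -> Z}, (forall v w, f (t v w) = b v w) /\
      (forall f' : {linear T -> Z}, (forall v w, f' (t v w) = b v w) ->
         f' =1 f).

Definition tensor_repn (G : groupType) (E : fieldType) (V W T : lmodType E)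
    (rV : repn G V) (rW : repn G W)
    (t : {bilinear V -> W -> T}) (rT : repn G T) : Prop :=
  tensor_product t /\ (forall g v w, rT g (t v w) = t (rV g v) (rW g w)).

(* Tensor products exist when one factor is finite-dimensional, which is the
   case used here. *)
Section TensorExistence.
Variables (G : groupType) (E : fieldType) (V : vectType E) (W : lmodType E).

Let e := vbasis (@fullv E V).
Let T : lmodType E := {ffun 'I_(\dim (@fullv E V)) -> W}.

Definition ftensor (v : V) (w : W) : T := [ffun i => coord e i v *: w].

Fact ftensor_bilinear :
  bilinear_for (GRing.Scale.Law.clone _ _ *:%R _)
     (GRing.Scale.Law.clone _ _ *:%R _) ftensor.
Proof.
split=> [w a v v'|v a w w']; apply/ffunP=> i; rewrite !ffunE.
  by rewrite linearP scalerDl scalerA.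
by rewrite scalerDr !scalerA mulrC.
Qed.

HB.instance Definition _ :=
  bilinear_isBilinear.Build E V W T _ _ ftensor ftensor_bilinear.

Lemma ftensor_decomp (x : T) : x = \sum_(i < \dim (@fullv E V)) ftensor e`_i (x i).
Proof.
apply/ffunP=> j; rewrite sum_ffunE (bigD1 j) //= big1 => [|i ij].
  by rewrite ffunE coord_free ?eqxx ?scale1r ?addr0 // (basis_free (vbasisP _)).
by rewrite ffunE coord_free ?(basis_free (vbasisP _)) // (negPf ij) scale0r.
Qed.

Lemma ftensor_tensor_product : tensor_product (ftensor : {bilinear V -> W -> T}).
Proof.
move=> Z b; pose f (x : T) : Z := \sum_(i < \dim (@fullv E V)) b e`_i (x i).
have f_lin : linear f.
  move=> a x y; rewrite /f scaler_sumr -big_split /=.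
  by apply: eq_bigr => i _; rewrite !ffunE linearP.
pose fM := GRing.isLinear.Build E T Z _ f f_lin.
pose fL : {linear T -> Z} := HB.pack f fM.
exists fL; split=> [v w|f' f'E x].
  rewrite /= /f {2}(coord_vbasis (memvf v)) linear_sumlz.
  by apply: eq_bigr => i _; rewrite ffunE linearZr_LR linearZl_LR.
rewrite {1}(ftensor_decomp x) linear_sum /=.
by apply: eq_bigr => i _; rewrite f'E.
Qed.

Lemma tensor_repn_exists (rV : repn G V) (rW : repn G W) :
  exists (T : lmodType E) (t : {bilinear V -> W -> T}) (rT : repn G T),
    tensor_repn rV rW t rT.
Proof.
pose t : {bilinear V -> W -> T} := ftensor.
have tP : tensor_product t := ftensor_tensor_product.
pose b g v w : T := t (rV g v) (rW g w).
have b_bil g : bilinear_for (GRing.Scale.Law.clone _ _ *:%R _)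
     (GRing.Scale.Law.clone _ _ *:%R _) (b g).
  split=> [w a v v'|v a w w']; rewrite /b ract_linear ?linearPl ?linearPr //.
pose bL g : {bilinear V -> W -> T} :=
  HB.pack (b g) (bilinear_isBilinear.Build E V W T _ _ (b g) (b_bil g)).
have /choice[f fP] : forall g, exists f : {linear T -> T},
    forall v w, f (t v w) = b g v w.
  by move=> g; have [f [fE _]] := tP _ (bL g); exists f.
have ext (h h' : {linear T -> T}) :
    (forall v w, h (t v w) = h' (t v w)) -> h =1 h'.
  move=> hh' x; rewrite (ftensor_decomp x) !linear_sum.
  by apply: eq_bigr => i _; apply: hh'.
have f1 x : f 1%g x = x.
  apply: (ext (f 1%g) idfun) => v w.
  by rewrite fP /b !ract1.
have fM g h x : f (g * h)%g x = f g (f h x).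
  apply: (ext (f (g * h)%g) (f g \o f h)) => v w /=.
  by rewrite !fP /b !ractM -/(b g (rV h v) (rW h w)) -fP.
exists T, t, (Repn (fun g => linearP (f g)) f1 fM).
by split=> // g v w; rewrite /= fP.
Qed.

End TensorExistence.

Section PrincipalSeries.
Variables (R : realType) (F : fieldType) (absF : nonarch_absval R F) (E : fieldType).

(* The topology of GL_2(F) as a subspace of M_2(F). *)
Definition GL2_open (U : set (GL2 F)) : Prop :=
  forall g, U g -> exists2 e : R, 0 < e &
    forall h : GL2 F, (forall i j, absF (uval h i j - uval g i j) < e) -> U h.

Definition GL2_open_subgroup (U : set (GL2 F)) : Prop :=
  [/\ GL2_open U, U 1%g & forall g h, U g -> U h -> U (g / h)%g].

Lemma GL2_open_conj (U : set (GL2 F)) (g : GL2 F) :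
  GL2_open U -> GL2_open [set u | U (g^-1 * u * g)%g].
Proof.
move=> Uo x /= /Uo[e e0 eP].
pose C (a : 'M[F]_2) : R := 1 + \sum_i \sum_j absF (a i j).
have C_gt0 a : 0 < C a.
  apply: ltr_pwDl => //; apply: sumr_ge0 => i _; apply: sumr_ge0 => j _.
  exact: absval_ge0.
have C_ge (a : 'M[F]_2) i j : absF (a i j) <= C a.
  apply: (@le_trans _ _ (\sum_k absF (a i k))).
    by rewrite (bigD1 j) //= lerDl sumr_ge0 // => k _; apply: absval_ge0.
  rewrite /C [leRHS]addrC [X in _ <= X + _](bigD1 i) //= -addrA lerDl addr_ge0 // sumr_ge0 // => k _.
  by apply: sumr_ge0 => l _; apply: absval_ge0.
set p := uval g^-1%g; set r := uval g.
exists (e / (C p * C r)); first by rewrite divr_gt0 ?mulr_gt0.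
move=> h hx; apply: eP => i j.
have -> : uval (g^-1 * h * g)%g i j - uval (g^-1 * x * g)%g i j =
    \sum_l \sum_k p i k * (uval h k l - uval x k l) * r l j.
  rewrite -[LHS]/((p *m uval h *m r) i j - (p *m uval x *m r) i j).
  rewrite !mxE -sumrB; apply: eq_bigr => l _.
  rewrite !mxE !mulr_suml -sumrB; apply: eq_bigr => k _.
  by rewrite mulrBr mulrBl.
apply: absval_sum_lt => // l; apply: absval_sum_lt => // k.
rewrite !absvalM; have := hx k l; rewrite ltr_pdivlMr ?mulr_gt0 // => hkl.
apply: le_lt_trans hkl; rewrite mulrAC mulrC.
rewrite ler_wpM2l ?absval_ge0 //.
by rewrite ler_pM ?absval_ge0.
Qed.

Definition borel_mx (t1 : F) (s : F) (t2 : F) : 'M[F]_2 :=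
  block_mx (t1%:M : 'M_1) (s%:M : 'M_1) (0 : 'M_1) (t2%:M : 'M_1).

Fact borel_subproof (t1 t2 : unitg F) (s : F) :
  borel_mx (uval t1) s (uval t2) \is a GRing.unit.
Proof.
rewrite -[_ \is a _]/(borel_mx (uval t1) s (uval t2) \in unitmx) unitmxE.
rewrite /borel_mx (@det_ublock _ 1 1).
by rewrite !det_scalar !expr1 unitrM !uvalP.
Qed.

Definition borel (t1 : unitg F) (s : F) (t2 : unitg F) : GL2 F :=
  Unitg (borel_subproof t1 t2 s).

Variables chi1 chi2 : {multiplicative unitg F -> unitg E}.

Definition Ind_pred (f : GL2 F -> E^o) : Prop :=
  (forall t1 s t2 g,
     f (borel t1 s t2 * g)%g = uval (chi1 t1) * uval (chi2 t2) * f g) /\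
  (exists2 U, GL2_open_subgroup U & forall g u, U u -> f (g * u)%g = f g).

Definition Ind_mem : {pred GL2 F -> E^o} := [pred f | `[< Ind_pred f >]].

Fact Ind_submod_closed : submod_closed Ind_mem.
Proof.
split=> [|a f g]; rewrite !inE.
  split=> [t1 s t2 x|]; first by rewrite mulr0.
  exists setT => //; split=> // g _; exists 1 => //.
move=> [fB [U [Uo U1 UV] fU]] [gB [U' [Uo' U1' UV'] gU]].
split=> [t1 s t2 x|].
  change (a * f (borel t1 s t2 * x)%g + g (borel t1 s t2 * x)%g =
    uval (chi1 t1) * uval (chi2 t2) * (a * f x + g x)).
  by rewrite fB gB mulrDr mulrCA.
exists (U `&` U'); last first.
  move=> x u [Uu U'u].
  change (a * f (x * u)%g + g (x * u)%g = a * f x + g x).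
  by rewrite fU // gU.
split=> // [x [Ux U'x]|x y [Ux U'x] [Uy U'y]]; last first.
  by split; [apply: UV|apply: UV'].
have [d d0 dP] := Uo _ Ux; have [d' d'0 d'P] := Uo' _ U'x.
exists (Num.min d d'); first by rewrite lt_min d0.
move=> h hP; split; [apply: dP|apply: d'P] => i j.
  by have := hP i j; rewrite lt_min => /andP[].
by have := hP i j; rewrite lt_min => /andP[].
Qed.

HB.instance Definition _ :=
  GRing.isSubmodClosed.Build E (GL2 F -> E^o) Ind_mem Ind_submod_closed.

Record Ind : Type := MkInd { ind_fun :> GL2 F -> E^o; _ : ind_fun \in Ind_mem }.

HB.instance Definition _ := [isSub for ind_fun].
HB.instance Definition _ := [Choice of Ind by <:].
HB.instance Definition _ := [SubChoice_isSubLmodule of Ind by <:].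

Fact IndP (f : Ind) : Ind_pred f.
Proof. by case: f => f /=; rewrite inE. Qed.

Fact Ind_act_subproof (g : GL2 F) (f : Ind) :
  (fun x => f (x * g)%g) \in Ind_mem.
Proof.
have [fB [U [Uo U1 UV] fU]] := IndP f.
rewrite inE; split=> [t1 s t2 x|]; first by rewrite -mulgA fB.
exists [set u | U (g^-1 * u * g)%g] => [|x u Uu].
  split=> [||u w Uu Uw] /=; first exact: GL2_open_conj.
    by rewrite mulg1 mulVg.
  have := UV _ _ Uu Uw; congr U.
  by rewrite invgM invgM invgK !mulgA mulgK.
by rewrite -[in RHS](fU _ _ Uu) !mulgA mulgK.
Qed.

Definition Ind_act (g : GL2 F) (f : Ind) : Ind := MkInd (Ind_act_subproof g f).

Fact Ind_act_linear g : linear (Ind_act g).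
Proof. by move=> a f f'; apply/val_inj. Qed.

Fact Ind_act1 f : Ind_act 1%g f = f.
Proof. by apply/val_inj/funext => x /=; rewrite mulg1. Qed.

Fact Ind_actM g h f : Ind_act (g * h)%g f = Ind_act g (Ind_act h f).
Proof. by apply/val_inj/funext => x /=; rewrite mulgA. Qed.

Definition Ind_repn : repn (GL2 F) Ind :=
  Repn Ind_act_linear Ind_act1 Ind_actM.

End PrincipalSeries.

(* Sym^n(E^2) is the degree n part of the symmetric algebra E[X_0, X_1] on the
   standard basis of E^2; g sends X_j to its j-th column g_0j X_0 + g_1j X_1. *)
Section DetSym.
Variables (F E : fieldType) (iota : {rmorphism F -> E}) (m : int) (n : nat).

Definition std_subst (g : GL2 F) : 2.-tuple {mpoly E[2]} :=
  [tuple \sum_(i < 2) iota (uval g i j) *: 'X_i | j < 2].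

Fact Sym_subproof (g : GL2 F) (P : dhomog 2 E n) :
  (val P \mPo std_subst g) \is n.-homog.
Proof.
rewrite comp_mpolyEX big_seq; apply: rpred_sum => a aP; apply: rpredZ.
rewrite comp_mpolyX.
have -> : n = \sum_(j < 2) (1 * a j)%N.
  have /dhomogP/(_ _ aP) /= <- := dhomog_is_dhomog P.
  by rewrite mdegE; apply: eq_bigr => j _; rewrite mul1n.
pose prodH := big_ind2 (fun (q : {mpoly E[2]}) (k : nat) => q \is k.-homog).
apply: prodH => [|q k q' k' qk q'k'|j _]; first exact: dhomog1.
  exact: dhomogM.
apply: dhomogMn; rewrite tnth_mktuple; apply: rpred_sum => i _; apply: rpredZ.
by rewrite dhomogX /= mdeg1.
Qed.

Definition Sym_act (g : GL2 F) (P : dhomog 2 E n) : dhomog 2 E n :=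
  DHomog (Sym_subproof g P).

Fact Sym_act_linear g : linear (Sym_act g).
Proof. by move=> a P Q; apply/val_inj; rewrite /= linearP. Qed.

Fact Sym_act1 P : Sym_act 1%g P = P.
Proof.
apply/val_inj => /=; rewrite -[RHS]comp_mpoly_id; congr (_ \mPo _).
apply: eq_from_tnth => j; rewrite !tnth_mktuple (bigD1 j) //= big1 => [|i ij].
  by rewrite mxE eqxx rmorph1 scale1r addr0.
by rewrite mxE (negPf ij) rmorph0 scale0r.
Qed.

Fact Sym_actM g h P : Sym_act (g * h)%g P = Sym_act g (Sym_act h P).
Proof.
apply/val_inj => /=.
rewrite [X in _ = X \mPo _]comp_mpolyEX [LHS]comp_mpolyEX raddf_sum.
apply: eq_bigr => a _; rewrite /= linearZ /=; congr (_ *: _).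
rewrite !comp_mpolyX rmorph_prod; apply: eq_bigr => j _.
rewrite rmorphXn; congr (_ ^+ _); rewrite !tnth_mktuple /= raddf_sum /=.
under eq_bigr => i _ do rewrite mxE rmorph_sum scaler_suml.
rewrite exchange_big; apply: eq_bigr => k _ /=.
rewrite linearZ /= comp_mpolyXU -tnth_nth tnth_mktuple scaler_sumr.
by apply: eq_bigr => i _; rewrite rmorphM scalerA mulrC.
Qed.

Definition Sym_repn : repn (GL2 F) (dhomog 2 E n) :=
  Repn Sym_act_linear Sym_act1 Sym_actM.

Definition det_Sym_act (g : GL2 F) (P : dhomog 2 E n) : dhomog 2 E n :=
  iota (\det (uval g)) ^ m *: Sym_repn g P.

Fact det_Sym_act_linear g : linear (det_Sym_act g).
Proof.
move=> a P Q; rewrite /det_Sym_act ract_linear scalerDr !scalerA.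
by rewrite [a * _]mulrC.
Qed.

Fact det_Sym_act1 P : det_Sym_act 1%g P = P.
Proof. by rewrite /det_Sym_act ract1 det1 rmorph1 exp1rz scale1r. Qed.

Fact det_Sym_actM g h P :
  det_Sym_act (g * h)%g P = det_Sym_act g (det_Sym_act h P).
Proof.
rewrite /det_Sym_act ractM.
have -> : \det (uval (g * h)%g) = \det (uval g) * \det (uval h).
  exact: det_mulmx.
by rewrite rmorphM expfzMl -scalerA ractZ.
Qed.

Definition det_Sym_repn : repn (GL2 F) (dhomog 2 E n) :=
  Repn det_Sym_act_linear det_Sym_act1 det_Sym_actM.

End DetSym.

(* Main.v *)
(* The representation rho is irreducible: applying small upper unipotents to a
   sum of X^i Y^(n-i) (x) f_i and separating the powers of the parameter isolates
   a pure tensor X^n (x) f, and lower unipotents then give all of Sym^n (x) f.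
   Hence one nonzero linear form l with a single bounded orbit g |-> l (g v0)
   suffices: { v | |l (g v)| <= 1 for all g } is an integral structure.

   A linear form on tau (x) sigma is a finitely additive measure on P^1(F) with
   values in the dual of tau, that is, an additive function on the edges of the
   Bruhat-Tits tree pointing away from a root edge.  For v0 = P (x) f, with f the
   Iwahori eigenfunction supported on one half of the tree, the orbit of v0
   consists of the values at all oriented edges; those at the edges pointing
   towards the root are determined by the others.  The values are chosen
   recursively, moving outwards: at each vertex a prescribed integral element has
   to be distributed over the q children.  If chi1 / chi2 is unramified this is
   interpolation of binary forms of degree n at n + 1 <= q distinct residues.  If
   it is ramified and n = 0, there is an explicit solution, checked by evaluating
   a sum of a character over the Moebius image of the residue field. *)

Require Import Defs.
From HB Require Import structures.
From mathcomp Require Import all_boot all_order all_algebra.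
From mathcomp Require Import sesquilinear.
From mathcomp Require Import boolp classical_sets functions cardinality reals.
From mathcomp Require Import mpoly.
From mathcomp Require Import ring.

Set Implicit Arguments.
Unset Strict Implicit.
Unset Printing Implicit Defensive.

Import Order.TTheory GRing.Theory Num.Theory.

Local Open Scope classical_set_scope.
Local Open Scope ring_scope.

(** * Nonarchimedean absolute values *)

(** Obstacle: the form must be bounded on both orientations of every edge, yet by [edge_back] the
    value at a reversed edge is [(xch chi2 pi)^-1] times a sum over the parent and the siblings, and
    the hypotheses make this factor integral only after multiplication by q. Write lambda and mu'
    for the values of chi1 and chi2 at pi times pi^m, so that mu' = q mu. Condition (i) makes the
    centre act by units; given it, (ii) says exactly that 1/lambda and q/mu' are integral. If chi1 /
    chi2 is unramified, each vertex carries an eigenvector of its stabiliser, and passing to the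
    values at these vectors removes the obstacle: consecutive edges share a vertex, whose value is
    copied, and the new values obey one Hecke relation with eigenvalue 1/lambda + q/mu', up to a
    power of pi. Returning to edges divides by 1 - chi1(pi)/chi2(pi), a fixed constant, nonzero
    because sigma is irreducible. If the ratio is ramified there are no such vectors, and the factor
    q has to come out of character sums. *)

Section AbsvalTheory.
Variables (R : realType) (K : fieldType) (v : nonarch_absval R K).
Implicit Types x y z : K.

Lemma absval0 : v 0 = 0.
Proof. exact/absval_eq0. Qed.

Lemma absval_eq0b x : (v x == 0) = (x == 0).
Proof. by apply/eqP/eqP => [/(absval_eq0 v)//|->]; rewrite absval0. Qed.

Lemma absval_gt0 x : (0 < v x) = (x != 0).
Proof. by rewrite lt_def absval_ge0 andbT absval_eq0b. Qed.

Lemma absval1 : v 1 = 1.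
Proof.
have v1 : v 1 != 0 by rewrite absval_eq0b oner_eq0.
by apply: (mulfI v1); rewrite -absvalM !mulr1.
Qed.

Lemma absvalX x n : v (x ^+ n) = v x ^+ n.
Proof. by elim: n => [|n IH]; rewrite ?absval1 // !exprS absvalM IH. Qed.

Lemma absvalN1 : v (- 1) = 1.
Proof.
have /eqP : v (- 1) ^+ 2 = 1 by rewrite -absvalX sqrrN expr1n absval1.
by rewrite sqrf_eq1 => /orP[/eqP//|/eqP vN]; have := absval_ge0 v (-1); rewrite vN oppr_ge0 ler10.
Qed.

Lemma absvalN x : v (- x) = v x.
Proof. by rewrite -mulN1r absvalM absvalN1 mul1r. Qed.

Lemma absvalV x : v x^-1 = (v x)^-1.
Proof.
have [->|x0] := eqVneq x 0; first by rewrite invr0 absval0 invr0.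
have vx : v x != 0 by rewrite absval_eq0b.
by apply: (mulfI vx); rewrite -absvalM !divff ?absval1.
Qed.

Lemma absvalXz x (k : int) : v (x ^ k) = v x ^ k.
Proof. by case: k => k; rewrite ?NegzE -?exprnN ?absvalV /= absvalX. Qed.

Lemma absvalB_le x y : v (x - y) <= Num.max (v x) (v y).
Proof. by rewrite -(absvalN y) absvalD. Qed.

Lemma absvalBC x y : v (x - y) = v (y - x).
Proof. by rewrite -absvalN opprB. Qed.

Lemma absvalD_lt x y e : v x < e -> v y < e -> v (x + y) < e.
Proof. by move=> xe ye; apply: le_lt_trans (absvalD _ _ _) _; rewrite gt_max xe. Qed.

Lemma absvalD_le x y e : v x <= e -> v y <= e -> v (x + y) <= e.
Proof. by move=> xe ye; apply: le_trans (absvalD _ _ _) _; rewrite ge_max xe. Qed.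

Lemma absvalB_lt x y e : v x < e -> v y < e -> v (x - y) < e.
Proof. by move=> xe ye; apply: absvalD_lt; rewrite ?absvalN. Qed.

Lemma absvalD_eq x y : v x < v y -> v (x + y) = v y.
Proof.
move=> xy; apply/eqP; rewrite eq_le absvalD_le ?(ltW xy) //=.
have [//|lt] := leP (v y) (v (x + y)).
by have := absvalB_lt lt xy; rewrite addrC addKr ltxx.
Qed.

Definition vint : {pred K} := [pred x | v x <= 1].

Lemma vintE x : (x \in vint) = (v x <= 1).
Proof. by []. Qed.

Fact vint_subring : subring_closed vint.
Proof.
split=> [|x y|x y]; rewrite !vintE ?absval1 //.
  by move=> x1 y1; rewrite absvalD_le ?absvalN.
by move=> x1 y1; rewrite absvalM mulr_ile1 ?absval_ge0.
Qed.

HB.instance Definition _ := GRing.isSubringClosed.Build K vint vint_subring.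

Lemma absval_sum_le (I : finType) (P : pred I) (f : I -> K) (e : R) :
  0 <= e -> (forall i, P i -> v (f i) <= e) -> v (\sum_(i | P i) f i) <= e.
Proof.
move=> e0 fe; elim/big_ind: _ => [|x y|] //; first by rewrite absval0.
exact: absvalD_le.
Qed.

Lemma absval_mul_lt x y : v x <= 1 -> v y < 1 -> v (x * y) < 1.
Proof. by move=> x1 y1; rewrite absvalM; apply: le_lt_trans y1; rewrite ler_piMl ?absval_ge0. Qed.

Lemma absval_mul_le x y : v x <= 1 -> v y <= 1 -> v (x * y) <= 1.
Proof. by move=> x1 y1; rewrite absvalM mulr_ile1 ?absval_ge0. Qed.

Lemma absval_near1 x : v (x - 1) < 1 -> v x = 1.
Proof. by move=> x1; rewrite -[x](subrK 1) absvalD_eq absval1. Qed.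

End AbsvalTheory.

Section Uniformizer.
Variables (R : realType) (K : fieldType) (v : nonarch_absval R K) (pi : K).
Hypothesis pi_unif : uniformizer v pi.

Lemma unif_neq0 : pi != 0. Proof. by case: pi_unif. Qed.

Lemma unif_lt1 : v pi < 1. Proof. by case: pi_unif. Qed.

Lemma unif_gt0 : 0 < v pi. Proof. by rewrite absval_gt0 unif_neq0. Qed.

Lemma unif_div_le x : v x < 1 -> v (x / pi) <= 1.
Proof.
by case: pi_unif => _ _ h /h; rewrite absvalM absvalV ler_pdivrMr ?unif_gt0 ?mul1r.
Qed.

(** Bernoulli: with [1 + d] the inverse of [v pi], its [M]-th power is at least [M * d], and [R] is
    archimedean. *)
Lemma unif_expr_lt (e : R) : 0 < e -> exists M, v pi ^+ M < e.
Proof.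
move=> e0; pose d := (v pi)^-1 - 1.
have d0 : 0 < d by rewrite subr_gt0 invf_gt1 ?unif_gt0 ?unif_lt1.
have dM M : M%:R * d <= (v pi)^-1 ^+ M.
  elim: M => [|M IH]; first by rewrite mul0r expr0.
  rewrite exprS -[X in _ <= X * _](subrK 1) mulrDl mul1r -natr1 mulrDl mul1r addrC lerD //.
  by rewrite ler_peMr ?(ltW d0) // exprn_ege1 // ltW // invf_gt1 ?unif_gt0 ?unif_lt1.
have [M hM] : exists M : nat, (e * d)^-1 < M%:R.
  exists (Num.bound (e * d)^-1); by apply: archi_boundP; rewrite invr_ge0 mulr_ge0 ?ltW.
exists M; have vM : 0 < v pi ^+ M by rewrite exprn_gt0 ?unif_gt0.
have := dM M; rewrite exprVn => /(lt_le_trans _) h.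
have : e^-1 < (v pi ^+ M)^-1.
  by apply: h; rewrite -ltr_pdivrMr // -invfM.
by rewrite ltf_pV2 ?posrE.
Qed.

Lemma unif_expr_decr M N : (M <= N)%N -> v pi ^+ N <= v pi ^+ M.
Proof. by move=> MN; rewrite ler_wiXn2l // ?absval_ge0 // ltW // unif_lt1. Qed.

Lemma unif_factor x : x != 0 -> exists (k : int) (u : K), v u = 1 /\ x = u * pi ^ k.
Proof.
have main y : y != 0 -> v y <= 1 -> exists (k : int) (u : K), v u = 1 /\ y = u * pi ^ k.
  move=> y0 y1; have vy : 0 < v y by rewrite absval_gt0.
  have exM : exists M, v pi ^+ M < v y by apply: unif_expr_lt.
  (* The minimal exponent is [M.+1], so [y / pi ^+ M] is integral; were it not a unit, one more
     division by [pi] would contradict [hM]. *)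
  case: (ex_minnP exM) => -[|M].
    by rewrite expr0 => /lt_le_trans/(_ y1); rewrite ltxx.
  move=> hM minM; exists M%:Z, (y / pi ^+ M); split; last first.
    by rewrite mulfVK // expf_neq0 // unif_neq0.
  have le1 : v (y / pi ^+ M) <= 1.
    rewrite absvalM absvalV absvalX ler_pdivrMr ?exprn_gt0 ?unif_gt0 // mul1r leNgt.
    by apply/negP => /minM; rewrite ltnn.
  apply/eqP; rewrite eq_le le1 leNgt; apply/negP => lt1.
  have := unif_div_le lt1; rewrite -mulrA -invfM -exprSr absvalM absvalV absvalX.
  by rewrite ler_pdivrMr ?exprn_gt0 ?unif_gt0 // mul1r leNgt hM.
move=> x0; have [|x1] := leP (v x) 1; first exact: main.
have [||k [u [u1 e]]] := main x^-1; rewrite ?invr_eq0 // ?absvalV ?invf_le1 ?ltW ?absval_gt0 //.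
exists (- k), u^-1; split; first by rewrite absvalV u1 invr1.
by rewrite -[x]invrK e invfM invr_expz.
Qed.

Lemma unif_expz_le1 (k : int) : v (pi ^ k) <= 1 -> 0 <= k.
Proof.
case: k => // k; rewrite NegzE absvalXz -exprnN invf_le1 ?exprn_gt0 ?unif_gt0 //.
by rewrite leNgt exprn_ilt1 // ?absval_ge0 // unif_lt1.
Qed.

End Uniformizer.

(** Representatives of the residue field. Distinct classes differ by a unit, hence the exact value 1
    in [dig_sep]. *)
Record digits (R : realType) (K : fieldType) (v : nonarch_absval R K) (q : nat) :=
  Digits {
  dig :> 'I_q -> K;
  dig_le1 : forall i, v (dig i) <= 1;
  dig_sep : forall i j, i != j -> v (dig i - dig j) = 1;
  dig_near : forall z, v z <= 1 -> exists i, v (z - dig i) < 1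
}.

Lemma digits_exist (R : realType) (K : fieldType) (v : nonarch_absval R K)
    (pi : K) (q : nat) :
  uniformizer v pi -> (residue_ring v pi #= `I_q)%card -> inhabited (digits v q).
Proof.
move=> pi_unif; rewrite card_eq_sym => /card_set_bijP[f [fI finj fsurj]].
have coset (i : 'I_q) : exists x, v x <= 1 /\ f i = [set x + pi * z | z in integers v].
  by have [x x1 <-] := fI i (ltn_ord i); exists x.
pose d i := projT1 (cid (coset i)).
have d1 i : v (d i) <= 1 by rewrite /d; case: cid => x [].
have fd (i : 'I_q) : f i = [set d i + pi * z | z in integers v] by rewrite /d; case: cid => x [].
have sub x y : v (x - y) < 1 ->
    [set x + pi * z | z in integers v] `<=` [set y + pi * z | z in integers v].
  move=> xy _ [z z1 <-]; exists (z + (x - y) / pi).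
    by apply: absvalD_le => //; apply: unif_div_le.
  by rewrite mulrDr mulrCA divff ?(unif_neq0 pi_unif) // mulr1; ring.
split; apply: (@Digits _ _ _ _ d) => // [i j ij|z z1].
  have le1 : v (d i - d j) <= 1 by apply: absvalD_le; rewrite ?absvalN.
  apply/eqP; rewrite eq_le le1 leNgt; apply/negP => lt1.
  move/eqP: ij; apply; apply/val_inj/finj; rewrite ?inE ?mem_set //=; try exact: ltn_ord.
  by rewrite !fd; apply/seteqP; split; apply: sub; rewrite // absvalBC.
have [i iq fi] := fsurj [set z + pi * y | y in integers v] (ex_intro2 _ _ z z1 erefl).
exists (Ordinal iq).
have : [set d (Ordinal iq) + pi * y | y in integers v] z.
  rewrite -fd /= fi; exists 0; rewrite /integers /= ?absval0 ?ler01 //.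
  by rewrite mulr0 addr0.
case=> y y1 <-; rewrite addrC addKr mulrC; apply: absval_mul_lt => //.
exact: unif_lt1 pi_unif.
Qed.

(** * Two by two matrices, characters and induced functions *)

Section Matrices.
Variable K : fieldType.
Implicit Types (a b c d : K) (g h : GL2 K).

Definition mx2 a b c d : 'M[K]_2 :=
  \matrix_(i, j) (if i == 0 then if j == 0 then a else b
                  else if j == 0 then c else d).

Lemma ord2_cases (i : 'I_2) : i = 0 \/ i = 1.
Proof. by case: i => [[|[|]]] //= lt; [left|right]; apply/val_inj. Qed.

Lemma mx2_eq (M N : 'M[K]_2) :
  M 0 0 = N 0 0 -> M 0 1 = N 0 1 -> M 1 0 = N 1 0 -> M 1 1 = N 1 1 -> M = N.
Proof. by move=> ? ? ? ?; apply/matrixP=> i j; case: (ord2_cases i) (ord2_cases j) => -> [] ->. Qed.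

Lemma mx2_eta (M : 'M[K]_2) : M = mx2 (M 0 0) (M 0 1) (M 1 0) (M 1 1).
Proof. by apply: mx2_eq; rewrite mxE. Qed.

Lemma mx2_mul a b c d a' b' c' d' : mx2 a b c d *m mx2 a' b' c' d' =
  mx2 (a * a' + b * c') (a * b' + b * d') (c * a' + d * c') (c * b' + d * d').
Proof. by apply: mx2_eq; rewrite !mxE !big_ord_recl big_ord0 !mxE /= addr0. Qed.

Lemma det_mx22 (M : 'M[K]_2) : \det M = M 0 0 * M 1 1 - M 0 1 * M 1 0.
Proof.
rewrite (expand_det_row _ 0) !big_ord_recl big_ord0 /cofactor !det_mx11 !mxE /=.
rewrite expr0 mul1r expr1 mulN1r mulrN addr0.
by congr (M _ _ * M _ _ - M _ _ * M _ _); apply/val_inj.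
Qed.

Lemma det_mx2 a b c d : \det (mx2 a b c d) = a * d - b * c.
Proof. by rewrite det_mx22 !mxE. Qed.

Lemma mx2_1 : 1 = mx2 1 0 0 1.
Proof. by apply: mx2_eq; rewrite !mxE. Qed.

Lemma uvalM g h : uval (g * h)%g = uval g *m uval h.
Proof. by []. Qed.

Lemma uval_inj : injective (@uval 'M[K]_2).
Proof. exact: val_inj. Qed.

(** The default is [1] for a singular matrix; [gl2E] recovers the entries once the determinant is
    known to be nonzero. *)
Definition gl2 a b c d : GL2 K := insubd (1%g : GL2 K) (mx2 a b c d).

Lemma gl2E a b c d : a * d - b * c != 0 -> uval (gl2 a b c d) = mx2 a b c d.
Proof.
move=> D0; rewrite /gl2 insubdK // -[_ \in _]/(mx2 a b c d \in unitmx).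
by rewrite unitmxE det_mx2 unitfE.
Qed.

Lemma det_neq0 g : \det (uval g) != 0.
Proof. by rewrite -unitfE -unitmxE; exact: uvalP g. Qed.

Lemma det_entries g :
  \det (uval g) = uval g 0 0 * uval g 1 1 - uval g 0 1 * uval g 1 0.
Proof. exact: det_mx22. Qed.

Lemma detM g h : \det (uval (g * h)%g) = \det (uval g) * \det (uval h).
Proof. exact: det_mulmx. Qed.

Lemma detV g : \det (uval g^-1%g) = (\det (uval g))^-1.
Proof.
apply: (mulfI (det_neq0 g)); rewrite divff ?det_neq0 // -detM mulgV.
exact: det1.
Qed.

Lemma row_mul g h j :
  uval (g * h)%g 1 j = uval g 1 0 * uval h 0 j + uval g 1 1 * uval h 1 j.
Proof.
rewrite mxE !big_ord_recl big_ord0 addr0.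
by congr (_ + uval g 1 _ * uval h _ j); apply/val_inj.
Qed.

Lemma borel_mxE a s d : borel_mx a s d = mx2 a s 0 d.
Proof.
apply/matrixP=> i j; rewrite !mxE.
by case: splitP => k ik; rewrite !mxE; case: splitP => l jl; rewrite !mxE;
  rewrite !ord1 ?ord1 in ik jl *; rewrite -!val_eqE /= ik jl.
Qed.

End Matrices.

Section ExtendedCharacter.
Variables (F E : fieldType) (chi : {multiplicative unitg F -> unitg E}).

(* Extended by 0 at 0. *)
Definition xch (x : F) : E := oapp (fun u => uval (chi u)) 0 (insub x).

Lemma xch_uval (u : unitg F) : xch (uval u) = uval (chi u).
Proof. by rewrite /xch valK. Qed.

Lemma unitg_of (x : F) : x != 0 -> exists u : unitg F, uval u = x.
Proof. by rewrite -unitfE => xu; exists (Unitg xu). Qed.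

Lemma xch0 : xch 0 = 0.
Proof. by rewrite /xch insubF // unitr0. Qed.

Lemma xch_neq0 x : (xch x != 0) = (x != 0).
Proof.
have [->|/unitg_of[u <-]] := eqVneq x 0; first by rewrite xch0 eqxx.
by rewrite xch_uval -unitfE; exact: uvalP.
Qed.

Lemma xchM x y : xch (x * y) = xch x * xch y.
Proof.
have [->|/unitg_of[u <-]] := eqVneq x 0; first by rewrite mul0r xch0 mul0r.
have [->|/unitg_of[w <-]] := eqVneq y 0; first by rewrite mulr0 xch0 mulr0.
by rewrite -[uval u * uval w]/(uval (u * w)%g) !xch_uval gmulfM.
Qed.

Lemma xch1 : xch 1 = 1.
Proof.
have X0 : xch 1 != 0 by rewrite xch_neq0 oner_eq0.
by apply: (mulfI X0); rewrite -xchM !mulr1.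
Qed.

Lemma xchV x : xch x^-1 = (xch x)^-1.
Proof.
have [->|x0] := eqVneq x 0; first by rewrite invr0 xch0 invr0.
have X0 : xch x != 0 by rewrite xch_neq0.
by apply: (mulfI X0); rewrite -xchM !divff // xch1.
Qed.

Lemma xchX x n : xch (x ^+ n) = xch x ^+ n.
Proof. by elim: n => [|n IH]; rewrite ?xch1 // !exprS xchM IH. Qed.

Lemma xchXz x (k : int) : xch (x ^ k) = xch x ^ k.
Proof. by case: k => k; rewrite ?NegzE -?exprnN ?xchV xchX. Qed.

Lemma xch_N1_sq : xch (-1) * xch (-1) = 1.
Proof. by rewrite -xchM mulrNN mulr1 xch1. Qed.

Variables (R : realType) (v : nonarch_absval R F) (absE : nonarch_absval R E).

Variable pi : F.
Hypothesis pi_unif : uniformizer v pi.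

Lemma xch_tame : tamely_ramified v chi pi -> forall x, v (x - 1) < 1 -> xch x = 1.
Proof.
move=> ht x x1; have /unitg_of[u ux] : x != 0 by rewrite -(absval_gt0 v) (absval_near1 x1).
rewrite -ux xch_uval ht //; exists ((x - 1) / pi); last first.
  by rewrite ux mulrC divfK ?(unif_neq0 pi_unif) // addrC subrK.
exact: unif_div_le.
Qed.

Lemma xch_unramified : unramified v chi -> forall x, v x = 1 -> xch x = 1.
Proof.
move=> hu x x1; have /unitg_of[u ux] : x != 0 by rewrite -(absval_gt0 v) x1.
by rewrite -ux xch_uval hu ?ux.
Qed.

Lemma unramified_tame : unramified v chi -> tamely_ramified v chi pi.
Proof.
move=> hu x [z z1 xz]; apply: hu; apply: absval_near1.
rewrite xz addrC addKr mulrC; apply: absval_mul_lt => //; exact: unif_lt1 pi_unif.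
Qed.

(* The residue field is finite, so some power of a unit is congruent to 1. *)
Lemma xch_tame_absval (q : nat) (D : digits v q) :
  (forall x, v (x - 1) < 1 -> xch x = 1) -> forall x, v x = 1 -> absE (xch x) = 1.
Proof.
move=> ht x x1.
have xn k : v (x ^+ k) <= 1 by rewrite absvalX x1 expr1n.
pose f (k : 'I_q.+1) : 'I_q := projT1 (cid (dig_near D (xn k))).
have fP (k : 'I_q.+1) : v (x ^+ k - D (f k)) < 1 by rewrite /f; case: cid.
(* Pigeonhole: [q.+1] exponents for [q] digits. *)
have [i [j [ij fij]]] : exists i j : 'I_q.+1, (i < j)%N /\ f i = f j.
  apply: contrapT => nij; suff fi : injective f.
    by have := leq_card f fi; rewrite !card_ord ltnn.
  move=> i j fij; apply/val_inj; case: (ltngtP i j) => // ij; case: nij.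
    by exists i, j.
  by exists j, i.
have : v (x ^+ (j - i) - 1) < 1.
  have -> : x ^+ (j - i) - 1 = ((x ^+ j - D (f j)) - (x ^+ i - D (f i))) * (x ^+ i)^-1.
    have xi0 : x ^+ i != 0 by rewrite -(absval_gt0 v) absvalX x1 expr1n.
    by rewrite fij opprB addrA subrK mulrBl divff // -[in x ^+ j](subnK (ltnW ij)) exprD mulfK.
  by rewrite absvalM absvalV absvalX x1 expr1n invr1 mulr1; apply: absvalB_lt; apply: fP.
move/ht; rewrite xchX => xk.
have /eqP : absE (xch x) ^+ (j - i) = 1 by rewrite -absvalX xk absval1.
by rewrite pexpr_eq1 ?absval_ge0 ?subn_gt0 // => /eqP.
Qed.

End ExtendedCharacter.

Section Induced.
Variables (R : realType) (F : fieldType) (absF : nonarch_absval R F) (E : fieldType).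
Variables chi1 chi2 : {multiplicative unitg F -> unitg E}.
Notation Ind := (Ind absF chi1 chi2).
Implicit Types (f : Ind) (g h : GL2 F).

Lemma Ind_borel f g h a s d :
  a != 0 -> d != 0 -> uval g = mx2 a s 0 d *m uval h ->
  f g = xch chi1 a * xch chi2 d * f h.
Proof.
move=> /unitg_of[t1 t1E] /unitg_of[t2 t2E] gh.
have -> : g = (borel t1 s t2 * h)%g.
  by apply: uval_inj; rewrite uvalM gh /= borel_mxE t1E t2E.
by have [-> _] := IndP f; rewrite -t1E -t2E !xch_uval.
Qed.

Lemma Ind_scalar f g h c : c != 0 -> uval g = c *: uval h ->
  f g = xch chi1 c * xch chi2 c * f h.
Proof.
move=> c0 gh; apply: (@Ind_borel _ _ _ _ 0) => //.
rewrite gh [uval h]mx2_eta mx2_mul; apply: mx2_eq; rewrite !mxE /=; ring.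
Qed.

Lemma Ind_smooth f : exists2 e : R, 0 < e &
  forall u : GL2 F, (forall i j, absF (uval u i j - (i == j)%:R) < e) ->
    forall g, f (g * u)%g = f g.
Proof.
have [_ [U [Uo U1 UV] fU]] := IndP f; have [e e0 eP] := Uo _ U1.
exists e => // u hu g; apply: fU; apply: eP => i j.
by have := hu i j; rewrite -[uval (1%g : GL2 F)]/(1%:M : 'M[F]_2) mxE.
Qed.

(** The right stabiliser of [f] is a group containing a ball around 1, and such a group is open. *)
Lemma Ind_pred_near (f : GL2 F -> E^o) :
  (forall g h a s d, a != 0 -> d != 0 -> uval g = mx2 a s 0 d *m uval h ->
     f g = xch chi1 a * xch chi2 d * f h) ->
  (exists2 e : R, 0 < e &
     forall u : GL2 F, (forall i j, absF (uval u i j - (i == j)%:R) < e) ->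
     forall g, f (g * u)%g = f g) ->
  Ind_pred absF chi1 chi2 f.
Proof.
move=> fB [e e0 fe]; split=> [t1 s t2 g|].
  rewrite -!xch_uval; apply: (fB _ _ _ s).
  - by rewrite -unitfE; exact: uvalP.
  - by rewrite -unitfE; exact: uvalP.
  - by rewrite uvalM /= borel_mxE.
exists [set u | forall g, f (g * u)%g = f g] => [|g u]; last exact.
split=> [x fx|g|x y fx fy g] /=; last 2 first.
- by rewrite mulg1.
- by rewrite mulgA -(fy (g * x * y^-1)%g) mulgVK fx.
(* [C] bounds the entries of [x^-1], so [y] within [e / C] of [x] gives [x^-1 * y] within [e] of
   1. *)
pose C : R := 1 + \sum_i \sum_j absF (uval x^-1%g i j).
have C_ge i j : absF (uval x^-1%g i j) <= C.
  have S0 k : 0 <= \sum_l absF (uval x^-1%g k l) by rewrite sumr_ge0 // => l _; exact: absval_ge0.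
  apply: (@le_trans _ _ (\sum_l absF (uval x^-1%g i l))).
    by rewrite [leRHS](bigD1 j) //= lerDl sumr_ge0 // => k _; exact: absval_ge0.
  apply: (@le_trans _ _ (\sum_k \sum_l absF (uval x^-1%g k l))).
    by rewrite [leRHS](bigD1 i) //= lerDl sumr_ge0.
  by rewrite /C lerDr ler01.
have C0 : 0 < C.
  by rewrite ltr_pwDl // sumr_ge0 // => i _; rewrite sumr_ge0 // => j _; rewrite absval_ge0.
exists (e / C); first exact: divr_gt0.
move=> y xy g; have -> : (g * y = g * x * (x^-1 * y))%g by rewrite mulgA mulgK.
rewrite fe ?fx // => i j.
have -> : uval (x^-1 * y)%g i j - (i == j)%:R =
    \sum_k uval x^-1%g i k * (uval y k j - uval x k j).
  have -> : (i == j)%:R = uval (x^-1 * x)%g i j by rewrite mulVg -[uval _]/(1%:M : 'M[F]_2) mxE.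
  by rewrite !mxE -sumrB; apply: eq_bigr => k _; rewrite mulrBr.
apply: absval_sum_lt => // k; rewrite absvalM.
have := xy k j; rewrite ltr_pdivlMr // => /le_lt_trans; apply.
by rewrite mulrC ler_wpM2l ?absval_ge0.
Qed.

End Induced.

(** * The Iwahori eigenfunction *)

Section EdgeFunction.
Variables (R : realType) (F : fieldType) (absF : nonarch_absval R F) (E : fieldType).
Variables (pi : F) (q : nat) (D : digits absF q).
Variables chi1 chi2 : {multiplicative unitg F -> unitg E}.
Hypothesis pi_unif : uniformizer absF pi.
Hypothesis tame1 : forall x, absF (x - 1) < 1 -> xch chi1 x = 1.
Hypothesis tame2 : forall x, absF (x - 1) < 1 -> xch chi2 x = 1.
Notation Ind := (Ind absF chi1 chi2).
Notation sigma := (Ind_repn absF chi1 chi2).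
Implicit Types (f : Ind) (g h k : GL2 F) (t r : F).

Let pi0 : pi != 0 := unif_neq0 pi_unif.

Definition lower_unip t : GL2 F := gl2 1 0 t 1.
Definition upper_unip t : GL2 F := gl2 1 t 0 1.
Definition shift_mx r : GL2 F := gl2 pi 0 r 1.
Definition flip_mx : GL2 F := gl2 0 pi 1 0.
Definition scalar_gl t : GL2 F := gl2 t 0 0 t.

Lemma lower_unipE t : uval (lower_unip t) = mx2 1 0 t 1.
Proof. by rewrite gl2E // mul0r subr0 mulr1 oner_eq0. Qed.

Lemma upper_unipE t : uval (upper_unip t) = mx2 1 t 0 1.
Proof. by rewrite gl2E // mulr0 subr0 mulr1 oner_eq0. Qed.

Lemma shift_mxE r : uval (shift_mx r) = mx2 pi 0 r 1.
Proof. by rewrite gl2E // mul0r subr0 mulr1. Qed.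

Lemma flip_mxE : uval flip_mx = mx2 0 pi 1 0.
Proof. by rewrite gl2E // mul0r sub0r mulr1 oppr_eq0. Qed.

Lemma scalar_glE t : t != 0 -> uval (scalar_gl t) = t%:M.
Proof.
move=> t0; rewrite gl2E ?mul0r ?subr0 ?mulf_neq0 //.
by apply: mx2_eq; rewrite !mxE ?mulr1n ?mulr0n.
Qed.

Lemma gl_inv g h : uval g *m uval h = 1%:M -> (g^-1)%g = h.
Proof.
move=> gh; have e : (g * h)%g = 1%g by apply: uval_inj.
by rewrite -[LHS]mulg1 -e mulgA mulVg mul1g.
Qed.

Lemma shift_mxVE r : uval (shift_mx r)^-1%g = mx2 pi^-1 0 (- r / pi) 1.
Proof.
have e : uval (gl2 pi^-1 0 (- r / pi) 1) = mx2 pi^-1 0 (- r / pi) 1.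
  by rewrite gl2E // mul0r subr0 mulr1 invr_eq0.
rewrite (@gl_inv _ (gl2 pi^-1 0 (- r / pi) 1)) ?e // shift_mxE mx2_mul.
rewrite -[RHS]/(1 : 'M_2) mx2_1; by congr mx2; field; rewrite ?pi0.
Qed.

Lemma flip_mxVE : uval flip_mx^-1%g = mx2 0 1 pi^-1 0.
Proof.
have e : uval (gl2 0 1 pi^-1 0) = mx2 0 1 pi^-1 0.
  by rewrite gl2E // mul0r sub0r mul1r oppr_eq0 invr_eq0.
rewrite (@gl_inv _ (gl2 0 1 pi^-1 0)) ?e // flip_mxE mx2_mul.
rewrite -[RHS]/(1 : 'M_2) mx2_1; by congr mx2; field; rewrite ?pi0.
Qed.

Lemma det_shift r : \det (uval (shift_mx r)) = pi.
Proof. by rewrite shift_mxE det_mx2 mul0r subr0 mulr1. Qed.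

Lemma det_flip : \det (uval flip_mx) = - pi.
Proof. by rewrite flip_mxE det_mx2 mul0r sub0r mulr1. Qed.

Lemma flip_mx_sq : (flip_mx * flip_mx)%g = scalar_gl pi.
Proof.
apply: uval_inj; rewrite uvalM flip_mxE scalar_glE // mx2_mul.
by apply: mx2_eq; rewrite !mxE /= ?mulr1n ?mulr0n; ring.
Qed.

(** The bottom row is proportional to [(t, 1)] or to [(1, pi * t)] with [t] integral, according to
    which entry dominates. This covers P^1(F) by the ends of the two half-trees cut off by the root
    edge. *)
Lemma row_decomposition g : exists t, absF t <= 1 /\
  exists a s d, [/\ a != 0, d != 0 &
    uval g = mx2 a s 0 d *m uval (lower_unip t) \/
    uval g = mx2 a s 0 d *m uval (lower_unip t * flip_mx)%g].
Proof.
have := det_neq0 g; rewrite det_entries.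
set a := uval g 0 0; set b := uval g 0 1; set c := uval g 1 0; set d := uval g 1 1.
move=> D0; have gE : uval g = mx2 a b c d by exact: mx2_eta.
have [cd|dc] := leP (absF c) (absF d).
  have d0 : d != 0.
    apply: contraNneq D0 => d0; have c0 : c = 0.
      by apply/eqP; rewrite -(absval_eq0b absF) eq_le absval_ge0 andbT (le_trans cd) // d0 absval0.
    by rewrite c0 d0 !mulr0 subrr.
  exists (c / d); split.
    by rewrite absvalM absvalV ler_pdivrMr ?mul1r // absval_gt0.
  exists ((a * d - b * c) / d), b, d; split=> //; first by rewrite mulf_neq0 ?invr_eq0.
  by left; rewrite lower_unipE mx2_mul gE; congr mx2; field; rewrite ?d0.
have c0 : c != 0 by rewrite -(absval_gt0 absF) (le_lt_trans _ dc) ?absval_ge0.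
exists (d / c / pi); split.
  apply: (unif_div_le pi_unif).
  by rewrite absvalM absvalV ltr_pdivrMr ?mul1r // absval_gt0.
exists (- (a * d - b * c) / c / pi), a, c; split=> //.
  by rewrite !mulf_neq0 ?oppr_eq0 ?invr_eq0.
right; rewrite uvalM flip_mxE lower_unipE !mx2_mul gE; congr mx2; field; rewrite ?c0 ?pi0 //.
Qed.

Lemma Ind_ext f f' :
  (forall t, absF t <= 1 -> f (lower_unip t) = f' (lower_unip t)) ->
  (forall t, absF t <= 1 -> f (lower_unip t * flip_mx)%g = f' (lower_unip t * flip_mx)%g) ->
  f = f'.
Proof.
move=> h1 h2; apply/val_inj/funext => g /=.
have [t [t1 [a [s [d [a0 d0 [gE|gE]]]]]]] := row_decomposition g.
  by rewrite !(Ind_borel _ a0 d0 gE) h1.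
by rewrite !(Ind_borel _ a0 d0 gE) h2.
Qed.

(* The value at a matrix with bottom row (x, y) and determinant d. *)
Definition edge_val (x y d : F) : E :=
  if absF x <= absF y then xch chi1 (d / y) * xch chi2 y else 0.

Definition edge_fun (g : GL2 F) : E^o :=
  edge_val (uval g 1 0) (uval g 1 1) (\det (uval g)).

Lemma edge_funE g a b c d :
  uval g = mx2 a b c d -> edge_fun g = edge_val c d (a * d - b * c).
Proof. by move=> gE; rewrite /edge_fun gE det_mx2 !mxE. Qed.

(** Lower triangular modulo [pi]: the stabiliser of the oriented root edge in the maximal compact
    subgroup. Conjugation by [flip_mx] preserves it. *)
Definition iwahori k : Prop :=
  [/\ absF (uval k 0 0) = 1, absF (uval k 0 1) < 1,
      absF (uval k 1 0) <= 1 & absF (uval k 1 1) = 1].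

(** If [|x| <= |y|], right multiplication by [k] turns [y] into [y * uval k 1 1] times some [u]
    close to 1, and tameness kills [u]; if [|y| < |x|], the first entry still dominates
    afterwards. *)
Lemma edge_fun_iwahori g k : iwahori k -> edge_fun (g * k)%g =
  xch chi1 (\det (uval k) / uval k 1 1) * xch chi2 (uval k 1 1) * edge_fun g.
Proof.
case=> k00 k01 k10 k11; rewrite /edge_fun !row_mul detM /edge_val.
set x := uval g 1 0; set y := uval g 1 1.
have k110 : uval k 1 1 != 0 by rewrite -(absval_gt0 absF) k11.
have [xy|yx] := leP (absF x) (absF y).
  have [y0|y0] := eqVneq y 0.
    have x0 : x = 0.
      by apply/eqP; rewrite -(absval_eq0b absF) eq_le absval_ge0 andbT (le_trans xy) // y0 absval0.
    by rewrite x0 y0 !mul0r !addr0 !xch0 !mulr0 if_same.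
  have vy : 0 < absF y by rewrite absval_gt0.
  have lt1 : absF (x * uval k 0 1) < absF (y * uval k 1 1).
    rewrite !absvalM k11 mulr1; apply: le_lt_trans (_ : absF y * absF (uval k 0 1) < _).
      by rewrite ler_wpM2r ?absval_ge0.
    by rewrite gtr_pMr.
  have vy' : absF (x * uval k 0 1 + y * uval k 1 1) = absF y.
    by rewrite absvalD_eq // absvalM k11 mulr1.
  rewrite vy' ifT; last first.
    apply: absvalD_le; rewrite absvalM ?k00 ?mulr1 //.
    by rewrite ler_piMr ?absval_ge0.
  set y' := x * _ + _; pose u := y' / (y * uval k 1 1).
  have uE : absF (u - 1) < 1.
    have -> : u - 1 = x * uval k 0 1 / (y * uval k 1 1).
      by rewrite /u /y' mulrDl divff ?addrK // mulf_neq0.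
    by rewrite absvalM absvalV ltr_pdivrMr ?mul1r // absval_gt0 mulf_neq0.
  have -> : y' = y * uval k 1 1 * u by rewrite /u mulrC divfK // mulf_neq0.
  clearbody u.
  rewrite !invfM !xchM !xchV (tame1 uE) (tame2 uE) invr1 !mulr1; ring.
rewrite mulr0 ifF //; apply/negbTE; rewrite -ltNge.
have vx : 0 < absF x by apply: le_lt_trans yx; exact: absval_ge0.
have -> : absF (x * uval k 0 0 + y * uval k 1 0) = absF x.
  rewrite addrC absvalD_eq !absvalM k00 mulr1 //.
  by apply: le_lt_trans yx; rewrite ler_piMr ?absval_ge0.
apply: absvalD_lt; rewrite absvalM ?k11 ?mulr1 //.
by rewrite gtr_pMr.
Qed.

Fact edge_Ind : edge_fun \in Ind_mem absF chi1 chi2.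
Proof.
rewrite inE; apply: Ind_pred_near => [g h a s d a0 d0 gE|].
  have r0 : uval g 1 0 = d * uval h 1 0.
    by rewrite gE [uval h]mx2_eta mx2_mul !mxE /= mul0r add0r.
  have r1 : uval g 1 1 = d * uval h 1 1.
    by rewrite gE [uval h]mx2_eta mx2_mul !mxE /= mul0r add0r.
  have dE : \det (uval g) = a * d * \det (uval h).
    by rewrite gE det_mulmx det_mx2 mulr0 subr0.
  rewrite /edge_fun r0 r1 dE /edge_val !absvalM ler_pM2l ?absval_gt0 //.
  case: ifP => _; last by rewrite mulr0.
  have -> : a * d * \det (uval h) / (d * uval h 1 1) = a * (\det (uval h) / uval h 1 1).
    by rewrite invfM mulrACA mulfK.
  rewrite !xchM; ring.
exists 1; first exact: ltr01.
move=> u u1 g.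
have [u00 u01 u10 u11] : [/\ absF (uval u 0 0 - 1) < 1, absF (uval u 0 1) < 1,
    absF (uval u 1 0) < 1 & absF (uval u 1 1 - 1) < 1].
  split; [exact: (u1 0 0)| | |exact: (u1 1 1)].
    by have := u1 0 1; rewrite subr0.
  by have := u1 1 0; rewrite subr0.
have v00 := absval_near1 u00; have v11 := absval_near1 u11.
rewrite edge_fun_iwahori; last by split=> //; exact: ltW.
rewrite (tame2 u11) mulr1 tame1 ?mul1r // det_entries.
have u110 : uval u 1 1 != 0 by rewrite -(absval_gt0 absF) v11.
have -> : (uval u 0 0 * uval u 1 1 - uval u 0 1 * uval u 1 0) / uval u 1 1 - 1 =
  (uval u 0 0 - 1) - uval u 0 1 * uval u 1 0 / uval u 1 1 by field.
apply: absvalB_lt => //; rewrite absvalM absvalV v11 invr1 mulr1 mulrC.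
by apply: absval_mul_lt => //; exact: ltW.
Qed.

Definition edge : Ind := MkInd edge_Ind.

Lemma edgeE g a b c d :
  uval g = mx2 a b c d -> edge g = edge_val c d (a * d - b * c).
Proof. exact: edge_funE. Qed.

Lemma edge_val0 x y d : absF y < absF x -> edge_val x y d = 0.
Proof. by move=> yx; rewrite /edge_val leNgt yx. Qed.

Lemma edge_val1 x y d : absF x <= absF y -> edge_val x y d = xch chi1 (d / y) * xch chi2 y.
Proof. by rewrite /edge_val => ->. Qed.

Lemma pi_t_lt t : absF t <= 1 -> absF (pi * t) < 1.
Proof. by move=> t1; rewrite mulrC; apply: absval_mul_lt => //; exact: unif_lt1 pi_unif. Qed.

Lemma invpi_gt1 : 1 < absF pi^-1.
Proof. by rewrite absvalV invf_gt1 ?(unif_gt0 pi_unif) ?(unif_lt1 pi_unif). Qed.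

Lemma edge_lower t : absF t <= 1 -> edge (lower_unip t) = 1.
Proof.
move=> t1; rewrite (edgeE (lower_unipE t)) edge_val1 ?absval1 //.
by rewrite mulr1 mul0r subr0 divr1 !xch1 mulr1.
Qed.

Lemma lower_flipE t : uval (lower_unip t * flip_mx)%g = mx2 0 pi 1 (pi * t).
Proof. by rewrite uvalM lower_unipE flip_mxE mx2_mul; congr mx2; ring. Qed.

Lemma edge_flip t : absF t <= 1 -> edge (lower_unip t * flip_mx)%g = 0.
Proof. by move=> t1; rewrite (edgeE (lower_flipE t)) edge_val0 // absval1 pi_t_lt. Qed.

(** On integral [t] the translate is a multiple of the indicator of the residue disc of [r]: the
    half-tree of a child. *)
Lemma edge_shiftV_lower t r : absF t <= 1 -> edge (lower_unip t * (shift_mx r)^-1)%g =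
  if absF (t - r) < 1 then (xch chi1 pi)^-1 else 0.
Proof.
move=> t1.
have e : uval (lower_unip t * (shift_mx r)^-1)%g = mx2 pi^-1 0 ((t - r) / pi) 1.
  by rewrite uvalM lower_unipE shift_mxVE mx2_mul; congr mx2; ring.
rewrite (edgeE e); case: ltP => tr.
  rewrite edge_val1 ?absval1 ?(unif_div_le pi_unif) //.
  by rewrite mul0r subr0 divr1 mulr1 xch1 mulr1 xchV.
rewrite edge_val0 // absval1 absvalM; apply: lt_le_trans invpi_gt1 _.
by rewrite ler_peMl ?absval_ge0.
Qed.

Lemma edge_shiftV_flip t r : absF t <= 1 -> absF r <= 1 ->
  edge (lower_unip t * flip_mx * (shift_mx r)^-1)%g = 0.
Proof.
move=> t1 r1.
have e : uval (lower_unip t * flip_mx * (shift_mx r)^-1)%g =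
    mx2 (- r) pi (pi^-1 - r * t) (pi * t).
  rewrite uvalM lower_flipE shift_mxVE mx2_mul; by congr mx2; field; rewrite ?pi0.
rewrite (edgeE e) edge_val0 //; apply: lt_trans (pi_t_lt t1) _.
rewrite addrC absvalD_eq ?invpi_gt1 // absvalN.
by apply: le_lt_trans invpi_gt1; apply: absval_mul_le.
Qed.

Lemma digit_near_eq (t : F) (i j : 'I_q) :
  absF (t - D i) < 1 -> (absF (t - D j) < 1) = (j == i).
Proof.
move=> ti; apply/idP/eqP => [tj|-> //]; apply/eqP/negPn/negP => ij.
have := dig_sep D ij.
have -> : D j - D i = (t - D i) - (t - D j) by ring.
by move=> e; have := absvalB_lt ti tj; rewrite e ltxx.
Qed.

Lemma IndD f f' g : (f + f') g = f g + f' g. Proof. by []. Qed.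
Lemma IndZ a f g : (a *: f) g = a * f g. Proof. by []. Qed.

Lemma Ind_sum (I : Type) (s : seq I) (P : pred I) (f : I -> Ind) g :
  (\sum_(i <- s | P i) f i) g = \sum_(i <- s | P i) f i g.
Proof. by elim/big_rec2: _ => // i x y _ <-. Qed.

Lemma sigmaE g f h : sigma g f h = f (h * g)%g. Proof. by []. Qed.

Definition eta (x : F) : E := xch chi2 x / xch chi1 x.

Lemma eta_near x y : x != 0 -> absF (x - y) < absF y -> eta x = eta y.
Proof.
move=> x0 xy; have y0 : y != 0 by rewrite -(absval_gt0 absF) (le_lt_trans _ xy) ?absval_ge0.
have xE : x = x / y * y by rewrite divfK.
have n1 : absF (x / y - 1) < 1.
  rewrite -{1}(divff y0) -mulrBl absvalM absvalV ltr_pdivrMr ?mul1r //.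
  by rewrite absval_gt0.
by rewrite /eta xE !(xchM _ (x / y) y) (tame1 n1) (tame2 n1) !mul1r.
Qed.

(** Outside the disc of [r] the difference [t - r] is a unit, on which the value depends through
    [eta]; by tameness it is constant on each other residue disc. *)
Lemma edge_back_lower t r : absF t <= 1 -> absF r <= 1 ->
  edge (lower_unip t * ((shift_mx r)^-1 * flip_mx^-1))%g =
  if absF (t - r) < 1 then 0
  else (xch chi2 pi)^-1 * (xch chi1 (-1) * (eta (t - r) * (xch chi1 pi)^-1)).
Proof.
move=> t1 r1.
have e : uval (lower_unip t * ((shift_mx r)^-1 * flip_mx^-1))%g =
    mx2 0 pi^-1 pi^-1 ((t - r) / pi).
  by rewrite !uvalM lower_unipE shift_mxVE flip_mxVE !mx2_mul; congr mx2; ring.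
rewrite (edgeE e); case: ltP => tr.
  rewrite edge_val0 // absvalM -[ltRHS]mul1r ltr_pM2r //.
  by rewrite absval_gt0 invr_eq0.
have tr0 : t - r != 0 by rewrite -(absval_gt0 absF) (lt_le_trans ltr01).
rewrite edge_val1; last by rewrite absvalM ler_peMl ?absval_ge0.
have -> : (0 * ((t - r) / pi) - pi^-1 * pi^-1) / ((t - r) / pi) =
  -1 * (t - r)^-1 * pi^-1 by field; rewrite pi0.
rewrite /eta !xchM !xchV; ring.
Qed.

Lemma edge_back_flip t r : absF t <= 1 -> absF r <= 1 ->
  edge (lower_unip t * flip_mx * ((shift_mx r)^-1 * flip_mx^-1))%g = (xch chi2 pi)^-1.
Proof.
move=> t1 r1.
have e : uval (lower_unip t * flip_mx * ((shift_mx r)^-1 * flip_mx^-1))%g =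
    mx2 1 (- r) t (pi^-1 - t * r).
  rewrite uvalM lower_flipE uvalM shift_mxVE flip_mxVE !mx2_mul; by congr mx2; field; rewrite ?pi0.
have u1 : absF ((1 - pi * (t * r)) - 1) < 1.
  by rewrite addrC addKr absvalN pi_t_lt // absval_mul_le.
have u0 : 1 - pi * (t * r) != 0 by rewrite -(absval_gt0 absF) (absval_near1 u1).
have yE : pi^-1 - t * r = (1 - pi * (t * r)) * pi^-1 by rewrite mulrBl mul1r mulrAC divff // mul1r.
rewrite (edgeE e) edge_val1; last first.
  rewrite yE absvalM (absval_near1 u1) mul1r.
  exact: le_trans t1 (ltW invpi_gt1).
have -> : (1 * (pi^-1 - t * r) - - r * t) / (pi^-1 - t * r) = (1 - pi * (t * r))^-1.
  by rewrite yE; field; rewrite u0 pi0.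
by rewrite yE xchM !xchV (tame1 u1) (tame2 u1) invr1 !mul1r.
Qed.

(** The complement of the half-tree of the child [i] consists of the half-tree behind the parent
    edge and of the half-trees of the siblings. Both sides are compared on the two families of
    [Ind_ext]. *)
Lemma edge_back i :
  sigma ((shift_mx (D i))^-1 * flip_mx^-1)%g edge =
  (xch chi2 pi)^-1 *: (sigma flip_mx^-1%g edge + xch chi1 (-1) *:
     \sum_(j | j != i) eta (D j - D i) *: sigma (shift_mx (D j))^-1%g edge).
Proof.
have flipV t : absF t <= 1 -> edge (lower_unip t * flip_mx^-1)%g = 0.
  move=> t1; have e : uval (lower_unip t * flip_mx^-1)%g = mx2 0 1 pi^-1 t.
    by rewrite uvalM lower_unipE flip_mxVE mx2_mul; congr mx2; ring.
  by rewrite (edgeE e) edge_val0 // (le_lt_trans t1) ?invpi_gt1.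
apply: Ind_ext => t t1; rewrite sigmaE IndZ IndD IndZ Ind_sum !sigmaE.
  rewrite flipV // add0r edge_back_lower ?dig_le1 //.
  have [j tj] := dig_near D t1.
  under eq_bigr => l _ do rewrite IndZ sigmaE edge_shiftV_lower // (digit_near_eq _ tj).
  rewrite (digit_near_eq _ tj); have [ij|ij] := eqVneq i j.
    rewrite big1 ?mulr0 // => l; rewrite -ij => /negbTE ->; exact: mulr0.
  rewrite (bigD1 j) ?eqxx 1?eq_sym //= big1 ?addr0 => [|l /andP[_ /negbTE ->]]; last exact: mulr0.
  congr (_ * (_ * (_ * _))); apply: eta_near.
    apply: contraNneq ij => e; rewrite -(digit_near_eq _ tj) e absval0; exact: ltr01.
  by rewrite dig_sep 1?eq_sym // opprB addrA subrK.
rewrite mulgK edge_lower // edge_back_flip ?dig_le1 //.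
rewrite big1 ?mulr0 ?addr0 ?mulr1 // => j _.
by rewrite IndZ sigmaE edge_shiftV_flip ?dig_le1 // mulr0.
Qed.

End EdgeFunction.

(** * Linear forms built along the tree *)

Section BoundaryFunctional.
Variables (R : realType) (F : fieldType) (absF : nonarch_absval R F) (E : fieldType).
Variables (pi : F) (q : nat) (D : digits absF q).
Variables chi1 chi2 : {multiplicative unitg F -> unitg E}.
Hypothesis pi_unif : uniformizer absF pi.
Hypothesis tame1 : forall x, absF (x - 1) < 1 -> xch chi1 x = 1.
Hypothesis tame2 : forall x, absF (x - 1) < 1 -> xch chi2 x = 1.
Notation Ind := (Ind absF chi1 chi2).
Notation sigma := (Ind_repn absF chi1 chi2).
Notation edge := (edge tame1 tame2).
Notation shift := (shift_mx pi).
Notation flip := (flip_mx pi).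
Variables (T : lmodType E) (tau : repn (GL2 F) T).
(* A state describes the linear form along an edge, translated by some g to the
   edge carrying [edge]: [fwd s v] stands for its value at g (v (x) edge), [bwd s v]
   for its value at g flip^-1 (v (x) edge), on the opposite orientation; [step s i]
   is the state at the i-th following edge, for g (shift (D i))^-1. *)
Variables (St : Type) (fwd bwd : St -> T -> E) (step : St -> 'I_q -> St).
Variable ok : St -> Prop.
Hypothesis fwd_linear : forall s a v w, fwd s (a *: v + w) = a * fwd s v + fwd s w.
Hypothesis ok_step : forall s i, ok s -> ok (step s i).
(** Additivity over the children: [edge] is [xch chi1 pi] times the sum of its translates by the
    [(shift (D i))^-1]. Likewise [bwd_step] transcribes [edge_back]. *)
Hypothesis fwd_split : forall s v, ok s ->
  fwd s v = xch chi1 pi * \sum_i fwd (step s i) (tau (shift (D i)) v).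
Hypothesis bwd_step : forall s i v, ok s -> bwd (step s i) v =
  (xch chi2 pi)^-1 * (bwd s (tau (flip * (shift (D i))^-1 * flip^-1)%g v) +
    xch chi1 (-1) * \sum_(j | j != i) eta chi1 chi2 (D j - D i) *
      fwd (step s j) (tau (shift (D j) * (shift (D i))^-1 * flip^-1)%g v)).

Implicit Types (f : Ind) (v : T) (s : St) (t u : F).

Let pi0 : pi != 0 := unif_neq0 pi_unif.
Let sigmaM g h f : sigma (g * h)%g f = sigma g (sigma h f) := ractM sigma g h f.
Let tauM g h v : tau (g * h)%g v = tau g (tau h v) := ractM tau g h v.

Lemma sigma_lin g a f f' : sigma g (a *: f + f') = a *: sigma g f + sigma g f'.
Proof. exact: ract_linear. Qed.

(** Riemann sum over the q^N discs of depth [N]; after the shifts, [f 1%g] samples the function at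
    one point of each disc. *)
Fixpoint Riemann N s v f : E :=
  if N is N'.+1 then
    \sum_i Riemann N' (step s i) (tau (shift (D i)) v) (sigma (shift (D i)) f)
  else fwd s v * f 1%g.

Lemma RiemannS N s v f : Riemann N.+1 s v f =
  \sum_i Riemann N (step s i) (tau (shift (D i)) v) (sigma (shift (D i)) f).
Proof. by []. Qed.

Lemma Riemann_linl N s a v w f :
  Riemann N s (a *: v + w) f = a * Riemann N s v f + Riemann N s w f.
Proof.
elim: N s v w f => [|N IH] s v w f /=; first by rewrite fwd_linear mulrDl mulrA.
by rewrite mulr_sumr -big_split; apply: eq_bigr => i _; rewrite ract_linear IH.
Qed.

Lemma Riemann_linr N s a v f f' :
  Riemann N s v (a *: f + f') = a * Riemann N s v f + Riemann N s v f'.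
Proof.
elim: N s v f f' => [|N IH] s v f f'.
  by rewrite /Riemann IndD IndZ mulrDr mulrCA.
rewrite !RiemannS mulr_sumr -big_split; apply: eq_bigr => i _.
by rewrite sigma_lin IH.
Qed.

Definition level M f := forall t u, absF t <= 1 -> absF u <= 1 ->
  f (lower_unip (t + pi ^+ M * u)) = f (lower_unip t).

Lemma lower_unipD t u : lower_unip (t + u) = (lower_unip t * lower_unip u)%g.
Proof.
by apply: uval_inj; rewrite uvalM !lower_unipE mx2_mul; congr mx2; ring.
Qed.

Lemma lower_unip0 : lower_unip (0 : F) = 1%g.
Proof. by apply: uval_inj; rewrite lower_unipE -mx2_1. Qed.

Lemma level_exists f : exists M, level M f.
Proof.
have [e e0 fe] := Ind_smooth f.
have [M Me] := unif_expr_lt pi_unif e0.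
exists M => t u t1 u1; rewrite lower_unipD fe // => i j.
rewrite lower_unipE mxE.
case: (ord2_cases i) => ->; case: (ord2_cases j) => -> /=; rewrite ?subrr ?subr0 ?absval0 //.
rewrite absvalM absvalX; apply: le_lt_trans Me.
by rewrite ler_piMr // exprn_ge0 ?absval_ge0.
Qed.

Lemma level_le M N f : (M <= N)%N -> level M f -> level N f.
Proof.
move=> MN lM t u t1 u1; rewrite -(subnKC MN) exprD -mulrA lM //.
apply: absval_mul_le => //; rewrite absvalX exprn_ile1 ?absval_ge0 //.
exact: ltW (unif_lt1 pi_unif).
Qed.

Lemma shift_lower f i t : sigma (shift (D i)) f (lower_unip t) =
  xch chi1 pi * f (lower_unip (pi * t + D i)).
Proof.
rewrite sigmaE (@Ind_borel _ _ _ _ _ _ f _ (lower_unip (pi * t + D i)) pi 0 1).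
- by rewrite xch1 mulr1.
- exact: pi0.
- exact: oner_neq0.
by rewrite uvalM !lower_unipE (shift_mxE pi_unif) !mx2_mul; congr mx2; ring.
Qed.

Lemma shift_arg_le t i : absF t <= 1 -> absF (pi * t + D i) <= 1.
Proof.
move=> t1; apply: absvalD_le; last exact: dig_le1.
exact: ltW (pi_t_lt pi_unif t1).
Qed.

Lemma level_shift M f i : level M.+1 f -> level M (sigma (shift (D i)) f).
Proof.
move=> lM t u t1 u1; rewrite !shift_lower; congr (_ * _).
have -> : pi * (t + pi ^+ M * u) + D i = (pi * t + D i) + pi ^+ M.+1 * u.
  by rewrite exprS; ring.
by rewrite lM // shift_arg_le.
Qed.

(** Refinement is harmless: the factor [xch chi1 pi] that each shift puts on [f] is the one of
    [fwd_split]. *)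
Lemma Riemann_const N s v f : ok s -> level 0 f -> Riemann N s v f = fwd s v * f 1%g.
Proof.
elim: N s v f => [//|N IH] s v f oks l0.
have fc t : absF t <= 1 -> f (lower_unip t) = f 1%g.
  move=> t1; rewrite -lower_unip0 -[t]add0r -[t in LHS]mul1r -[1 in LHS](expr0 pi).
  by apply: l0; rewrite ?absval0 ?ler01.
rewrite RiemannS fwd_split // mulrAC mulrC mulr_suml; apply: eq_bigr => i _.
rewrite IH; last 2 first.
- exact: ok_step.
- by move=> t u t1 u1; rewrite !shift_lower !fc // shift_arg_le // expr0 mul1r absvalD_le.
by rewrite -lower_unip0 shift_lower fc ?shift_arg_le ?absval0 ?ler01 // lower_unip0.
Qed.

Lemma Riemann_stable M N s v f : ok s -> level M f -> (M <= N)%N ->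
  Riemann N s v f = Riemann M s v f.
Proof.
elim: M N s v f => [|M IH] N s v f oks lM; first by rewrite Riemann_const.
case: N => // N; rewrite ltnS => MN; rewrite !RiemannS; apply: eq_bigr => i _.
by apply: IH => //; [exact: ok_step|exact: level_shift].
Qed.

(** The level is an arbitrary choice; [integralE] shows that it does not matter at states that are
    [ok]. *)
Definition integral s v f : E := Riemann (projT1 (cid (level_exists f))) s v f.

Lemma integralE M s v f : ok s -> level M f -> integral s v f = Riemann M s v f.
Proof.
move=> oks lM; rewrite /integral; case: cid => M' lM' /=.
rewrite -(Riemann_stable v oks lM (leq_maxl M M')).
by rewrite -(Riemann_stable v oks lM' (leq_maxr M M')).
Qed.

Lemma integral_linl s a v w f :
  integral s (a *: v + w) f = a * integral s v f + integral s w f.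
Proof. exact: Riemann_linl. Qed.

Lemma integral_linr s a v f f' : ok s ->
  integral s v (a *: f + f') = a * integral s v f + integral s v f'.
Proof.
move=> oks; have [M lM] := level_exists f; have [M' lM'] := level_exists f'.
have l := level_le (leq_maxl M M') lM; have l' := level_le (leq_maxr M M') lM'.
rewrite (integralE _ oks l) (integralE _ oks l').
rewrite (@integralE (maxn M M')) ?Riemann_linr // => t u t1 u1.
by rewrite !IndD !IndZ l // l'.
Qed.

Lemma integral_step s v f : ok s -> integral s v f =
  \sum_i integral (step s i) (tau (shift (D i)) v) (sigma (shift (D i)) f).
Proof.
move=> oks; have [M lM] := level_exists f; have l := level_le (leqnSn M) lM.
rewrite (integralE _ oks l) RiemannS; apply: eq_bigr => i _.
by rewrite (@integralE M) //; [exact: ok_step|exact: level_shift].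
Qed.

Lemma integral_0 s v f : ok s ->
  (forall t, absF t <= 1 -> f (lower_unip t) = 0) -> integral s v f = 0.
Proof.
move=> oks f0; rewrite (@integralE 0) //.
  by rewrite /Riemann -lower_unip0 f0 ?mulr0 // absval0 ler01.
by move=> t u t1 u1; rewrite !f0 // expr0 mul1r absvalD_le.
Qed.

Lemma integral_edge s v : ok s -> integral s v edge = fwd s v.
Proof.
move=> oks; rewrite (@integralE 0) //.
  by rewrite /Riemann -lower_unip0 edge_lower ?mulr1 // absval0 ler01.
by move=> t u t1 u1; rewrite !edge_lower // expr0 mul1r absvalD_le.
Qed.

(* Supported on the rows proportional to some (t, 1) with t integral. *)
Definition inner f := forall t, absF t <= 1 -> f (lower_unip t * flip)%g = 0.

Lemma inner_edge : inner edge.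
Proof. by move=> t t1; rewrite (edge_flip pi_unif). Qed.

(** The half-tree of a child lies inside that of its parent. *)
Lemma inner_shiftV f i : inner f -> inner (sigma (shift (D i))^-1%g f).
Proof.
move=> f0 t t1; rewrite sigmaE; pose u := 1 - pi * (D i * t).
have u1 : absF (u - 1) < 1.
  by rewrite /u addrC addKr absvalN (pi_t_lt pi_unif) // absval_mul_le ?dig_le1.
have u0 : u != 0 by rewrite -(absval_gt0 absF) (absval_near1 u1).
rewrite (@Ind_borel _ _ _ _ _ _ f _ (lower_unip (pi * t / u) * flip)%g u^-1 (- D i) (u / pi)).
- rewrite f0 ?mulr0 // absvalM absvalV (absval_near1 u1) invr1 mulr1.
  exact: ltW (pi_t_lt pi_unif t1).
- by rewrite invr_eq0.
- by rewrite mulf_neq0 ?invr_eq0.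
rewrite uvalM !(lower_flipE pi_unif) (shift_mxVE pi_unif) !mx2_mul.
by congr mx2; rewrite /u; field; rewrite ?pi0 ?andbT.
Qed.

(** The half-trees of two siblings have no common end. *)
Lemma inner_other f i j : inner f -> i != j ->
  forall t, absF t <= 1 -> sigma (shift (D i) * (shift (D j))^-1)%g f (lower_unip t) = 0.
Proof.
move=> f0 ij t t1; rewrite sigmaE; pose x := pi * t + (D i - D j).
have x1 : absF x = 1 by rewrite /x absvalD_eq dig_sep // (pi_t_lt pi_unif).
have x0 : x != 0 by rewrite -(absval_gt0 absF) x1.
rewrite (@Ind_borel _ _ _ _ _ _ f _ (lower_unip x^-1 * flip)%g (- x^-1) 1 (x / pi)).
- by rewrite f0 ?mulr0 // absvalV x1 invr1.
- by rewrite oppr_eq0 invr_eq0.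
- by rewrite mulf_neq0 ?invr_eq0.
rewrite !uvalM !lower_unipE (flip_mxE pi_unif) (shift_mxE pi_unif) (shift_mxVE pi_unif) !mx2_mul.
by congr mx2; rewrite /x; field; rewrite ?pi0 ?andbT //=.
Qed.

(** [L] is the global form transported to an edge with state [s]. Only its restriction to the
    functions on the forward half-tree and its value at the reversed edge are recorded; this is just
    enough to pass to a child. *)
Definition compatible s (L : T -> Ind -> E) : Prop :=
  [/\ forall a v f f', L v (a *: f + f') = a * L v f + L v f',
      forall v f, inner f -> L v f = integral s v f &
      forall v, L (tau flip^-1%g v) (sigma flip^-1%g edge) = bwd s v].

(** By [edge_back] the reversed child edge consists of the reversed parent edge, where [L] is
    [bwd s], and of sibling edges, where [L] is given by the [fwd] of their states; [bwd_step] is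
    this identity. *)
Lemma compatible_step s L i : ok s -> compatible s L ->
  compatible (step s i)
    (fun v f => L (tau (shift (D i))^-1%g v) (sigma (shift (D i))^-1%g f)).
Proof.
move=> oks [L_lin L_in L_bwd].
have L_inner j v f : inner f ->
    L (tau (shift (D j))^-1%g v) (sigma (shift (D j))^-1%g f) = integral (step s j) v f.
  move=> f_in; rewrite L_in; last exact: inner_shiftV.
  rewrite integral_step // (bigD1 j) // big1 ?addr0 => [|l lj].
    by rewrite -tauM -sigmaM mulgV !ract1; exact: addr0.
  apply: integral_0 => [|t t1]; first exact: ok_step.
  by rewrite -sigmaM inner_other.
split=> [a v f f'|v f|v]; [by rewrite sigma_lin L_lin|exact: L_inner|].
have L0 v' : L v' 0 = 0 by have := L_lin (-1) v' 0 0; rewrite scaleN1r oppr0 addr0 mulN1r addNr.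
have LZ a v' f : L v' (a *: f) = a * L v' f by rewrite -[a *: f]addr0 L_lin L0 addr0.
have LD v' f f' : L v' (f + f') = L v' f + L v' f' by rewrite -[f]scale1r L_lin mul1r scale1r.
have Lsum v' (P : pred 'I_q) (f : 'I_q -> Ind) :
    L v' (\sum_(j | P j) f j) = \sum_(j | P j) L v' (f j).
  by elim/big_rec2: _ => // j x y _ <-; rewrite LD.
rewrite -tauM -sigmaM (edge_back D pi_unif) LZ LD LZ Lsum bwd_step //; congr (_ * (_ + _ * _)).
  by rewrite -L_bwd -!tauM !mulgA mulVg mul1g.
apply: eq_bigr => j ji; rewrite LZ; congr (_ * _).
set y := tau _ v; have -> : y = tau (shift (D j))^-1%g (tau (shift (D j)) y).
  by rewrite -tauM mulVg ract1.
rewrite L_inner; last exact: inner_edge.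
by rewrite integral_edge -/y; [rewrite /y -tauM mulgA|exact: ok_step].
Qed.

Fixpoint word_mx (w : seq 'I_q) : GL2 F :=
  if w is i :: w' then ((shift (D i))^-1 * word_mx w')%g else 1%g.

Lemma compatible_word w s L : ok s -> compatible s L ->
  exists s', [/\ ok s', forall v, L (tau (word_mx w) v) (sigma (word_mx w) edge) = fwd s' v &
    forall v, L (tau (word_mx w * flip^-1)%g v) (sigma (word_mx w * flip^-1)%g edge) = bwd s' v].
Proof.
elim: w s L => [|i w IH] s L oks cL; rewrite [word_mx _]/=.
  exists s; split=> // v; last by rewrite mul1g; case: cL => _ _ ->.
  by rewrite !ract1; case: cL => _ L_in _; rewrite L_in ?integral_edge //; exact: inner_edge.
have [s' [oks' h1 h2]] := IH _ _ (ok_step i oks) (compatible_step i oks cL).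
by exists s'; split=> // v; rewrite -?mulgA tauM sigmaM ?h1 ?h2.
Qed.

Variables s0 s1 : St.
Hypothesis ok0 : ok s0.
Hypothesis ok1 : ok s1.
(** [s0] and [s1] sit on the two orientations of the root edge. Reversing twice is translation by
    [flip^-1 * flip^-1], which is central; hence the scalars in [bwd1]. *)
Hypothesis bwd0 : forall v, bwd s0 v = fwd s1 v.
Hypothesis bwd1 : forall v, bwd s1 v =
  (xch chi1 pi * xch chi2 pi)^-1 * fwd s0 (tau (scalar_gl pi)^-1%g v).

(** One term for each half of P^1(F); the outer half is brought to the inner one by [flip]. *)
Definition boundary v f : E :=
  integral s0 v f + integral s1 (tau flip v) (sigma flip f).

Lemma boundary_linl a v w f :
  boundary (a *: v + w) f = a * boundary v f + boundary w f.
Proof. by rewrite /boundary ract_linear !integral_linl mulrDr addrACA. Qed.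

Lemma boundary_linr a v f f' :
  boundary v (a *: f + f') = a * boundary v f + boundary v f'.
Proof. by rewrite /boundary sigma_lin !integral_linr // mulrDr addrACA. Qed.

Lemma boundary_Zr a v f : boundary v (a *: f) = a * boundary v f.
Proof.
have b0 : boundary v 0 = 0.
  by have := boundary_linr (-1) v 0 0; rewrite scaleN1r oppr0 addr0 mulN1r addNr.
by rewrite -[a *: f]addr0 boundary_linr b0 addr0.
Qed.

Lemma boundary_Zl a v f : boundary (a *: v) f = a * boundary v f.
Proof.
have b0 : boundary 0 f = 0.
  by have := boundary_linl (-1) 0 0 f; rewrite scaleN1r oppr0 addr0 mulN1r addNr.
by rewrite -[a *: v]addr0 boundary_linl b0 addr0.
Qed.

Lemma sigma_scalar c f : c != 0 -> sigma (scalar_gl c) f = (xch chi1 c * xch chi2 c) *: f.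
Proof.
move=> c0; apply/val_inj/funext => g /=; rewrite (Ind_scalar _ c0 (h := g)) //.
by rewrite uvalM scalar_glE // mul_mx_scalar.
Qed.

Lemma boundary_edge v : boundary v edge = fwd s0 v.
Proof.
rewrite /boundary integral_edge // [X in _ + X]integral_0 ?addr0 // => t t1.
by rewrite sigmaE inner_edge.
Qed.

Lemma flipV_E : (flip^-1 = flip * (scalar_gl pi)^-1)%g.
Proof. by rewrite -(flip_mx_sq pi_unif) invgM mulgA mulgV mul1g. Qed.

Lemma sigma_scalarV c f : c != 0 ->
  sigma (scalar_gl c)^-1%g f = (xch chi1 c * xch chi2 c)^-1 *: f.
Proof.
move=> c0; have x0 : xch chi1 c * xch chi2 c != 0 by rewrite mulf_neq0 ?xch_neq0.
rewrite -{1}[f](scale1r f) -(mulVf x0) -scalerA -sigma_scalar // ractZ -sigmaM.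
by rewrite mulVg ract1.
Qed.

Lemma compatible0 : compatible s0 boundary.
Proof.
split=> [a v f f'|v f f_in|v]; first exact: boundary_linr.
  by rewrite /boundary [X in _ + X]integral_0 ?addr0 // => t t1; rewrite sigmaE f_in.
rewrite /boundary -tauM -sigmaM mulgV !ract1 integral_edge // integral_0 ?add0r //.
move=> t t1; rewrite flipV_E sigmaM sigma_scalarV // ractZ IndZ sigmaE.
by rewrite inner_edge ?mulr0.
Qed.

Lemma compatible1 : compatible s1 (fun v f => boundary (tau flip^-1%g v) (sigma flip^-1%g f)).
Proof.
split=> [a v f f'|v f f_in|v]; first by rewrite sigma_lin boundary_linr.
  rewrite /boundary -!tauM -!sigmaM !mulgV !ract1 integral_0 ?add0r // => t t1.
  by rewrite flipV_E sigmaM sigma_scalarV // ractZ IndZ sigmaE f_in ?mulr0.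
rewrite -tauM -sigmaM -invgM (flip_mx_sq pi_unif) sigma_scalarV // bwd1 -boundary_edge.
exact: boundary_Zr.
Qed.

(** * Boundedness of the form over the whole group *)

Variables (absE : nonarch_absval R E) (lattice : T -> Prop) (C : R).
Hypothesis lattice_iwahori : forall k v,
  iwahori absF k -> lattice v -> lattice (tau k v).
Hypothesis central : forall c, c != 0 -> exists2 z,
  forall v, tau (scalar_gl c) v = z *: v & absE (z * (xch chi1 c * xch chi2 c)) = 1.
Hypothesis chi1_unit : forall x, absF x = 1 -> absE (xch chi1 x) = 1.
Hypothesis chi2_unit : forall x, absF x = 1 -> absE (xch chi2 x) = 1.
Hypothesis fwd_bound : forall s v, ok s -> lattice v -> absE (fwd s v) <= C.
Hypothesis bwd_bound : forall s v, ok s -> lattice v -> absE (bwd s v) <= C.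

Definition bounded_at (g : GL2 F) : Prop :=
  forall v, lattice v -> absE (boundary (tau g v) (sigma g edge)) <= C.

Lemma sigma_iwahori k : iwahori absF k ->
  exists2 x, absE x = 1 & sigma k edge = x *: edge.
Proof.
move=> ik; have [k00 k01 k10 k11] := ik.
exists (xch chi1 (\det (uval k) / uval k 1 1) * xch chi2 (uval k 1 1)); last first.
  apply/val_inj/funext => g /=; exact: edge_fun_iwahori.
rewrite absvalM chi2_unit // chi1_unit ?mulr1 // absvalM absvalV k11 invr1 mulr1.
rewrite det_entries addrC absvalD_eq absvalM ?k00 ?k11 ?mulr1 // absvalN absvalM.
by apply: le_lt_trans k01; rewrite ler_piMr ?absval_ge0.
Qed.

Lemma bounded_iwahori g k : iwahori absF k -> bounded_at g -> bounded_at (g * k)%g.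
Proof.
move=> ik bg v lv; have [x x1 kE] := sigma_iwahori ik.
rewrite sigmaM kE ractZ boundary_Zr absvalM x1 mul1r tauM.
exact/bg/lattice_iwahori.
Qed.

Lemma bounded_scalar c g h : c != 0 -> uval h = c *: uval g ->
  bounded_at g -> bounded_at h.
Proof.
move=> c0 hE bg v lv; have [z zE z1] := central c0.
have -> : h = (scalar_gl c * g)%g.
  by apply: uval_inj; rewrite uvalM scalar_glE // mul_scalar_mx.
rewrite tauM zE sigmaM sigma_scalar // boundary_Zl boundary_Zr mulrA absvalM z1 mul1r.
exact: bg.
Qed.

(** Both orientations at once, so that the property is stable under [flip] as well as under the
    centre and the Iwahori subgroup. *)
Definition bounded2 g := bounded_at g /\ bounded_at (g * flip^-1)%g.

Lemma bounded2_scalar c g h : c != 0 -> uval h = c *: uval g -> bounded2 g -> bounded2 h.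
Proof.
move=> c0 hE [b1 b2]; split; first exact: (bounded_scalar c0 hE b1).
by apply: (bounded_scalar c0 _ b2); rewrite !uvalM hE scalemxAl.
Qed.

Lemma bounded2_flip g : bounded2 g -> bounded2 (g * flip^-1)%g.
Proof.
case=> b1 b2; split=> //; apply: (@bounded_scalar pi^-1 g) => //; first by rewrite invr_eq0.
rewrite !uvalM (flip_mxVE pi_unif) -mulmxA mx2_mul; set m := mx2 _ _ _ _.
have -> : m = pi^-1%:M.
  by apply: mx2_eq; rewrite /m !mxE /= ?mulr1n ?mulr0n; ring.
by rewrite mul_mx_scalar.
Qed.

Lemma bounded2_iwahori g k : iwahori absF k -> bounded2 g -> bounded2 (g * k)%g.
Proof.
move=> ik [b1 b2]; split; first exact: bounded_iwahori.
have -> : (g * k * flip^-1 = g * flip^-1 * (flip * k * flip^-1))%g.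
  by rewrite !mulgA mulgVK.
apply: bounded_iwahori b2; have kE : uval (flip * k * flip^-1)%g =
    mx2 (uval k 1 1) (pi * uval k 1 0) (uval k 0 1 / pi) (uval k 0 0).
  rewrite !uvalM (flip_mxE pi_unif) (flip_mxVE pi_unif) [uval k]mx2_eta !mx2_mul !mxE /=.
  by congr mx2; field; rewrite ?pi0.
case: ik => k00 k01 k10 k11; rewrite /iwahori kE !mxE /=; split=> //.
  exact: (pi_t_lt pi_unif).
exact: unif_div_le.
Qed.

Lemma iwahori_lower t : absF t <= 1 -> iwahori absF (lower_unip t).
Proof. by move=> t1; rewrite /iwahori lower_unipE !mxE /= absval1 absval0 ltr01. Qed.

Lemma iwahori_upper t : absF t < 1 -> iwahori absF (upper_unip t).
Proof. by move=> t1; rewrite /iwahori upper_unipE !mxE /= absval1 absval0 ler01. Qed.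

Lemma iwahori_diag u : absF u = 1 -> iwahori absF (gl2 u 0 0 1).
Proof.
move=> u1; have u0 : u != 0 by rewrite -(absval_gt0 absF) u1.
by rewrite /iwahori gl2E ?mul0r ?subr0 ?mulr1 // !mxE /= u1 absval1 absval0 ltr01 ler01.
Qed.

Lemma bounded2_word w : bounded2 (word_mx w) /\ bounded2 (flip^-1 * word_mx w)%g.
Proof.
have [s [oks h1 h2]] := compatible_word w ok0 compatible0.
have [s' [oks' h1' h2']] := compatible_word w ok1 compatible1.
split; split=> v lv.
- by rewrite h1 fwd_bound.
- by rewrite h2 bwd_bound.
- by rewrite tauM sigmaM h1' fwd_bound.
- by rewrite -mulgA tauM sigmaM h2' bwd_bound.
Qed.

(** The letters of [w] are the first [N] digits of the expansion of [z] in powers of [pi]; the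
    remainder is absorbed in [x]. *)
Lemma word_lower N z : absF z <= 1 -> exists w x, absF x <= 1 /\
  uval (word_mx w * lower_unip x)%g = mx2 (pi ^- N) 0 (- z * pi ^- N) 1.
Proof.
elim: N z => [|N IH] z z1.
  exists [::], (- z); split; first by rewrite absvalN.
  by rewrite [word_mx _]/= mul1g lower_unipE expr0 invr1 mulr1.
have [i zi] := dig_near D z1.
have [w [x [x1 wE]]] := IH _ (unif_div_le pi_unif zi).
exists (i :: w), x; split=> //; rewrite [word_mx _]/= -mulgA uvalM wE (shift_mxVE pi_unif) mx2_mul.
have p0 : pi ^+ N != 0 by rewrite expf_neq0.
by congr mx2; rewrite ?exprS; field; rewrite ?pi0 ?p0.
Qed.

Definition lower_tri a c : GL2 F := gl2 a 0 c 1.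

Lemma lower_triE a c : a != 0 -> uval (lower_tri a c) = mx2 a 0 c 1.
Proof. by move=> a0; rewrite gl2E // mul0r subr0 mulr1. Qed.

(** These are the edges reached by a word from [s0], respectively from [s1] after [flip^-1], up to
    Iwahori elements on the right. *)
Lemma bounded2_outer a c : 1 <= absF a -> absF c <= absF a ->
  bounded2 (lower_tri a c) /\ bounded2 (flip^-1 * lower_tri a c)%g.
Proof.
move=> a1 ca; have a0 : a != 0 by rewrite -(absval_gt0 absF) (lt_le_trans ltr01).
have va : 0 < absF a by rewrite absval_gt0.
have [k [u [u1 aE]]] := unif_factor pi_unif a0.
have u0 : u != 0 by rewrite -(absval_gt0 absF) u1.
have : absF (pi ^ (- k)) <= 1.
  have pk : absF (pi ^ k) = absF a by rewrite aE absvalM u1 mul1r.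
  by rewrite -invr_expz absvalV pk invf_le1.
move/(unif_expz_le1 pi_unif); rewrite oppr_ge0 => k0.
have {k0} kE : k = - (`|k|%N)%:Z by rewrite abszE ler0_norm ?opprK.
set N := `|k|%N in kE; have {}aE : a = u * pi ^- N by rewrite aE kE -exprnN.
have p0 : pi ^+ N != 0 by rewrite expf_neq0.
have [w [x [x1 wE]]] : exists w x, absF x <= 1 /\
    uval (word_mx w * lower_unip x)%g = mx2 (pi ^- N) 0 (- (- c / a) * pi ^- N) 1.
  by apply: word_lower; rewrite absvalM absvalN absvalV ler_pdivrMr ?mul1r.
have -> : lower_tri a c = (word_mx w * lower_unip x * gl2 u 0 0 1)%g.
  apply: uval_inj; rewrite uvalM wE lower_triE // gl2E ?mul0r ?subr0 ?mulr1 // mx2_mul.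
  by congr mx2; rewrite ?aE; field; rewrite ?u0 ?p0.
have [b1 b2] := bounded2_word w; rewrite !mulgA.
by split; apply: bounded2_iwahori (iwahori_diag u1) _; apply: bounded2_iwahori (iwahori_lower x1) _.
Qed.

Lemma bounded2_lower_tri a c : a != 0 -> bounded2 (lower_tri a c).
Proof.
move=> a0; have va : 0 < absF a by rewrite absval_gt0.
have [c1|c1] := leP (absF c) 1.
  have [a1|a1] := leP 1 (absF a).
    by case: (bounded2_outer a1 (le_trans c1 a1)).
  (* Up to the scalar [a * pi], the diagonal matrix with entries [a], 1 is
     [flip^-1 * lower_tri a^-1 0 * flip^-1], which lies on the side of [s1]. *)
  have ai : 1 <= absF a^-1 by rewrite absvalV invf_ge1 // ltW.
  have [_] : bounded2 (lower_tri a^-1 0) /\ bounded2 (flip^-1 * lower_tri a^-1 0)%g.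
    by apply: bounded2_outer ai _; rewrite absval0 absval_ge0.
  move/bounded2_flip/(bounded2_iwahori (iwahori_lower c1)).
  apply: bounded2_scalar (_ : a * pi != 0) _; first by rewrite mulf_neq0.
  have ai0 : a^-1 != 0 by rewrite invr_eq0.
  rewrite !uvalM (lower_triE _ a0) (lower_triE _ ai0) (flip_mxVE pi_unif) lower_unipE !mx2_mul.
  by apply: mx2_eq; rewrite !mxE /=; field; rewrite ?a0 ?pi0.
have c0 : c != 0 by rewrite -(absval_gt0 absF) (lt_trans ltr01).
have [ca|ac] := leP (absF c) (absF a).
  have a1 : 1 <= absF a by apply: le_trans ca; exact: ltW.
  by case: (bounded2_outer a1 ca).
have ac1 : absF (a / (c * pi)) <= 1.
  rewrite invfM mulrA; apply: unif_div_le => //.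
  by rewrite absvalM absvalV ltr_pdivrMr ?mul1r // absval_gt0.
(* Chosen so that [lower_tri a c] is [- a / c] times [flip^-1 * lower_tri a' (- c) * upper_unip
   c^-1]; [ac1] then gives [|c| <= |a'|]. *)
pose a' := - (c * c * pi) / a; have a'0 : a' != 0.
  by rewrite !mulf_neq0 ?oppr_eq0 ?invr_eq0 ?mulf_neq0.
have ca' : absF (- c) <= absF a'.
  have -> : a' = (- c) * (a / (c * pi))^-1 by rewrite /a'; field; rewrite ?a0 ?c0 ?pi0.
  rewrite absvalM ler_peMr ?absval_ge0 // absvalV invf_ge1 //.
  by rewrite absval_gt0 !mulf_neq0 ?invr_eq0 ?mulf_neq0.
have a'1 : 1 <= absF a' by apply: le_trans ca'; rewrite absvalN ltW.
have [_] := bounded2_outer a'1 ca'.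
have c1' : absF c^-1 < 1 by rewrite absvalV invf_lt1 // absval_gt0.
move/(bounded2_iwahori (iwahori_upper c1')).
apply: bounded2_scalar (_ : - a / c != 0) _; first by rewrite !mulf_neq0 ?oppr_eq0 ?invr_eq0.
rewrite !uvalM (lower_triE _ a0) (lower_triE _ a'0) (flip_mxVE pi_unif) upper_unipE !mx2_mul.
by apply: mx2_eq; rewrite !mxE /= /a'; field; rewrite ?a0 ?c0 ?pi0.
Qed.

(** The entry [b] is cleared by the column operation [upper_unip (b / a)], an Iwahori element, and
    the scalar [d'] normalises the last entry. *)
Lemma bounded2_dominant (g : GL2 F) : absF (uval g 0 1) < absF (uval g 0 0) -> bounded2 g.
Proof.
have := det_neq0 g; rewrite det_entries; have := mx2_eta (uval g).
set a := uval g 0 0; set b := uval g 0 1; set c := uval g 1 0; set d := uval g 1 1.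
move=> gE D0 ba; have a0 : a != 0 by rewrite -(absval_gt0 absF) (le_lt_trans _ ba) ?absval_ge0.
have ba1 : absF (b / a) < 1 by rewrite absvalM absvalV ltr_pdivrMr ?mul1r // absval_gt0.
pose d' := (a * d - b * c) / a; have d'0 : d' != 0 by rewrite mulf_neq0 ?invr_eq0.
have a'0 : a / d' != 0 by rewrite mulf_neq0 ?invr_eq0.
have := bounded2_iwahori (iwahori_upper ba1) (bounded2_lower_tri (c / d') a'0).
apply: bounded2_scalar d'0 _.
rewrite uvalM lower_triE // upper_unipE mx2_mul gE.
by apply: mx2_eq; rewrite !mxE /= /d'; field; rewrite ?a0 ?D0.
Qed.

Lemma boundary_bounded (g : GL2 F) : bounded_at g.
Proof.
have [ba|ab] := ltP (absF (uval g 0 1)) (absF (uval g 0 0)).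
  by case: (bounded2_dominant ba).
(* [flip] exchanges the columns and multiplies the old first one by [pi], which makes the domination
   strict. *)
suff /bounded2_flip : bounded2 (g * flip)%g by rewrite mulgK => -[].
apply: bounded2_dominant.
have gE : uval (g * flip)%g = mx2 (uval g 0 1) (pi * uval g 0 0) (uval g 1 1) (pi * uval g 1 0).
  by rewrite uvalM (flip_mxE pi_unif) {1}[uval g]mx2_eta mx2_mul; congr mx2; ring.
rewrite gE !mxE /= absvalM; have [a0|a0] := eqVneq (uval g 0 0) 0.
  rewrite a0 absval0 mulr0 absval_gt0; apply: contraNneq (det_neq0 g) => b0.
  by rewrite det_entries a0 b0 !mul0r subrr.
apply: lt_le_trans ab; rewrite gtr_pMl ?absval_gt0 //; exact: unif_lt1 pi_unif.
Qed.

End BoundaryFunctional.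

(** * Binary forms *)

Section BinaryForms.
Variables (E : fieldType) (n : nat).
Notation forms := (dhomog 2 E n).
Implicit Types (P Q : forms) (i j : 'I_n.+1).

Definition mexp (i : nat) : 'X_{1..2} :=
  [multinom (if j == 0%R :> 'I_2 then i else n - i)%N | j < 2].

Lemma mdeg2 (m : 'X_{1..2}) : mdeg m = (m 0%R + m 1%R)%N.
Proof.
rewrite mdegE !big_ord_recl big_ord0 addn0.
by congr (_ + m _)%N; apply/val_inj.
Qed.

Lemma mdeg_mexp i : mdeg (mexp i) = n.
Proof. by rewrite mdeg2 !mnmE /= subnKC // -ltnS. Qed.

Lemma mexp_eq i j : (mexp i == mexp j) = (i == j).
Proof.
apply/eqP/eqP => [/mnmP/(_ 0)|-> //]; rewrite !mnmE /= => e; exact/val_inj.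
Qed.

Lemma mexpP (m : 'X_{1..2}) : mdeg m = n -> exists i, m = mexp i.
Proof.
rewrite mdeg2 => mn; have m0 : (m 0%R < n.+1)%N by rewrite ltnS -mn leq_addr.
exists (Ordinal m0); apply/mnmP => j; rewrite mnmE /= -mn addKn.
by case: (ord2_cases j) => ->.
Qed.

Fact mono_homog i : ('X_[mexp i] : {mpoly E[2]}) \is n.-homog.
Proof. by rewrite dhomogX /= mdeg_mexp. Qed.

Definition mono i : forms := DHomog (mono_homog i).

Definition coef i P : E := (val P)@_(mexp i).

Lemma valZ_form a P : val (a *: P) = a *: val P. Proof. by []. Qed.

Lemma val_sum_form (I : Type) (s : seq I) (p : pred I) (f : I -> forms) :
  val (\sum_(i <- s | p i) f i) = \sum_(i <- s | p i) val (f i).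
Proof. by elim/big_rec2: _ => // i x y _ <-. Qed.

Lemma coef_linear i a P Q : coef i (a *: P + Q) = a * coef i P + coef i Q.
Proof. by rewrite -[LHS]/((a *: val P + val Q)@_(mexp i)) mcoeffD mcoeffZ. Qed.

Lemma coefZ i a P : coef i (a *: P) = a * coef i P.
Proof. by rewrite -[LHS]/((a *: val P)@_(mexp i)) mcoeffZ. Qed.

Lemma coef_mono i j : coef i (mono j) = (i == j)%:R.
Proof. by rewrite /coef mcoeffX mexp_eq eq_sym. Qed.

Lemma forms_decomp P : P = \sum_i coef i P *: mono i.
Proof.
apply/val_inj; rewrite val_sum_form; apply/mpolyP => m.
have mE i : (val (coef i P *: mono i))@_m = coef i P * (mexp i == m)%:R.
  by rewrite valZ_form mcoeffZ mcoeffX.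
rewrite raddf_sum (eq_bigr _ (fun i _ => mE i)).
have [/mexpP[i ->]|mn] := eqVneq (mdeg m) n.
  rewrite (bigD1 i) //= eqxx mulr1 big1 ?addr0 // => j ji.
  by rewrite mexp_eq (negbTE ji) mulr0.
rewrite (dhomog_nemf_coeff (dhomog_is_dhomog P) mn) big1 // => i _.
by case: eqP => [e|]; rewrite ?mulr0 //; move: mn; rewrite -e mdeg_mexp eqxx.
Qed.

Lemma val_mono i : val (mono i) = 'X_0 ^+ i * 'X_1 ^+ (n - i).
Proof.
rewrite /= mpolyXE_id !big_ord_recl big_ord0 mulr1 !mnmE /=.
by congr (_ * 'X_ _ ^+ _); apply/val_inj.
Qed.

Lemma form_eval_01 P : (val P).@[fun j : 'I_2 => (j == 1)%:R] = coef 0 P.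
Proof.
have mE i : (val (coef i P *: mono i)).@[fun j : 'I_2 => (j == 1)%:R] = coef i P * (i == 0)%:R.
  rewrite valZ_form mevalZ mevalX !big_ord_recl big_ord0 !mnmE /= expr1n !mulr1.
  by rewrite expr0n.
rewrite [in LHS](forms_decomp P) val_sum_form raddf_sum (eq_bigr _ (fun i _ => mE i)).
rewrite (bigD1 0) // eqxx mulr1 big1; last by move=> i /negbTE ->; exact: mulr0.
exact: addr0.
Qed.

End BinaryForms.

Section SymAction.
Variables (F E : fieldType) (iota : {rmorphism F -> E}) (m : int) (n : nat).
Notation forms := (dhomog 2 E n).
Notation Sym := (Sym_repn iota n).
Notation tau := (det_Sym_repn iota m n).
Implicit Types (P Q : forms) (i j : 'I_n.+1) (x : F).

Lemma std_subst0 (g : GL2 F) : tnth (std_subst iota g) 0 =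
  iota (uval g 0 0) *: 'X_0 + iota (uval g 1 0) *: 'X_1.
Proof.
rewrite tnth_mktuple !big_ord_recl big_ord0 addr0.
by congr (_ + iota (uval g _ 0) *: 'X_ _); apply/val_inj.
Qed.

Lemma std_subst1 (g : GL2 F) : tnth (std_subst iota g) 1 =
  iota (uval g 0 1) *: 'X_0 + iota (uval g 1 1) *: 'X_1.
Proof.
rewrite tnth_mktuple !big_ord_recl big_ord0 addr0.
by congr (_ + iota (uval g _ 1) *: 'X_ _); apply/val_inj.
Qed.

Lemma val_Sym (g : GL2 F) P : val (Sym g P) = val P \mPo std_subst iota g.
Proof. by []. Qed.

Lemma val_Sym_mono (g : GL2 F) i : val (Sym g (mono E i)) =
  (iota (uval g 0 0) *: 'X_0 + iota (uval g 1 0) *: 'X_1) ^+ i *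
  (iota (uval g 0 1) *: 'X_0 + iota (uval g 1 1) *: 'X_1) ^+ (n - i).
Proof.
rewrite val_Sym val_mono rmorphM !rmorphXn /= !comp_mpolyXU.
by rewrite -std_subst0 -std_subst1 -!tnth_nth.
Qed.

Lemma tauE g P : tau g P = iota (\det (uval g)) ^ m *: Sym g P.
Proof. by []. Qed.

Lemma repn_sum (G : groupType) (V : lmodType E) (r : repn G V) g (I : Type) (s : seq I)
    (p : pred I) (f : I -> V) :
  r g (\sum_(i <- s | p i) f i) = \sum_(i <- s | p i) r g (f i).
Proof.
have r0 : r g 0 = 0 by have := ractZ r g 0 0; rewrite !scale0r.
have rD v w : r g (v + w) = r g v + r g w by rewrite -[v]scale1r ract_linear !scale1r.
by elim/big_rec2: _ => // i x y _ <-.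
Qed.

Lemma Sym_scalar (c : F) P : c != 0 -> Sym (scalar_gl c) P = iota c ^+ n *: P.
Proof.
move=> c0; rewrite [P]forms_decomp repn_sum scaler_sumr; apply: eq_bigr => i _.
rewrite ractZ scalerA mulrC -scalerA; congr (_ *: _); apply/val_inj.
rewrite val_Sym_mono valZ_form val_mono (scalar_glE c0) !mxE /=.
rewrite !mulr1n !mulr0n rmorph0 !scale0r addr0 add0r !exprZn -scalerAl -scalerAr scalerA.
by rewrite -exprD subnKC // -ltnS.
Qed.

(** For [i + k] beyond [n] the index [inord] takes a default value, but its binomial coefficient
    vanishes. *)
Lemma Sym_upper x i : Sym (upper_unip x) (mono E i) =
  \sum_(k < n.+1) (iota x ^+ k * 'C(n - i, k)%:R) *: mono E (inord (i + k) : 'I_n.+1).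
Proof.
apply/val_inj; rewrite val_sum_form val_Sym_mono upper_unipE !mxE /=.
rewrite rmorph0 rmorph1 scale0r addr0 !scale1r addrC exprDn.
have i_n : (i <= n)%N by rewrite -ltnS.
rewrite mulr_sumr (big_ord_widen n.+1 (fun k : nat => 'X_0 ^+ i *
  ('X_1 ^+ (n - i - k) * (iota x *: 'X_0) ^+ k *+ 'C(n - i, k)))) ?ltnS ?leq_subr //.
rewrite big_mkcond; apply: eq_bigr => k _; rewrite ltnS; case: leqP => kn; last first.
  by rewrite bin_small // mulr0 scale0r.
have ik : (i + k < n.+1)%N by rewrite ltnS -leq_subRL.
rewrite -[X in _ = X]/(_ *: val (mono E (inord (i + k)))) val_mono inordK // exprZn.
rewrite subnDA exprD -scalerAr mulrnAr -scalerAr mulr_natr -scalerMnl.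
by congr (_ *: _ *+ _); rewrite mulrCA mulrC mulrAC.
Qed.

Lemma Sym_lower x : Sym (lower_unip x) (mono E ord_max) =
  \sum_(k < n.+1) (iota x ^+ k * 'C(n, k)%:R) *: mono E (rev_ord k).
Proof.
apply/val_inj; rewrite val_sum_form val_Sym_mono lower_unipE !mxE /= subnn expr0 mulr1.
rewrite rmorph1 scale1r exprDn; apply: eq_bigr => k _.
rewrite -[X in _ = X]/(_ *: val (mono E (rev_ord k))) val_mono /= subSS subKn;
  last by rewrite -ltnS.
by rewrite exprZn -scalerAr mulr_natr -scalerMnl mulrC.
Qed.

(** The coefficient of ['X_1 ^+ n] is the value at (0, 1), and [shift_mx pi x] moves this point to
    (x, 1). So [coef 0] at the child [x] evaluates [P] at (x, 1), which is what makes interpolation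
    available. *)
Lemma coef0_shift (pi : F) x P : pi != 0 ->
  coef 0 (Sym (shift_mx pi x) P) = \sum_i coef i P * iota x ^+ i.
Proof.
move=> pi0; have gE : uval (shift_mx pi x) = mx2 pi 0 x 1.
  by rewrite gl2E // mul0r subr0 mulr1.
have mE i : (val (Sym (shift_mx pi x) (coef i P *: mono E i))).@[fun j : 'I_2 => (j == 1)%:R] =
    coef i P * iota x ^+ i.
  rewrite ractZ valZ_form mevalZ val_Sym_mono gE !mxE /= rmorph0 rmorph1 scale0r add0r scale1r.
  rewrite mevalM !rmorphXn /= mevalD !mevalZ !mevalXU /=.
  by rewrite mulr0 add0r mulr1 expr1n mulr1.
rewrite [in LHS](forms_decomp P) repn_sum -form_eval_01 val_sum_form raddf_sum.
exact: (eq_bigr _ (fun i _ => mE i)).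
Qed.

Section Lattice.
Variables (R : realType) (absF : nonarch_absval R F) (absE : nonarch_absval R E).
Hypothesis absE_ext : forall x, absE (iota x) = absF x.

Definition integral_form P := forall i, absE (coef i P) <= 1.

Lemma integral_formP P : integral_form P <-> val P \is a mpolyOver 2 (vint absE).
Proof.
split=> [h|/mpolyOverP h i]; last exact: h.
apply/mpolyOverP => e; have [/mexpP[i ->]|en] := eqVneq (mdeg e) n; first exact: h.
by rewrite (dhomog_nemf_coeff (dhomog_is_dhomog P) en) rpred0.
Qed.

Lemma integral_mono i : integral_form (mono E i).
Proof. by move=> j; rewrite coef_mono; case: eqP; rewrite ?absval1 ?absval0 ?ler01. Qed.

Lemma integral_Sym (g : GL2 F) P :
  (forall i j : 'I_2, absF (uval g i j) <= 1) -> integral_form P -> integral_form (Sym g P).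
Proof.
move=> g1 /integral_formP/mpolyOverP P1; apply/integral_formP.
have t1 (j : 'I_2) : tnth (std_subst iota g) j \is a mpolyOver 2 (vint absE).
  rewrite tnth_mktuple rpred_sum // => i _; apply: mpolyOverZ; last exact: mpolyOverX.
  by rewrite vintE absE_ext.
rewrite val_Sym comp_mpolyEX rpred_sum // => e _; apply: mpolyOverZ; first exact: P1.
by rewrite comp_mpolyX rpred_prod // => i _; rewrite rpredX.
Qed.

Lemma det_iwahori (k : GL2 F) : iwahori absF k -> absF (\det (uval k)) = 1.
Proof.
case=> k00 k01 k10 k11; rewrite det_entries addrC absvalD_eq absvalM ?k00 ?k11 ?mulr1 //.
rewrite absvalN absvalM; apply: le_lt_trans k01.
by rewrite ler_piMr ?absval_ge0.
Qed.

Lemma integral_tau (k : GL2 F) P : absF (\det (uval k)) = 1 ->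
  (forall i j : 'I_2, absF (uval k i j) <= 1) -> integral_form P -> integral_form (tau k P).
Proof.
move=> dk k1 P1 i; rewrite tauE coefZ absvalM absvalXz absE_ext dk exp1rz mul1r.
exact: integral_Sym.
Qed.

End Lattice.

End SymAction.

(** * Irreducibility of the tensor product *)

Section VandermondeInverse.
Variables (E : fieldType) (N : nat) (x : 'I_N -> E).
Hypothesis x_inj : injective x.

Definition power_mx : 'M[E]_N := \matrix_(l, k) x l ^+ k.

Lemma det_power_mx : \det power_mx = \prod_(i < N) \prod_(j < N | (i < j)%N) (x j - x i).
Proof.
have -> : power_mx = (Vandermonde N (\row_j x j))^T.
  by apply/matrixP => i j; rewrite !mxE.
by rewrite det_tr det_Vandermonde; apply: eq_bigr => i _; apply: eq_bigr => j _; rewrite !mxE.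
Qed.

Lemma power_mx_unit : power_mx \in unitmx.
Proof.
rewrite unitmxE unitfE det_power_mx prodf_seq_neq0; apply/allP => i _ /=.
rewrite prodf_seq_neq0; apply/allP => j _ /=; apply/implyP => ij.
by rewrite subr_eq0; apply: contraTneq ij => /x_inj ->; rewrite ltnn.
Qed.

Lemma power_mx_inv (k k' : 'I_N) :
  \sum_l invmx power_mx k l * x l ^+ k' = (k == k')%:R.
Proof.
have := congr1 (fun M : 'M_N => M k k') (mulVmx power_mx_unit).
by rewrite !mxE => <-; apply: eq_bigr => l _; rewrite mxE.
Qed.

(** The Vandermonde determinant is a product of units, so the adjugate formula stays integral. *)
Lemma power_mx_inv_integral (R : realType) (absE : nonarch_absval R E) :
  (forall i, absE (x i) <= 1) -> (forall i j, i != j -> absE (x i - x j) = 1) ->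
  forall k l, absE (invmx power_mx k l) <= 1.
Proof.
move=> x1 xs k l; rewrite /invmx power_mx_unit mxE absvalM absvalV.
have -> : absE (\det power_mx) = 1.
  rewrite det_power_mx; elim/big_ind: _ => [|y z y1 z1|i _];
    rewrite ?absval1 ?absvalM ?y1 ?z1 ?mulr1 //.
  elim/big_ind: _ => [|y z y1 z1|j ij]; rewrite ?absval1 ?absvalM ?y1 ?z1 ?mulr1 //.
  by rewrite xs // -val_eqE gtn_eqF.
rewrite invr1 mul1r mxE /cofactor absvalM absvalX absvalN1 expr1n mul1r.
rewrite -vintE /determinant rpred_sum // => s _.
rewrite rpredM ?rpredX ?rpredN1 // rpred_prod // => i _.
by rewrite !mxE rpredX // vintE.
Qed.

(** Recovers the coefficients of a vector-valued polynomial from its values at [N] distinct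
    points. *)
Lemma power_mx_span (V : lmodType E) (W : set V) (w : 'I_N -> V) :
  W 0 -> (forall u v, W u -> W v -> W (u + v)) -> (forall a v, W v -> W (a *: v)) ->
  (forall l, W (\sum_(k < N) x l ^+ k *: w k)) -> forall k, W (w k).
Proof.
move=> W0 WD WZ Wl k.
have -> : w k = \sum_l invmx power_mx k l *: \sum_(k' < N) x l ^+ k' *: w k'.
  under eq_bigr => l _ do (rewrite scaler_sumr; under eq_bigr => k' _ do rewrite scalerA).
  rewrite exchange_big (bigD1 k) //= -scaler_suml power_mx_inv eqxx scale1r.
  rewrite big1 ?addr0 // => k' kk'; rewrite -scaler_suml power_mx_inv.
  by rewrite eq_sym (negbTE kk') scale0r.
by elim/big_ind: _ => [|u v|l _] //; [exact: WD|exact/WZ/Wl].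
Qed.

End VandermondeInverse.

Section TensorIrreducible.
Variables (R : realType) (F : fieldType) (absF : nonarch_absval R F) (pi : F).
Hypothesis pi_unif : uniformizer absF pi.
Hypothesis F_char0 : [pchar F] =i pred0.
Variables (E : fieldType) (iota : {rmorphism F -> E}).
Variables chi1 chi2 : {multiplicative unitg F -> unitg E}.
Variables (m : int) (n : nat).
Notation Ind := (Ind absF chi1 chi2).
Notation sigma := (Ind_repn absF chi1 chi2).
Notation tau := (det_Sym_repn iota m n).
Notation forms := (dhomog 2 E n).
Variables (V : lmodType E) (t : {bilinear forms -> Ind -> V}) (rho : repn (GL2 F) V).
Hypothesis rho_tensor : tensor_repn tau sigma t rho.
Hypothesis sigma_irr : irreducible sigma.

Lemma tensor_lin_l a P Q f : t (a *: P + Q) f = a *: t P f + t Q f.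
Proof. by rewrite linearPl. Qed.

Lemma tensor_lin_r a P f f' : t P (a *: f + f') = a *: t P f + t P f'.
Proof. by rewrite linearPr. Qed.

Lemma tensor_0l f : t 0 f = 0.
Proof. by have := tensor_lin_l (-1) 0 0 f; rewrite scaleN1r oppr0 addr0 scaleN1r addNr. Qed.

Lemma tensor_0r P : t P 0 = 0.
Proof. by have := tensor_lin_r (-1) P 0 0; rewrite scaleN1r oppr0 addr0 scaleN1r addNr. Qed.

Lemma tensor_Zl a P f : t (a *: P) f = a *: t P f.
Proof. by rewrite -[a *: P]addr0 tensor_lin_l tensor_0l addr0. Qed.

Lemma tensor_Zr a P f : t P (a *: f) = a *: t P f.
Proof. by rewrite -[a *: f]addr0 tensor_lin_r tensor_0r addr0. Qed.

Lemma tensor_sum_l (I : Type) (s : seq I) (p : pred I) (P : I -> forms) f :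
  t (\sum_(i <- s | p i) P i) f = \sum_(i <- s | p i) t (P i) f.
Proof.
elim/big_rec2: _ => [|i x y _ <-]; first exact: tensor_0l.
by rewrite -[P i]scale1r tensor_lin_l !scale1r.
Qed.

(** The universal property is applied to [(P, f) |-> coef i P *: f] to get the coordinates, and its
    uniqueness part identifies the reassembled map with the identity. *)
Lemma tensor_coords : exists c : 'I_n.+1 -> V -> Ind,
  forall v, v = \sum_i t (mono E i) (c i v).
Proof.
have tP := rho_tensor.1.
pose b (i : 'I_n.+1) (P : forms) (f : Ind) : Ind := coef i P *: f.
have b_bil i : bilinear_for (GRing.Scale.Law.clone _ _ *:%R _)
     (GRing.Scale.Law.clone _ _ *:%R _) (b i).
  split=> [f a P Q|P a f f']; rewrite /b /=.
    by rewrite coef_linear scalerDl scalerA.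
  by rewrite scalerDr !scalerA mulrC.
pose bL i : {bilinear forms -> Ind -> Ind} :=
  HB.pack (b i) (bilinear_isBilinear.Build E forms Ind Ind _ _ (b i) (b_bil i)).
have /choice[c cP] : forall i, exists c : {linear V -> Ind}, forall P f, c (t P f) = b i P f.
  by move=> i; have [c [cE _]] := tP _ (bL i); exists c.
exists (fun i => c i) => v.
pose g (v : V) : V := \sum_i t (mono E i) (c i v).
have g_lin : linear g.
  move=> a u w; rewrite /g scaler_sumr -big_split; apply: eq_bigr => i _.
  by rewrite linearP tensor_lin_r.
pose gL : {linear V -> V} := HB.pack g (GRing.isLinear.Build E V V _ g g_lin).
have [h [_ huniq]] := tP _ t.
have idE : (idfun : {linear V -> V}) =1 h by apply: huniq.
have gE : gL =1 h.
  apply: huniq => P f; rewrite /= /g [P in RHS]forms_decomp tensor_sum_l.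
  by apply: eq_bigr => i _; rewrite cP /b tensor_Zr tensor_Zl.
by rewrite -[LHS]/(idfun v) idE -gE.
Qed.

Lemma unif_expr_inj : injective (fun k : nat => iota (pi ^+ k)).
Proof.
move=> i j /fmorph_inj ij; apply/eqP; apply: contraT => neq.
have lt a b : (a < b)%N -> pi ^+ a = pi ^+ b -> False.
  move=> ab e; have := congr1 absF e; rewrite !absvalX => /eqP.
  rewrite -(subnKC (ltnW ab)) exprD -{1}[_ ^+ a]mulr1 => /eqP/mulfI.
  have p0 : absF pi ^+ a != 0 by rewrite expf_neq0 // absval_eq0b (unif_neq0 pi_unif).
  move/(_ p0) => e1; have : absF pi ^+ (b - a) < 1.
    by rewrite exprn_ilt1 ?absval_ge0 ?(unif_lt1 pi_unif) // subn_eq0 -ltnNge.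
  by rewrite -e1 ltxx.
by case: (ltngtP i j) neq => // ij' _; [case: (lt i j ij')|case: (lt j i ij')].
Qed.

Lemma smooth_family (I : finType) (f : I -> Ind) : exists M, forall x i,
  absF x <= absF pi ^+ M ->
  sigma (upper_unip x) (f i) = f i /\ sigma (lower_unip x) (f i) = f i.
Proof.
have smooth i : exists M, forall x, absF x <= absF pi ^+ M ->
    sigma (upper_unip x) (f i) = f i /\ sigma (lower_unip x) (f i) = f i.
  have [e e0 fe] := Ind_smooth (f i); have [M Me] := unif_expr_lt pi_unif e0.
  exists M => x xM; have xe := le_lt_trans xM Me.
  split; apply/val_inj/funext => g; apply: fe => a b;
    rewrite ?upper_unipE ?lower_unipE mxE;
    by case: (ord2_cases a) => ->; case: (ord2_cases b) => -> /=; rewrite ?subrr ?subr0 ?absval0.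
have /choice[M MP] := smooth; exists (\max_i M i)%N => x i xM; apply: MP.
by apply: le_trans xM _; apply: (unif_expr_decr pi_unif); apply: leq_bigmax.
Qed.

(** Characteristic 0 lets the binomial coefficients of [Sym_lower] be divided out. *)
Lemma natr_neq0 k : (0 < k)%N -> (k%:R : E) != 0.
Proof.
move=> k0; rewrite -(rmorph_nat iota) fmorph_eq0.
by rewrite (pcharf0P F).1 // -lt0n.
Qed.

Lemma tensor_irreducible (W : set V) : submodule rho setT W ->
  (exists2 w, w != 0 & W w) -> W = setT.
Proof.
move=> [W0 WD WZ WG] [w w0 Ww].
have WZ' a v : W v -> W (a *: v) by apply: WZ.
have [c cP] := tensor_coords.
have tE g P f : rho g (t P f) = t (tau g P) (sigma g f) := rho_tensor.2 g P f.
have tau1 g P : \det (uval g) = 1 -> tau g P = Sym_repn iota n g P.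
  by move=> d1; rewrite tauE d1 rmorph1 exp1rz scale1r.
pose f i := c i w.
have exf : exists i, (fun k => [exists i : 'I_n.+1, (i == k :> nat) && (f i != 0)]) i.
  apply: contrapT => nf; move/eqP: w0; apply; rewrite [w]cP big1 // => i _.
  have [->|fi] := eqVneq (c i w) 0; first exact: tensor_0r.
  by case: nf; exists i; apply/existsP; exists i; rewrite eqxx.
(* [i0] is the least index whose component of [w] is nonzero. *)
have [_ /existsP[i0 /andP[/eqP <- fi0]] min_i0] := ex_minnP exf.
have f_lt (i : 'I_n.+1) : (i < i0)%N -> f i = 0.
  move=> ii0; apply/eqP; apply: contraTT ii0 => fi; rewrite -leqNgt; apply: min_i0.
  by apply/existsP; exists i; rewrite eqxx.
have [M MP] := smooth_family f.
(* Pairwise distinct parameters, all small enough to fix every [f i]. *)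
pose y (l : 'I_n.+1) := pi ^+ (M + l).
have yM l : absF (y l) <= absF pi ^+ M.
  by rewrite /y absvalX (unif_expr_decr pi_unif) // leq_addr.
have y_inj : injective (fun l => iota (y l)).
  by move=> k l /unif_expr_inj/addnI/val_inj.
have top : W (t (mono E ord_max) (f i0)).
  (* The coefficient of x^k in [rho (upper_unip x) w], which is polynomial in [iota x] for small
     [x]. *)
  pose u (k : 'I_n.+1) : V :=
    \sum_(i < n.+1) 'C(n - i, k)%:R *: t (mono E (inord (i + k) : 'I_n.+1)) (f i).
  have Wu : forall k, W (u k).
    apply: (power_mx_span y_inj) => // l.
    have -> : \sum_(k < n.+1) iota (y l) ^+ k *: u k = rho (upper_unip (y l)) w.
      rewrite [in RHS](cP w) repn_sum; under eq_bigr => k _ do rewrite scaler_sumr.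
      rewrite exchange_big; apply: eq_bigr => i _.
      rewrite tE (MP _ i (yM l)).1 tau1; last by rewrite upper_unipE det_mx2 mulr0 subr0 mulr1.
      rewrite Sym_upper tensor_sum_l; apply: eq_bigr => k _.
      by rewrite tensor_Zl scalerA.
    exact: WG.
  (* In degree [n - i0] only [i0] survives: smaller indices have [f i = 0], larger ones a binomial
     'C(n - i, n - i0) equal to 0. *)
  have := Wu (rev_ord i0); rewrite /u (bigD1 i0) //= subSS big1 => [|i ii0].
    rewrite addr0 binn scale1r; congr (W (t (mono E _) _)).
    by apply/val_inj; rewrite /= subnKC ?inordK // -ltnS.
  have [lt|ge] := ltnP i i0; first by rewrite f_lt // tensor_0r scaler0.
  have {ge ii0} lt : (i0 < i)%N by rewrite ltn_neqAle ge andbT eq_sym.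
  rewrite bin_small ?scale0r // ltn_sub2l //; exact: leq_trans lt (ltnSE (ltn_ord i)).
have all_mono k : W (t (mono E k) (f i0)).
  have Wk : forall k : 'I_n.+1, W ('C(n, k)%:R *: t (mono E (rev_ord k)) (f i0)).
    apply: (power_mx_span y_inj) => // l.
    have -> : \sum_(k < n.+1) iota (y l) ^+ k *: ('C(n, k)%:R *: t (mono E (rev_ord k)) (f i0)) =
        rho (lower_unip (y l)) (t (mono E ord_max) (f i0)).
      rewrite tE (MP _ i0 (yM l)).2 tau1; last by rewrite lower_unipE det_mx2 mul0r subr0 mulr1.
      rewrite Sym_lower tensor_sum_l; apply: eq_bigr => i _.
      by rewrite tensor_Zl scalerA.
    exact: WG.
  have C0 : ('C(n, rev_ord k)%:R : E) != 0.
    by rewrite natr_neq0 // bin_gt0 -ltnS.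
  by have := WZ' 'C(n, rev_ord k)%:R^-1 _ (Wk (rev_ord k));
    rewrite scalerA mulVf // scale1r rev_ordK.
(* A nonzero subrepresentation of the irreducible [sigma], because it contains [f i0]. *)
pose S : set Ind := [set h | forall P, W (t P h)].
have Sf : S (f i0).
  move=> P; rewrite [P]forms_decomp tensor_sum_l.
  by elim/big_ind: _ => // i _; rewrite tensor_Zl; apply: WZ'.
have subS : submodule sigma setT S.
  split=> [P|h h' Sh Sh' P|a h _ Sh P|g h Sh P].
  - by rewrite tensor_0r.
  - by rewrite -[h]scale1r tensor_lin_r scale1r; apply: WD.
  - by rewrite tensor_Zr; apply: WZ'.
  - have -> : t P (sigma g h) = rho g (t (tau g^-1%g P) h).
      by rewrite tE -ractM mulgV ract1.
    exact/WG/Sh.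
have ST : S = setT.
  case: (sigma_irr.2 S subS) => // S0; move: Sf; rewrite S0 => /= e.
  by rewrite e eqxx in fi0.
apply/seteqP; split=> // v _; rewrite [v]cP.
elim/big_ind: _ => // i _; have : S (c i v) by rewrite ST.
exact.
Qed.

End TensorIrreducible.

(** * From bounded linear forms to integral structures *)

Section BoundedFunctional.
Variables (R : realType) (G : groupType) (E : fieldType) (absE : nonarch_absval R E).
Variables (V : lmodType E) (rho : repn G V).
Hypothesis rho_irr : forall W : set V, submodule rho setT W ->
  (exists2 w, w != 0 & W w) -> W = setT.
Variables (varpi : E) (l : V -> E) (v0 : V) (C : R).
Hypothesis varpi0 : varpi != 0.
Hypothesis varpi1 : absE varpi < 1.
Hypothesis varpi_small : forall e : R, 0 < e -> exists M, absE varpi ^+ M < e.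
Hypothesis l_linear : forall a v w, l (a *: v + w) = a * l v + l w.
Hypothesis l_v0 : l v0 != 0.
Hypothesis l_bounded : forall g, absE (l (rho g v0)) <= C.

Lemma integral_structure_of_bounded : exists V0, integral_structure rho absE V0.
Proof.
have l0 : l 0 = 0.
  by have := l_linear (-1) 0 0; rewrite scaleN1r oppr0 addr0 mulN1r addNr.
have lD v w : l (v + w) = l v + l w by rewrite -[v]scale1r l_linear mul1r scale1r.
have lZ a v : l (a *: v) = a * l v by rewrite -[a *: v]addr0 l_linear l0 addr0.
have rD g v w : rho g (v + w) = rho g v + rho g w.
  by rewrite -[v]scale1r ract_linear !scale1r.
have r0 g : rho g 0 = 0 by have := ractZ rho g 0 0; rewrite !scale0r.
have v00 : v0 != 0 by apply: contraNneq l_v0 => ->; rewrite l0.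
exists [set v | forall g, absE (l (rho g v)) <= 1]; split.
- split=> [g|v w Wv Ww g|a v a1 Wv g|g v Wv h].
  + by rewrite r0 l0 absval0 ler01.
  + by rewrite rD lD; apply: absvalD_le.
  + by rewrite ractZ lZ; apply: absval_mul_le.
  + by rewrite -ractM.
(* Bounded orbits form a submodule over [E] containing [v0], hence everything; a power of [varpi]
   then scales any vector into the lattice. *)
- have BT : [set v | exists B : R, forall g, absE (l (rho g v)) <= B] = setT.
    apply: rho_irr; last by exists v0 => //; exists C.
    split=> [|v w [B vB] [B' wB']|a v _ [B vB]|g v [B vB]].
    + by exists 1 => g; rewrite r0 l0 absval0 ler01.
    + exists (Num.max B B') => g; rewrite rD lD.
      by apply: absvalD_le; rewrite le_max ?vB ?wB' ?orbT.
    + by exists (absE a * B) => g; rewrite ractZ lZ absvalM ler_wpM2l ?absval_ge0.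
    + by exists B => h; rewrite -ractM.
  apply/seteqP; split=> // v _.
  have [B vB] : [set v | exists B : R, forall g, absE (l (rho g v)) <= B] v by rewrite BT.
  have B0 : 0 <= B := le_trans (absval_ge0 _ _) (vB 1%g).
  (* [B + 1] is positive even if [B] is 0. *)
  have [M hM] := @varpi_small (B + 1)^-1 ltac:(by rewrite invr_gt0 ltr_wpDl).
  exists 1%N, (fun=> varpi ^- M), (fun=> varpi ^+ M *: v); split=> [_ g|].
    rewrite ractZ lZ absvalM absvalX.
    apply: (@le_trans _ _ ((B + 1)^-1 * (B + 1))); last by rewrite mulVf ?gt_eqF ?ltr_wpDl.
    apply: ler_pM; [by rewrite exprn_ge0 ?absval_ge0|exact: absval_ge0|exact: ltW|].
    by rewrite (le_trans (vB g)) // lerDl ler01.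
  by rewrite big_ord_recl big_ord0 addr0 scalerA mulVf ?scale1r // expf_neq0.
- move=> [v v_neq0 vV0].
  (* A line inside the lattice forces [l] to vanish on the orbit of its generator; such vectors form
     a submodule, which would then contain [v0]. *)
  have NT : [set v | forall g, l (rho g v) = 0] = setT.
    apply: rho_irr.
      split=> [g|u w u0 w0 g|a u _ u0 g|g u u0 h].
      + by rewrite r0 l0.
      + by rewrite rD lD u0 w0 addr0.
      + by rewrite ractZ lZ u0 mulr0.
      + by rewrite -ractM.
    exists v => // g; apply/eqP; apply: contraT => lv.
    (* The multiple of [v] is scaled so that the value of [l] becomes [varpi^-1], of absolute value
       above 1. *)
    have /(_ g) := vV0 ((l (rho g v))^-1 * varpi^-1 *: v) (ex_intro2 _ _ _ I erefl).
    rewrite ractZ lZ mulrAC mulVf // mul1r absvalV leNgt invf_gt1 ?varpi1 //.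
    by rewrite absval_gt0.
  have : [set v | forall g, l (rho g v) = 0] v0 by rewrite NT.
  by move/(_ 1%g); rewrite ract1 => /eqP; rewrite (negbTE l_v0).
Qed.

End BoundedFunctional.

(** * From recursively chosen states to an integral structure *)

Section Criterion.
Variables (R : realType) (F : fieldType) (absF : nonarch_absval R F) (pi : F).
Hypothesis pi_unif : uniformizer absF pi.
Hypothesis F_char0 : [pchar F] =i pred0.
Variables (q : nat) (D : digits absF q).
Variables (E : fieldType) (iota : {rmorphism F -> E}) (absE : nonarch_absval R E).
Hypothesis absE_ext : forall x, absE (iota x) = absF x.
Variables chi1 chi2 : {multiplicative unitg F -> unitg E}.
Hypothesis tame1 : forall x, absF (x - 1) < 1 -> xch chi1 x = 1.
Hypothesis tame2 : forall x, absF (x - 1) < 1 -> xch chi2 x = 1.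
Variables (m : int) (n : nat).
Notation Ind := (Ind absF chi1 chi2).
Notation sigma := (Ind_repn absF chi1 chi2).
Notation tau := (det_Sym_repn iota m n).
Notation forms := (dhomog 2 E n).
Notation shift := (shift_mx pi).
Notation flip := (flip_mx pi).
Variables (V : lmodType E) (t : {bilinear forms -> Ind -> V}) (rho : repn (GL2 F) V).
Hypothesis rho_tensor : tensor_repn tau sigma t rho.
Hypothesis sigma_irr : irreducible sigma.

Definition central_val (c : F) : E := iota (c * c) ^ m * iota c ^+ n.

Hypothesis central_unit : absE (central_val pi * (xch chi1 pi * xch chi2 pi)) = 1.

Lemma tau_scalar c P : c != 0 -> tau (scalar_gl c) P = central_val c *: P.
Proof.
move=> c0; rewrite tauE Sym_scalar // scalerA; congr (iota _ ^ m * _ *: _).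
by rewrite det_entries (scalar_glE c0) !mxE /= mulr1n mulr0n mul0r subr0.
Qed.

(** The expression is multiplicative in [c], equal to 1 on units because tame characters have values
    of absolute value 1 there, and equal to 1 at [pi] by hypothesis. *)
Lemma central_absval c : c != 0 -> absE (central_val c * (xch chi1 c * xch chi2 c)) = 1.
Proof.
pose h x := absE (central_val x * (xch chi1 x * xch chi2 x)).
have hM x y : h (x * y) = h x * h y.
  rewrite /h /central_val -absvalM; congr (absE _).
  rewrite !xchM !rmorphM !expfzMl exprMn.
  move: (iota x ^ m) (iota y ^ m) (iota x ^+ n) (iota y ^+ n) => a b a' b'; ring.
have h1 : h 1 = 1 by rewrite /h /central_val !xch1 !mulr1 rmorph1 exp1rz expr1n mulr1 absval1.
have hV x : x != 0 -> h x = 1 -> h x^-1 = 1.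
  by move=> x0 hx; rewrite -h1 -(divff x0) hM hx mul1r.
have hX k : h (pi ^+ k) = 1.
  by elim: k => [|k IH]; rewrite ?h1 // exprS hM IH mulr1.
move=> c0; have [k [u [u1 ->]]] := unif_factor pi_unif c0.
rewrite -/(h _) hM; have -> : h u = 1.
  rewrite /h /central_val !absvalM absvalXz absvalX !absE_ext absvalM u1.
  by rewrite !(xch_tame_absval absE D _ u1) // !mulr1 exp1rz expr1n mulr1.
rewrite mul1r; case: k => k; first exact: hX.
by rewrite NegzE -exprnN; apply: hV => //; rewrite expf_neq0 // (unif_neq0 pi_unif).
Qed.

Variables (St : Type) (fwd bwd : St -> forms -> E) (step : St -> 'I_q -> St).
Variables (ok : St -> Prop) (s0 s1 : St) (C : R) (P0 : forms).
Hypothesis fwd_linear : forall s a P Q, fwd s (a *: P + Q) = a * fwd s P + fwd s Q.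
Hypothesis ok_step : forall s i, ok s -> ok (step s i).
Hypothesis fwd_split : forall s P, ok s ->
  fwd s P = xch chi1 pi * \sum_i fwd (step s i) (tau (shift (D i)) P).
Hypothesis bwd_step : forall s i P, ok s -> bwd (step s i) P =
  (xch chi2 pi)^-1 * (bwd s (tau (flip * (shift (D i))^-1 * flip^-1)%g P) +
    xch chi1 (-1) * \sum_(j | j != i) eta chi1 chi2 (D j - D i) *
      fwd (step s j) (tau (shift (D j) * (shift (D i))^-1 * flip^-1)%g P)).
Hypothesis ok0 : ok s0.
Hypothesis ok1 : ok s1.
Hypothesis bwd0 : forall P, bwd s0 P = fwd s1 P.
Hypothesis bwd1 : forall P, bwd s1 P =
  (central_val pi * (xch chi1 pi * xch chi2 pi))^-1 * fwd s0 P.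
Hypothesis fwd_bound : forall s P, ok s -> integral_form absE P -> absE (fwd s P) <= C.
Hypothesis bwd_bound : forall s P, ok s -> integral_form absE P -> absE (bwd s P) <= C.
Hypothesis P0_integral : integral_form absE P0.
Hypothesis P0_neq0 : fwd s0 P0 != 0.

(** The form is [boundary] read on the tensor product through the universal property, and the
    bounded orbit is that of [t P0 edge]. *)
Lemma integral_structure_of_states : exists V0, integral_structure rho absE V0.
Proof.
have pi0 := unif_neq0 pi_unif.
have bwd1' P : bwd s1 P = (xch chi1 pi * xch chi2 pi)^-1 * fwd s0 (tau (scalar_gl pi)^-1%g P).
  have z0 : central_val pi != 0.
    by rewrite mulf_neq0 ?expfz_neq0 ?expf_neq0 ?fmorph_eq0 ?mulf_neq0.
  have -> : tau (scalar_gl pi)^-1%g P = (central_val pi)^-1 *: P.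
    rewrite -{1}[P](scale1r P) -(mulVf z0) -scalerA -tau_scalar // ractZ -ractM.
    by rewrite mulVg ract1.
  have fwd0 : fwd s0 0 = 0.
    by have := fwd_linear s0 (-1) 0 0; rewrite scaleN1r oppr0 addr0 mulN1r addNr.
  by rewrite bwd1 -[_ *: P]addr0 fwd_linear fwd0 addr0 invfM mulrA [_^-1 * _^-1]mulrC.
pose B := boundary D pi_unif (chi1 := chi1) (chi2 := chi2) tau fwd step s0 s1.
have B_linl a P Q f : B (a *: P + Q) f = a * B P f + B Q f by exact: boundary_linl.
have B_linr a P f f' : B P (a *: f + f') = a * B P f + B P f'.
  exact: (boundary_linr pi_unif ok_step fwd_split ok0 ok1).
pose b (P : forms) (f : Ind) : E^o := B P f.
have b_bil : bilinear_for (GRing.Scale.Law.clone _ _ *:%R _)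
     (GRing.Scale.Law.clone _ _ *:%R _) b.
  by split=> [f a P Q|P a f f']; rewrite /b /= ?B_linl ?B_linr.
pose bL : {bilinear forms -> Ind -> E^o} :=
  HB.pack b (bilinear_isBilinear.Build E forms Ind E^o _ _ b b_bil).
have [l [lE _]] := rho_tensor.1 _ bL.
have lB P f : l (t P f) = B P f := lE P f.
apply: (@integral_structure_of_bounded _ _ _ _ _ _ _ (iota pi) l (t P0 (edge tame1 tame2)) C).
- exact: (tensor_irreducible pi_unif F_char0 rho_tensor sigma_irr).
- by rewrite fmorph_eq0.
- by rewrite absE_ext (unif_lt1 pi_unif).
- by move=> e e0; have [M hM] := unif_expr_lt pi_unif e0; exists M; rewrite absE_ext.
- by move=> a v w; rewrite linearP.
- by rewrite lB /B (boundary_edge pi_unif tame1 tame2 ok_step fwd_split ok0 ok1).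
move=> g; rewrite rho_tensor.2 lB.
apply: (boundary_bounded pi_unif tame1 tame2 fwd_linear ok_step fwd_split bwd_step ok0 ok1
  bwd0 bwd1' (absE := absE) (lattice := integral_form absE)) => //.
- move=> k P ik; apply: (integral_tau m absE_ext); first exact: det_iwahori ik.
  case: ik => k00 k01 k10 k11 i j.
  by case: (ord2_cases i) => ->; case: (ord2_cases j) => ->; rewrite ?k00 ?k11 // ltW.
- move=> c c0; exists (central_val c); last exact: central_absval.
  by move=> P; rewrite tau_scalar.
- by move=> x x1; apply: (xch_tame_absval absE D).
- by move=> x x1; apply: (xch_tame_absval absE D).
Qed.

End Criterion.

(** * The ratio chi1 / chi2 is unramified *)

Section UnramifiedRatio.
Variables (R : realType) (F : fieldType) (absF : nonarch_absval R F) (pi : F).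
Hypothesis pi_unif : uniformizer absF pi.
Variables (q : nat) (D : digits absF q).
Variables (E : fieldType) (iota : {rmorphism F -> E}) (absE : nonarch_absval R E).
Hypothesis absE_ext : forall x, absE (iota x) = absF x.
Variables chi1 chi2 : {multiplicative unitg F -> unitg E}.
Hypothesis same_on_units : forall x, absF x = 1 -> xch chi1 x = xch chi2 x.
Variables (m : int) (n : nat).
Hypothesis nq : (n < q)%N.
Notation tau := (det_Sym_repn iota m n).
Notation forms := (dhomog 2 E n).
Notation shift := (shift_mx pi).
Notation flip := (flip_mx pi).
Notation c1 := (xch chi1 pi).
Notation c2 := (xch chi2 pi).
Notation eps := (xch chi1 (-1)).
Notation z := (central_val iota m n pi).
Implicit Types (P Q : forms) (A : 'I_n.+1 -> E).

Hypothesis central_unit : absE (z * (c1 * c2)) = 1.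
Hypothesis c1_ge : absE (c1^-1 * iota pi ^ (- m)) <= 1.
Hypothesis c2_ge : absE (q%:R * c2^-1 * iota pi ^ (- m)) <= 1.
Hypothesis c1_neq_c2 : c1 != c2.

Let pi0 : pi != 0 := unif_neq0 pi_unif.
Let ipi0 : iota pi != 0. Proof. by rewrite fmorph_eq0. Qed.
Let c10 : c1 != 0. Proof. by rewrite xch_neq0. Qed.
Let c20 : c2 != 0. Proof. by rewrite xch_neq0. Qed.
Let z0 : z != 0.
Proof. by rewrite mulf_neq0 ?expfz_neq0 ?expf_neq0 ?fmorph_eq0 ?mulf_neq0. Qed.
(** Determinant of the system that expresses the two vertex values of an edge by its two oriented
    edge values. *)
Let kap := 1 - c1 / c2.
Let kap0 : kap != 0.
Proof.
rewrite subr_eq0; apply: contraNneq c1_neq_c2 => e.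
by rewrite -[c2]mul1r e divfK.
Qed.
Let eps2 : eps * eps = 1 := xch_N1_sq chi1.
Let tauM g h P : tau (g * h)%g P = tau g (tau h P) := ractM tau g h P.

Definition dual A P : E := \sum_i A i * coef i P.

Lemma sum_delta A i : \sum_k A k * (k == i)%:R = A i.
Proof.
by rewrite (bigD1 i) //= eqxx mulr1 big1 ?addr0 // => j /negbTE ->; rewrite mulr0.
Qed.

Lemma dual_lin A a P Q : dual A (a *: P + Q) = a * dual A P + dual A Q.
Proof.
by rewrite /dual mulr_sumr -big_split; apply: eq_bigr => i _; rewrite coef_linear mulrDr mulrCA.
Qed.

Lemma dualZ A a P : dual A (a *: P) = a * dual A P.
Proof. by rewrite /dual mulr_sumr; apply: eq_bigr => i _; rewrite coefZ mulrCA. Qed.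

Lemma dual_mono A i : dual A (mono E i) = A i.
Proof.
rewrite /dual (bigD1 i) //= coef_mono eqxx mulr1 big1 ?addr0 // => j ji.
by rewrite coef_mono (negbTE ji) mulr0.
Qed.

Lemma dual_of (psi : forms -> E) :
  (forall a P Q, psi (a *: P + Q) = a * psi P + psi Q) ->
  forall P, dual (fun i => psi (mono E i)) P = psi P.
Proof.
move=> psi_lin P; have psi0 : psi 0 = 0.
  by have := psi_lin (-1) 0 0; rewrite scaleN1r oppr0 addr0 mulN1r addNr.
rewrite [in RHS](forms_decomp P) /dual; symmetry.
elim/big_rec2: _ => // i x Q _ <-.
by rewrite psi_lin mulrC.
Qed.

Lemma dual_scale a A P : dual (fun i => a * A i) P = a * dual A P.
Proof. by rewrite /dual mulr_sumr; apply: eq_bigr => i _; rewrite mulrA. Qed.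

Lemma dual_integral A P :
  (forall i, absE (A i) <= 1) -> integral_form absE P -> absE (dual A P) <= 1.
Proof.
by move=> A1 P1; apply: absval_sum_le => // i _; apply: absval_mul_le.
Qed.

Lemma flip_sq P : tau flip (tau flip P) = z *: P.
Proof. by rewrite -tauM (flip_mx_sq pi_unif) tau_scalar. Qed.

Lemma flipV P : tau flip^-1%g P = z^-1 *: tau flip P.
Proof.
have -> : tau flip P = tau flip (tau flip (tau flip^-1%g P)) by rewrite -!tauM ?mulgA mulgK.
by rewrite flip_sq scalerA mulVf // scale1r.
Qed.

Lemma tau_flipE P : tau flip P = iota pi ^ m *: (iota (-1) ^ m *: Sym_repn iota n flip P).
Proof.
rewrite tauE (det_flip pi_unif) scalerA -[- pi]mulN1r rmorphM expfzMl.
by rewrite [_ * _ ^ m]mulrC.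
Qed.

Lemma integral_flip P : integral_form absE P ->
  integral_form absE (iota (-1) ^ m *: Sym_repn iota n flip P).
Proof.
move=> P1 i; rewrite coefZ absvalM absvalXz absE_ext absvalN1 exp1rz mul1r.
apply: (integral_Sym absE_ext) => // a b; rewrite (flip_mxE pi_unif).
by case: (ord2_cases a) => ->; case: (ord2_cases b) => ->; rewrite mxE /=
  ?absval0 ?absval1 ?ler01 // ltW // (unif_lt1 pi_unif).
Qed.

(* A state is the pair of values at the two ends of an edge of the Poisson
   transform of the functional, transported to the standard edge. *)
Definition unram_state := (('I_n.+1 -> E) * ('I_n.+1 -> E))%type.
Implicit Type s : unram_state.

(** The vector [edge + eps * c1 *: sigma flip^-1 edge] is an eigenvector of GL_2(O_F), which acts
    through chi1 o det. Hence [s.1] at [P] should be [fwd P + eps * c1 * bwd (tau flip P)], and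
    [s.2] at [P] should be [bwd P + eps * c2^-1 * fwd (tau flip^-1 P)]; [unram_fwd] and [unram_bwd]
    solve this system. [s.1] belongs to the outer end. *)
Definition unram_fwd s P : E := (dual s.1 P - eps * c1 * dual s.2 (tau flip P)) / kap.

Definition unram_bwd s P : E := dual s.2 P - eps * c2^-1 * unram_fwd s (tau flip^-1%g P).

Definition node (l : 'I_n.+1) : E := iota (D (widen_ord nq l)).

(** Hecke relation at the outer vertex: the sum over the [q] further neighbours is the eigenvalue
    times the value there, minus the contribution of the inner neighbour. *)
Definition target s P : E :=
  (c1^-1 + q%:R * c2^-1) * dual s.1 P - eps * dual s.2 (tau flip P).

(** Solution of the Vandermonde system that represents [target s] as a combination of evaluations at
    the nodes; [iota pi ^ (- m)] cancels the determinant of the shift. *)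
Definition weight s (l : 'I_n.+1) : E :=
  \sum_k iota pi ^ (- m) * target s (mono E k) * invmx (power_mx node) k l.

(** Only the first [n.+1] children get a nonzero form at their outer vertex, a multiple of [coef 0].
    The inner vertex is the outer vertex of the parent, so its value is copied, moved by
    [(shift (D r))^-1 * flip]; the inverse scalar comes from [flip * flip] being the scalar [pi]. *)
Definition unram_step s (r : 'I_q) : unram_state :=
  (fun i => if (r < n.+1)%N && (i == 0) then weight s (inord r) else 0,
   fun i => eps * (z * (c1 * c2))^-1 *
     dual s.1 (tau ((shift (D r))^-1 * flip)%g (mono E i))).

Definition unram_ok s : Prop := (forall i, absE (s.1 i) <= 1) /\ (forall i, absE (s.2 i) <= 1).

Lemma node_inj : injective node.
Proof.
move=> k l /fmorph_inj kl; apply/eqP; apply: contraT => neq.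
have := dig_sep D (_ : widen_ord nq k != widen_ord nq l).
rewrite kl subrr absval0 => e; have /e/eqP : widen_ord nq k != widen_ord nq l.
  by apply: contra neq => /eqP/(congr1 val)/= e'; apply/eqP/val_inj.
by rewrite eq_sym oner_eq0.
Qed.

Lemma eps_absval : absE eps = 1.
Proof.
have /eqP : absE eps ^+ 2 = 1 by rewrite -absvalX expr2 eps2 absval1.
rewrite sqrf_eq1 => /orP[/eqP //|/eqP eN].
by have := absval_ge0 absE eps; rewrite eN oppr_ge0 ler10.
Qed.

Lemma dual_tau A g a P Q :
  dual A (tau g (a *: P + Q)) = a * dual A (tau g P) + dual A (tau g Q).
Proof. by rewrite ract_linear dual_lin. Qed.

Lemma target_lin s a P Q : target s (a *: P + Q) = a * target s P + target s Q.
Proof.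
rewrite /target dual_lin dual_tau.
move: (dual s.1 P) (dual s.1 Q) (dual s.2 _) (dual s.2 _) => x y x' y'; ring.
Qed.

Lemma step2E s r P : dual (unram_step s r).2 P =
  eps * (z * (c1 * c2))^-1 * dual s.1 (tau ((shift (D r))^-1 * flip)%g P).
Proof.
rewrite dual_scale; congr (_ * _).
by rewrite (dual_of (psi := fun P => dual s.1 (tau _ P))) // => a Q Q'; exact: dual_tau.
Qed.

(* Lagrange interpolation at n + 1 digits. *)
Lemma step1_sum s P : \sum_r dual (unram_step s r).1 (tau (shift (D r)) P) = target s P.
Proof.
have stE r : dual (unram_step s r).1 (tau (shift (D r)) P) =
    if (r < n.+1)%N then weight s (inord r) * (iota pi ^ m * \sum_i coef i P * iota (D r) ^+ i)
    else 0.
  rewrite /dual (bigD1 0) //= andbT big1 ?addr0; last first.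
    by move=> i /negbTE i0; rewrite i0 andbF mul0r.
  by case: ifP => _; rewrite ?mul0r //
    -[X in _ * X]/(coef 0 (tau _ P)) tauE coefZ (det_shift pi_unif) coef0_shift.
rewrite (eq_bigr _ (fun r _ => stE r)) -big_mkcond big_ord_narrow.
under eq_bigr => l _ do rewrite /= inord_val -/(node l).
transitivity (\sum_i coef i P * target s (mono E i)); last first.
  rewrite -[RHS](dual_of (psi := target s)); last exact: target_lin.
  by apply: eq_bigr => i _; rewrite mulrC.
under eq_bigr => l _ do rewrite mulrCA mulr_sumr mulr_sumr.
rewrite exchange_big; apply: eq_bigr => i _.
transitivity (coef i P * (iota pi ^ m * \sum_k iota pi ^ (- m) * target s (mono E k) *
    \sum_l invmx (power_mx node) k l * node l ^+ i)).
  under [in RHS]eq_bigr => k _ do rewrite mulr_sumr.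
  rewrite exchange_big /= mulr_sumr mulr_sumr; apply: eq_bigr => l _.
  have -> : \sum_k iota pi ^ (- m) * target s (mono E k) *
      (invmx (power_mx node) k l * node l ^+ i) = weight s l * node l ^+ i.
    by rewrite /weight mulr_suml; apply: eq_bigr => k _; rewrite mulrA.
  move: (iota pi ^ m) (node l ^+ i) => a b; ring.
congr (_ * _); under eq_bigr => k _ do rewrite (power_mx_inv node_inj).
rewrite (sum_delta (fun k => iota pi ^ (- m) * target s (mono E k))).
by rewrite mulrA -expfzDr // subrr mul1r.
Qed.

Lemma unram_fwd_lin s a P Q : unram_fwd s (a *: P + Q) = a * unram_fwd s P + unram_fwd s Q.
Proof.
rewrite /unram_fwd dual_lin dual_tau.
move: (dual s.1 P) (dual s.1 Q) (dual s.2 _) (dual s.2 _) => x y x' y'; ring.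
Qed.

(** The contribution of the shared vertex does not depend on [r]; summed over the [q] children it
    cancels the term [q%:R * c2^-1] of [target]. *)
Lemma unram_fwd_step s r P : unram_fwd (unram_step s r) (tau (shift (D r)) P) =
  (dual (unram_step s r).1 (tau (shift (D r)) P) - c2^-1 * dual s.1 P) / kap.
Proof.
rewrite /unram_fwd step2E; congr ((_ - _) / _).
rewrite tauM flip_sq -ractZ -tauM mulVg ract1 dualZ.
transitivity (eps * eps * (c2^-1 * dual s.1 P)); last by rewrite eps2 mul1r.
by field; rewrite c10 c20 z0.
Qed.

Lemma unram_fwd_split s P :
  unram_fwd s P = c1 * \sum_i unram_fwd (unram_step s i) (tau (shift (D i)) P).
Proof.
rewrite (eq_bigr _ (fun i _ => unram_fwd_step s i P)) -mulr_suml sumrB step1_sum.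
rewrite sumr_const card_ord -mulr_natl /target /unram_fwd; field.
by rewrite c10 c20 kap0.
Qed.

Lemma unram_bwd_flip s P :
  unram_bwd s (tau flip P) = dual s.2 (tau flip P) - eps * c2^-1 * unram_fwd s P.
Proof. by rewrite /unram_bwd -tauM mulVg ract1. Qed.

Lemma unram_bwd_step s i P : unram_bwd (unram_step s i) P =
  c2^-1 * (unram_bwd s (tau (flip * (shift (D i))^-1 * flip^-1)%g P) +
    eps * \sum_(j | j != i) eta chi1 chi2 (D j - D i) *
      unram_fwd (unram_step s j) (tau (shift (D j) * (shift (D i))^-1 * flip^-1)%g P)).
Proof.
pose y := tau ((shift (D i))^-1 * flip^-1)%g P.
have -> : tau (flip * (shift (D i))^-1 * flip^-1)%g P = tau flip y.
  by rewrite /y -tauM mulgA.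
(* [eta] is 1 on differences of distinct digits, so the sum over the siblings is the full sum of
   [unram_fwd_split] minus its [i]-th term. *)
have sumE : \sum_(j | j != i) eta chi1 chi2 (D j - D i) *
    unram_fwd (unram_step s j) (tau (shift (D j) * (shift (D i))^-1 * flip^-1)%g P) =
    c1^-1 * unram_fwd s y - unram_fwd (unram_step s i) (tau flip^-1%g P).
  transitivity (\sum_(j | j != i) unram_fwd (unram_step s j) (tau (shift (D j)) y)).
    apply: eq_bigr => j ji; have d1 := dig_sep D ji.
    have d0 : D j - D i != 0 by rewrite -(absval_gt0 absF) d1.
    by rewrite /eta (same_on_units d1) divff ?xch_neq0 // mul1r /y -tauM mulgA.
  have sumD : \sum_j unram_fwd (unram_step s j) (tau (shift (D j)) y) =
      unram_fwd (unram_step s i) (tau (shift (D i)) y) +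
      \sum_(j | j != i) unram_fwd (unram_step s j) (tau (shift (D j)) y) by rewrite (bigD1 i).
  have yE : tau (shift (D i)) y = tau flip^-1%g P.
    by rewrite /y -tauM mulgA mulgV mul1g.
  have moveE (a b c : E) : a = b + c -> c = a - b by move=> ->; rewrite addrC addKr.
  by apply: moveE; rewrite -yE -sumD (unram_fwd_split s y) mulKf.
rewrite sumE unram_bwd_flip {1}/unram_bwd step2E.
have -> : tau ((shift (D i))^-1 * flip)%g P = z *: y.
  rewrite /y !tauM flipV [X in _ = _ *: X]ractZ.
  by rewrite [RHS]scalerA mulfV // scale1r.
rewrite dualZ; set a := unram_fwd (unram_step s i) _.
transitivity (eps * eps * (eps * (c1 * c2)^-1 * dual s.1 y) - eps / c2 * a).
  by rewrite eps2 mul1r; congr (_ - _); field; rewrite c10 c20 z0.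
have -> : dual s.1 y = kap * unram_fwd s y + eps * c1 * dual s.2 (tau flip y).
  by rewrite /unram_fwd mulrCA divff // mulr1 subrK.
transitivity (c2^-1 * (eps * eps * (eps * eps) * dual s.2 (tau flip y) +
  eps * eps * eps / c1 * kap * unram_fwd s y) - eps / c2 * a).
  by field; rewrite c10 c20.
by rewrite eps2 !mul1r /kap; field; rewrite c10 c20.
Qed.

Definition unram_init : unram_state := (fun i => (i == 0)%:R, fun=> 0).

(** The root edge with its ends exchanged, up to the central factor of [flip * flip]. *)
Definition unram_opp : unram_state := (unram_init.2, fun i => (z * (c1 * c2))^-1 * unram_init.1 i).

Lemma unram_bwd_init P : unram_bwd unram_init P = unram_fwd unram_opp P.
Proof.
have d2 Q : dual unram_init.2 Q = 0 by rewrite /dual big1 // => i _; rewrite mul0r.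
rewrite /unram_bwd /unram_fwd dual_scale !d2 flipV dualZ; field.
by rewrite c10 c20 z0 kap0.
Qed.

Lemma unram_bwd_opp P : unram_bwd unram_opp P = (z * (c1 * c2))^-1 * unram_fwd unram_init P.
Proof.
have d2 Q : dual unram_init.2 Q = 0 by rewrite /dual big1 // => i _; rewrite mul0r.
rewrite /unram_bwd /unram_fwd !dual_scale !d2 -tauM mulgV ract1.
set A0 := dual _ P; transitivity ((z * (c1 * c2))^-1 * A0 * (1 + eps * eps * c1 / c2 / kap)).
  by field; rewrite c10 c20 z0 kap0.
have -> : 1 + eps * eps * c1 / c2 / kap = kap^-1.
  by rewrite eps2 mul1r -{1}(divff kap0) -mulrDl /kap subrK mul1r.
by rewrite mulr0 subr0 -mulrA.
Qed.

Lemma absval_bool (b : bool) : absE b%:R <= 1.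
Proof. by case: b; rewrite ?absval1 ?absval0 ?ler01. Qed.

Lemma unram_ok_init : unram_ok unram_init.
Proof. by split=> i; [exact: absval_bool|rewrite absval0 ler01]. Qed.

Lemma unram_ok_opp : unram_ok unram_opp.
Proof.
split=> i /=; first by rewrite absval0 ler01.
rewrite absvalM absvalV central_unit invr1 mul1r; exact: absval_bool.
Qed.

(** [flip] has integral entries but determinant [- pi]; the power of [pi] compensates only the twist
    by the determinant. *)
Lemma flip_bound A P : (forall i, absE (A i) <= 1) -> integral_form absE P ->
  absE (iota pi ^ (- m) * dual A (tau flip P)) <= 1.
Proof.
move=> A1 P1; rewrite tau_flipE dualZ mulrA -expfzDr // addNr mul1r.
exact/dual_integral/integral_flip.
Qed.

(** At the outer vertex [c1_ge] and [c2_ge] bound the two terms of the Hecke eigenvalue, and the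
    inverse Vandermonde matrix is integral; at the inner vertex only a unit and an element of
    GL_2(O_F) intervene. *)
Lemma unram_ok_step s r : unram_ok s -> unram_ok (unram_step s r).
Proof.
case=> s1 s2; split=> i /=.
  case: ifP => _; last by rewrite absval0 ler01.
  apply: absval_sum_le => // k _; apply: absval_mul_le; last first.
    apply: (power_mx_inv_integral node_inj) => [l|l l' ll'].
      by rewrite absE_ext dig_le1.
    by rewrite -rmorphB absE_ext dig_sep.
  rewrite /target mulrBr mulrA mulrDr; apply: absvalD_le.
    apply: absval_mul_le; last exact: (dual_integral s1 (integral_mono absE k)).
    by apply: absvalD_le; rewrite [iota pi ^ _ * _]mulrC.
  rewrite absvalN mulrCA absvalM eps_absval mul1r.
  exact: (flip_bound s2 (integral_mono absE k)).
rewrite !absvalM eps_absval mul1r -!absvalM absvalM absvalV central_unit invr1 mul1r.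
apply: (dual_integral s1); apply: (integral_tau m absE_ext); last exact: integral_mono.
  by rewrite detM detV (det_shift pi_unif) (det_flip pi_unif) mulrN mulVf ?absvalN1.
(* No [pi] is left: this element fixes the vertex shared by the two edges. *)
have gE : uval ((shift (D r))^-1 * flip)%g = mx2 0 1 1 (- D r).
  rewrite uvalM (shift_mxVE pi_unif) (flip_mxE pi_unif) mx2_mul.
  by congr mx2; field; rewrite ?pi0.
move=> a b; rewrite gE; case: (ord2_cases a) => ->; case: (ord2_cases b) => ->;
  rewrite mxE /= ?absval0 ?absval1 ?ler01 // absvalN; exact: dig_le1.
Qed.

(** A crude common bound for both orientations. The division by [kap], which may be small, is why it
    need not be 1. *)
Definition unram_bound : R :=
  (1 + absE c1 * absE (iota pi ^ m)) / absE kap +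
  absE c2^-1 * ((absE (z^-1 * iota pi ^ m) + absE c1) / absE kap) + 1.

Lemma flip_bound_pi A P : (forall i, absE (A i) <= 1) -> integral_form absE P ->
  absE (dual A (tau flip P)) <= absE (iota pi ^ m).
Proof.
move=> A1 P1; rewrite tau_flipE dualZ absvalM ler_piMr ?absval_ge0 //.
exact/dual_integral/integral_flip.
Qed.

Lemma max_le_add (x y a b : R) : 0 <= a -> 0 <= b -> x <= a -> y <= b -> Num.max x y <= a + b.
Proof. by move=> a0 b0 xa yb; rewrite ge_max (le_trans xa) ?lerDl // (le_trans yb) ?lerDr. Qed.

Lemma unram_fwd_bound s P :
  unram_ok s -> integral_form absE P -> absE (unram_fwd s P) <= unram_bound.
Proof.
case=> s1 s2 P1; rewrite /unram_fwd absvalM absvalV.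
apply: (@le_trans _ _ ((1 + absE c1 * absE (iota pi ^ m)) / absE kap)).
  rewrite ler_wpM2r ?invr_ge0 ?absval_ge0 //; apply: le_trans (absvalB_le _ _ _) _.
  apply: max_le_add => //; rewrite ?mulr_ge0 ?absval_ge0 //; first exact: dual_integral.
  by rewrite !absvalM eps_absval mul1r ler_wpM2l ?absval_ge0 // flip_bound_pi.
rewrite /unram_bound -addrA lerDl !addr_ge0 ?ler01 // !mulr_ge0 ?invr_ge0 ?addr_ge0 ?absval_ge0 //.
Qed.

Lemma unram_bwd_bound s P :
  unram_ok s -> integral_form absE P -> absE (unram_bwd s P) <= unram_bound.
Proof.
case=> s1 s2 P1; rewrite /unram_bwd; apply: le_trans (absvalB_le _ _ _) _.
have N0 : 0 <= (1 + absE c1 * absE (iota pi ^ m)) / absE kap.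
  by rewrite mulr_ge0 ?invr_ge0 ?addr_ge0 ?mulr_ge0 ?absval_ge0 ?ler01.
have N1 : 0 <= absE c2^-1 * ((absE (z^-1 * iota pi ^ m) + absE c1) / absE kap).
  by rewrite !mulr_ge0 ?invr_ge0 ?addr_ge0 ?absval_ge0.
rewrite /unram_bound -addrA; apply: (@le_trans _ _ (absE c2^-1 *
  ((absE (z^-1 * iota pi ^ m) + absE c1) / absE kap) + 1)); last by rewrite lerDr.
rewrite addrC; apply: max_le_add => //; first exact: dual_integral.
rewrite !absvalM eps_absval mul1r -absvalM ler_wpM2l ?absval_ge0 // /unram_fwd absvalM absvalV.
rewrite ler_wpM2r ?invr_ge0 ?absval_ge0 // -tauM mulgV ract1; apply: le_trans (absvalB_le _ _ _) _.
apply: max_le_add; rewrite ?mulr_ge0 ?absval_ge0 //.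
  by rewrite flipV dualZ absvalM ler_wpM2l ?absval_ge0 // flip_bound_pi.
by rewrite !absvalM eps_absval mul1r ler_piMr ?absval_ge0 // dual_integral.
Qed.

Lemma unram_fwd_init_neq0 : unram_fwd unram_init (mono E 0) != 0.
Proof.
have d2 Q : dual unram_init.2 Q = 0 by rewrite /dual big1 // => i _; rewrite mul0r.
by rewrite /unram_fwd d2 mulr0 subr0 dual_mono /= mul1r invr_eq0.
Qed.

End UnramifiedRatio.

(** * The ratio chi1 / chi2 is tamely ramified *)

Section CharacterSums.
Variables (R : realType) (F : fieldType) (absF : nonarch_absval R F).
Variables (q : nat) (D : digits absF q) (E : fieldType) (theta : F -> E).
Hypothesis thetaM : forall x y, theta (x * y) = theta x * theta y.
Hypothesis theta_near : forall x y, absF x = 1 -> absF (x - y) < 1 -> theta x = theta y.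
Variable y0 : F.
Hypothesis y0_unit : absF y0 = 1.
Hypothesis theta_y0 : theta y0 != 1.

Lemma dig_neq0 i j : i != j -> D i - D j != 0.
Proof. by move=> ij; rewrite -(absval_gt0 absF) (dig_sep D ij) ltr01. Qed.

(** [j0] is only a default for non-integral [x]. *)
Definition digit (x : F) (j0 : 'I_q) : 'I_q :=
  if pselect (absF x <= 1) is left x1 then projT1 (cid (dig_near D x1)) else j0.

Lemma digitP x j0 : absF x <= 1 -> absF (x - D (digit x j0)) < 1.
Proof. by move=> x1; rewrite /digit; case: pselect => // x1'; case: cid. Qed.

Lemma digit_sep x y j0 : absF x <= 1 -> absF y <= 1 -> absF (x - y) = 1 ->
  digit x j0 != digit y j0.
Proof.
move=> x1 y1 xy; apply/eqP => e; have := absvalB_lt (digitP j0 x1) (digitP j0 y1).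
by rewrite e opprB addrA subrK xy ltxx.
Qed.

Lemma digit_eq x j j0 : absF x <= 1 -> absF (x - D j) < 1 -> digit x j0 = j.
Proof.
move=> x1 xj; apply/eqP/negPn/negP => ij; have := dig_sep D ij.
have -> : D (digit x j0) - D j = (x - D j) - (x - D (digit x j0)) by ring.
by move=> e; have := absvalB_lt xj (digitP j0 x1); rewrite e ltxx.
Qed.

(** Multiplication by [y0] permutes the nonzero residue classes and multiplies the sum by
    [theta y0], which is not 1. *)
Lemma character_sum r0 : \sum_(j | j != r0) theta (D j - D r0) = 0.
Proof.
pose f j := digit (D r0 + y0 * (D j - D r0)) r0.
have le1 j : absF (D r0 + y0 * (D j - D r0)) <= 1.
  apply: absvalD_le; first exact: dig_le1.
  by rewrite absvalM y0_unit mul1r; apply: absvalD_le; rewrite ?absvalN dig_le1.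
have f_inj : injective f.
  move=> j k jk; apply/eqP/negPn/negP => neq; move/eqP: jk; apply/negP/digit_sep => //.
  have -> : D r0 + y0 * (D j - D r0) - (D r0 + y0 * (D k - D r0)) = y0 * (D j - D k) by ring.
  by rewrite absvalM y0_unit mul1r dig_sep.
have f_r0 : f r0 = r0.
  by apply: digit_eq => //; rewrite subrr mulr0 addr0 subrr absval0 ltr01.
set S := \sum_(_ | _) _.
have SE : S = theta y0 * S.
  rewrite {1}/S (reindex_inj f_inj) mulr_sumr; apply: eq_big => [j|j jr].
    by rewrite -{1}f_r0 (inj_eq f_inj).
  have {}jr : j != r0 by rewrite -(inj_eq f_inj) f_r0.
  rewrite -thetaM; symmetry; apply: theta_near.
    by rewrite absvalM y0_unit mul1r dig_sep.
  have -> : y0 * (D j - D r0) - (D (f j) - D r0) =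
    D r0 + y0 * (D j - D r0) - D (f j) by ring.
  exact: digitP.
apply/eqP; have : (1 - theta y0) * S = 0 by rewrite mulrBl mul1r -SE subrr.
by move/eqP; rewrite mulf_eq0 subr_eq0 eq_sym (negbTE theta_y0).
Qed.

(* The Moebius map (x - i) / (x - r0) permutes the residue projective line. *)
Lemma character_sum_quotient i r0 : i != r0 ->
  \sum_(j | (j != r0) && (j != i)) theta ((D j - D i) / (D j - D r0)) = - theta 1.
Proof.
(* The map sends [r0] to infinity and infinity to 1; giving [r0] the value 1 makes it a permutation
   of the finite classes. That extra term is the [theta 1] of the result, and [i], sent to 0, drops
   out. *)
move=> ir0; pose x j := if j == r0 then D r0 + 1 else D r0 + (D j - D i) / (D j - D r0).
have le1 j : absF (x j) <= 1.
  rewrite /x; case: ifP => jr0; apply: absvalD_le; rewrite ?dig_le1 ?absval1 //.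
  rewrite absvalM absvalV [absF (D j - D r0)]dig_sep ?jr0 // invr1 mulr1.
  by apply: absvalD_le; rewrite ?absvalN dig_le1.
have sep j k : j != k -> absF (x j - x k) = 1.
  have one j' : j' != r0 -> absF (D r0 + (D j' - D i) / (D j' - D r0) - (D r0 + 1)) = 1.
    move=> j'r0; have d0 := dig_neq0 j'r0.
    have -> : D r0 + (D j' - D i) / (D j' - D r0) - (D r0 + 1) =
      (D r0 - D i) / (D j' - D r0) by field.
    by rewrite absvalM absvalV !dig_sep // ?invr1 ?mulr1 // eq_sym.
  move=> jk; rewrite /x; have [jr0|jr0] := eqVneq j r0; have [kr0|kr0] := eqVneq k r0.
  - by rewrite jr0 kr0 eqxx in jk.
  - by rewrite absvalBC one.
  - by rewrite one.
  have dj := dig_neq0 jr0; have dk := dig_neq0 kr0.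
  have -> : D r0 + (D j - D i) / (D j - D r0) - (D r0 + (D k - D i) / (D k - D r0)) =
    (D i - D r0) * (D j - D k) / ((D j - D r0) * (D k - D r0)) by field; rewrite dj dk.
  by rewrite absvalM absvalV !absvalM !dig_sep // !mulr1 invr1 mulr1.
pose f j := digit (x j) r0.
have f_inj : injective f.
  move=> j k jk; apply/eqP/negPn/negP => neq; move/eqP: jk; apply/negP/digit_sep => //.
  exact: sep.
have f_i : f i = r0.
  by apply: digit_eq => //; rewrite /x (negbTE ir0) subrr mul0r addr0 subrr absval0 ltr01.
have fP j y : x j = D r0 + y -> absF y = 1 -> theta (D (f j) - D r0) = theta y.
  move=> xj y1; symmetry; apply: theta_near => //.
  have -> : y - (D (f j) - D r0) = D r0 + y - D (f j) by ring.
  by rewrite -xj; apply: digitP.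
have := character_sum r0; rewrite (reindex_inj f_inj) (bigD1 r0) /=; last first.
  by rewrite -[X in _ != X]f_i (inj_eq f_inj) eq_sym.
rewrite (fP r0 1) ?absval1 //; last by rewrite /x eqxx.
move/eqP; rewrite addrC addr_eq0 => /eqP <-; apply: eq_big => [j|j /andP[jr0 ji]].
  by rewrite -[X in _ = (_ != X) && _]f_i (inj_eq f_inj) andbC.
rewrite (fP j ((D j - D i) / (D j - D r0))) //; first by rewrite /x (negbTE jr0).
by rewrite absvalM absvalV !dig_sep // invr1 mulr1.
Qed.

End CharacterSums.

Section RamifiedRatio.
Variables (R : realType) (F : fieldType) (absF : nonarch_absval R F) (pi : F).
Hypothesis pi_unif : uniformizer absF pi.
Variables (q : nat) (D : digits absF q).
Variables (E : fieldType) (iota : {rmorphism F -> E}) (absE : nonarch_absval R E).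
Hypothesis absE_ext : forall x, absE (iota x) = absF x.
Variables chi1 chi2 : {multiplicative unitg F -> unitg E}.
Hypothesis tame1 : forall x, absF (x - 1) < 1 -> xch chi1 x = 1.
Hypothesis tame2 : forall x, absF (x - 1) < 1 -> xch chi2 x = 1.
Variable y0 : F.
Hypothesis y0_unit : absF y0 = 1.
Hypothesis eta_y0 : xch chi1 y0 != xch chi2 y0.
Variable m : int.
Notation tau := (det_Sym_repn iota m 0).
Notation forms := (dhomog 2 E 0).
Notation shift := (shift_mx pi).
Notation flip := (flip_mx pi).
Notation c1 := (xch chi1 pi).
Notation c2 := (xch chi2 pi).
Notation z := (central_val iota m 0 pi).
Notation lam := (c1 * iota pi ^ m).
Notation mu := (c2 * iota pi ^ m).
Notation eps := (xch chi1 (-1) * iota (-1) ^ m).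
Notation eta := (eta chi1 chi2).
Implicit Types (P Q : forms).

Hypothesis lam_mu : absE (lam * mu) = 1.
Hypothesis lam_ge : absE lam^-1 <= 1.
Hypothesis mu_ge : absE (q%:R * mu^-1) <= 1.

Let pi0 : pi != 0 := unif_neq0 pi_unif.
Let ipi0 : iota pi != 0. Proof. by rewrite fmorph_eq0. Qed.
Let c10 : c1 != 0. Proof. by rewrite xch_neq0. Qed.
Let c20 : c2 != 0. Proof. by rewrite xch_neq0. Qed.
Let pm0 : iota pi ^ m != 0. Proof. by rewrite expfz_neq0. Qed.

Lemma det_tau0 g P : tau g P = iota (\det (uval g)) ^ m *: P.
Proof.
rewrite tauE; congr (_ *: _); rewrite [P]forms_decomp repn_sum; apply: eq_bigr => i _.
rewrite ractZ; congr (_ *: _); apply/val_inj; rewrite val_Sym_mono val_mono.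
have i0 : nat_of_ord i = 0%N by rewrite ord1.
by rewrite !i0 sub0n !expr0.
Qed.

Lemma eta_unit x : absF x = 1 -> absE (eta x) = 1.
Proof.
move=> x1; rewrite /eta absvalM absvalV !(xch_tame_absval absE D _ x1) //.
by rewrite invr1 mulr1.
Qed.

Lemma eps_sq : eps * eps = 1.
Proof.
rewrite mulrACA xch_N1_sq mul1r -expfzMl -rmorphM mulrNN mulr1 rmorph1.
exact: exp1rz.
Qed.

Lemma eps_unit : absE eps = 1.
Proof.
rewrite absvalM absvalXz absE_ext absvalN1 exp1rz mulr1.
by apply: (xch_tame_absval absE D); rewrite ?absvalN1.
Qed.

Lemma etaM x y : eta (x * y) = eta x * eta y.
Proof. by rewrite /eta !xchM invfM mulrACA. Qed.

Lemma etaV x : eta x^-1 = (eta x)^-1.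
Proof. by rewrite /eta !xchV invfM invrK. Qed.

Lemma eta1 : eta 1 = 1.
Proof. by rewrite /eta !xch1 divr1. Qed.

Lemma eta_neq0 x : x != 0 -> eta x != 0.
Proof. by move=> x0; rewrite mulf_neq0 ?invr_eq0 ?xch_neq0. Qed.

Lemma eta_near_unit x y : absF x = 1 -> absF (x - y) < 1 -> eta x = eta y.
Proof.
move=> x1 xy; apply: (eta_near tame1 tame2).
  by rewrite -(absval_gt0 absF) x1.
suff -> : absF y = 1 by [].
have -> : y = - (x - y) + x by ring.
by rewrite absvalD_eq ?absvalN ?x1.
Qed.

Lemma eta_y0_neq1 : eta y0 != 1.
Proof.
apply: contraNneq eta_y0 => e; have y00 : y0 != 0 by rewrite -(absval_gt0 absF) y0_unit.
by rewrite -[xch chi2 y0](divfK (_ : xch chi1 y0 != 0)) ?xch_neq0 // -/(eta y0) e mul1r.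
Qed.

Lemma eta_sum i r0 : i != r0 ->
  \sum_(j | (j != i) && (j != r0)) eta (D j - D i) * (eta (D j - D r0))^-1 = -1.
Proof.
move=> ir0; rewrite -eta1 -(character_sum_quotient D etaM eta_near_unit y0_unit eta_y0_neq1 ir0).
by apply: eq_big => [j|j _]; rewrite 1?andbC // etaM etaV.
Qed.

Lemma etaV_sum r0 : \sum_(j | j != r0) (eta (D j - D r0))^-1 = 0.
Proof.
apply: (@character_sum _ _ _ _ D _ (fun x => (eta x)^-1) _ _ y0) => //.
- by move=> x y; rewrite etaM invfM.
- by move=> x y x1 xy; rewrite (eta_near_unit x1 xy).
- by rewrite invr_eq1 eta_y0_neq1.
Qed.

(* With a' = s.1 / lam at the digit r0, the choice eps * s.2 / eta (j - r0) at the
   digits j <> r0 keeps the sum equal to a', by [etaV_sum], and makes the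
   convolution with eta in [ram_bwd_step] divisible by q, resp. proportional to
   a', by [eta_sum]. *)
Variable r0 : 'I_q.

Definition ram_fwd (s : E * E) P : E := s.1 * coef 0 P.

Definition ram_bwd (s : E * E) P : E := s.2 * coef 0 P.

Definition ram_step (s : E * E) (r : 'I_q) : E * E :=
  if r == r0 then (lam^-1 * s.1, q%:R * mu^-1 * s.2)
  else (eps * s.2 * (eta (D r - D r0))^-1, eps * (lam * mu)^-1 * eta (D r0 - D r) * s.1).

Definition ram_ok (s : E * E) : Prop := absE s.1 <= 1 /\ absE s.2 <= 1.

(** At [r0] this is the integrality of [lam^-1] and [q%:R * mu^-1]; at the other digits every factor
    is a unit. *)
Lemma ram_ok_step s r : ram_ok s -> ram_ok (ram_step s r).
Proof.
case=> s1 s2; rewrite /ram_step; have [|rr0] := eqVneq r r0.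
  by split; apply: absval_mul_le.
have u1 : absE (eta (D r - D r0)) = 1 by apply: eta_unit; rewrite dig_sep.
have u2 : absE (eta (D r0 - D r)) = 1 by apply: eta_unit; rewrite dig_sep // eq_sym.
split; rewrite /= absvalM.
  by rewrite absvalV u1 invr1 mulr1 absvalM eps_unit mul1r.
by rewrite absvalM u2 mulr1 absvalM eps_unit mul1r absvalV lam_mu invr1 mul1r.
Qed.

Lemma ram_fwd_lin s a P Q : ram_fwd s (a *: P + Q) = a * ram_fwd s P + ram_fwd s Q.
Proof. by rewrite /ram_fwd coef_linear; ring. Qed.

Lemma ram_step1 s r : r != r0 -> (ram_step s r).1 = eps * s.2 * (eta (D r - D r0))^-1.
Proof. by rewrite /ram_step => /negbTE ->. Qed.

Lemma ram_step_sum s : \sum_r (ram_step s r).1 = lam^-1 * s.1.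
Proof.
rewrite (bigD1 r0) //= {1}/ram_step eqxx /= (eq_bigr _ (fun r h => ram_step1 s h)).
by rewrite -mulr_sumr etaV_sum mulr0; exact: addr0.
Qed.

Lemma ram_fwd_split s P : ram_fwd s P = c1 * \sum_i ram_fwd (ram_step s i) (tau (shift (D i)) P).
Proof.
rewrite /ram_fwd; have tE i : (ram_step s i).1 * coef 0 (tau (shift (D i)) P) =
    (ram_step s i).1 * (iota pi ^ m * coef 0 P).
  by rewrite det_tau0 (det_shift pi_unif) coefZ.
rewrite (eq_bigr _ (fun i _ => tE i)) -mulr_suml ram_step_sum.
by move: (iota pi ^ m) pm0 => x x0; field; rewrite c10 x0.
Qed.

Lemma ram_bwd_convolution s i :
  (ram_step s i).2 = mu^-1 * (s.2 + eps * \sum_(j | j != i) eta (D j - D i) * (ram_step s j).1).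
Proof.
have [->|ir0] := eqVneq i r0.
  (* Each of the [q.-1] siblings contributes [s.2] once [eps * eps = 1] is applied; with the parent
     term this makes [q%:R * s.2]. *)
  have tE j : j != r0 -> eta (D j - D r0) * (ram_step s j).1 = eps * s.2.
    move=> jr0; rewrite ram_step1 // mulrCA mulfV ?mulr1 // eta_neq0 //.
    by rewrite -(absval_gt0 absF) dig_sep ?ltr01.
  rewrite (eq_bigr _ (fun j h => tE j h)) sumr_const /ram_step eqxx /=.
  have -> : #|(fun j : 'I_q => j != r0)| = q.-1.
    by have := cardC1 r0; rewrite card_ord => <-; apply: eq_card.
  have q0 : (0 < q)%N by apply: leq_trans (ltn_ord r0).
  have qE : q%:R = 1 + q.-1%:R :> E by rewrite -{1}(prednK q0) -natr1 addrC.
  rewrite -[_ *+ q.-1]mulr_natr qE.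
  transitivity (mu^-1 * (s.2 + eps * eps * s.2 * q.-1%:R)); last by rewrite !mulrA.
  rewrite eps_sq; ring.
(* The digits other than [i] and [r0] contribute [- s.2] by [eta_sum], cancelling the parent term;
   only the digit [r0] survives. *)
have r0i : r0 != i by rewrite eq_sym.
rewrite (bigD1 r0) //=.
have tE j : (j != i) && (j != r0) -> eta (D j - D i) * (ram_step s j).1 =
    eps * s.2 * (eta (D j - D i) * (eta (D j - D r0))^-1).
  by case/andP=> _ jr0; rewrite ram_step1 //; ring.
rewrite (eq_bigr _ tE) -mulr_sumr eta_sum // {1}/ram_step (negbTE ir0) /ram_step eqxx /=.
transitivity (mu^-1 * (s.2 + eps * (eta (D r0 - D i) * (lam^-1 * s.1)) - eps * eps * s.2)).
  rewrite eps_sq; move: (iota pi ^ m) pm0 (iota (-1) ^ m) (eta _) => x x0 y w.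
  by field; rewrite c10 c20 x0.
congr (_ * _); ring.
Qed.

Lemma ram_bwd_step s i P : ram_bwd (ram_step s i) P =
  c2^-1 * (ram_bwd s (tau (flip * (shift (D i))^-1 * flip^-1)%g P) +
    xch chi1 (-1) * \sum_(j | j != i) eta (D j - D i) *
      ram_fwd (ram_step s j) (tau (shift (D j) * (shift (D i))^-1 * flip^-1)%g P)).
Proof.
have tE j : eta (D j - D i) *
    ram_fwd (ram_step s j) (tau (shift (D j) * (shift (D i))^-1 * flip^-1)%g P) =
    (iota (-1) ^ m * (iota pi ^ m)^-1 * coef 0 P) * (eta (D j - D i) * (ram_step s j).1).
  rewrite /ram_fwd det_tau0 coefZ !detM !detV !(det_shift pi_unif) (det_flip pi_unif).
  rewrite mulfV // mul1r.
  rewrite -[- pi]mulN1r invfM invrN1 rmorphM expfzMl fmorphV exprz_inv -invr_expz.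
  ring.
rewrite (eq_bigr _ (fun j _ => tE j)) -mulr_sumr /ram_bwd ram_bwd_convolution.
rewrite det_tau0 coefZ !detM !detV (det_shift pi_unif) (det_flip pi_unif).
rewrite [- pi / pi / - pi]mulrAC mulfV ?oppr_eq0 // mul1r.
rewrite fmorphV exprz_inv -invr_expz.
move: (iota pi ^ m) pm0 (iota (-1) ^ m) (\sum_(_ | _) _) => x x0 y w.
by field; rewrite c20 x0.
Qed.

Definition ram_init : E * E := (1, 0).

Definition ram_opp : E * E := (0, (z * (c1 * c2))^-1).

Lemma ram_bwd_init P : ram_bwd ram_init P = ram_fwd ram_opp P.
Proof. by rewrite /ram_bwd /ram_fwd /= !mul0r. Qed.

Lemma ram_bwd_opp P : ram_bwd ram_opp P = (z * (c1 * c2))^-1 * ram_fwd ram_init P.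
Proof. by rewrite /ram_bwd /ram_fwd /= mul1r. Qed.

Lemma ram_ok_init : ram_ok ram_init.
Proof. by rewrite /ram_ok absval1 absval0 ler01. Qed.

Lemma central_val0 : z * (c1 * c2) = lam * mu.
Proof. by rewrite /central_val expr0 mulr1 rmorphM expfzMl mulrC mulrACA. Qed.

Lemma ram_ok_opp : ram_ok ram_opp.
Proof. by rewrite /ram_ok /= central_val0 absvalV lam_mu invr1 absval0 ler01. Qed.

Lemma ram_fwd_bound s P : ram_ok s -> integral_form absE P -> absE (ram_fwd s P) <= 1.
Proof. by case=> s1 _ P1; apply: absval_mul_le. Qed.

Lemma ram_bwd_bound s P : ram_ok s -> integral_form absE P -> absE (ram_bwd s P) <= 1.
Proof. by case=> _ s2 P1; apply: absval_mul_le. Qed.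

Lemma ram_fwd_init_neq0 : ram_fwd ram_init (mono E 0) != 0.
Proof. by rewrite /ram_fwd coef_mono eqxx mulr1 oner_eq0. Qed.

End RamifiedRatio.

(** * Irreducibility excludes equal characters *)

Section Reducibility.
Variables (R : realType) (F : fieldType) (absF : nonarch_absval R F) (pi : F).
Hypothesis pi_unif : uniformizer absF pi.
Variables (E : fieldType) (chi1 chi2 : {multiplicative unitg F -> unitg E}).
Hypothesis tame1 : forall x, absF (x - 1) < 1 -> xch chi1 x = 1.
Hypothesis tame2 : forall x, absF (x - 1) < 1 -> xch chi2 x = 1.
Notation Ind := (Ind absF chi1 chi2).
Notation sigma := (Ind_repn absF chi1 chi2).

(* If chi1 = chi2, the line spanned by chi1 o det is a proper submodule. *)
Lemma irreducible_neq : irreducible sigma ->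
  (forall x, absF x = 1 -> xch chi1 x = xch chi2 x) -> xch chi1 pi != xch chi2 pi.
Proof.
move=> irr same; apply/negP => /eqP c12.
have chiE x : xch chi1 x = xch chi2 x.
  have [->|x0] := eqVneq x 0; first by rewrite !xch0.
  have [k [u [u1 ->]]] := unif_factor pi_unif x0.
  by rewrite !xchM !xchXz c12 same.
pose d (g : GL2 F) : E^o := xch chi1 (\det (uval g)).
have dI : d \in Ind_mem absF chi1 chi2.
  rewrite inE; apply: Ind_pred_near => [g h a s b a0 b0 gE|].
    by rewrite /d gE det_mulmx det_mx2 mulr0 subr0 !xchM (chiE b).
  exists 1; first exact: ltr01.
  move=> u u1 g; rewrite /d detM xchM [X in _ * X]tame1 ?mulr1 // det_entries.
  have u00 := u1 0 0; have u11 := u1 1 1.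
  have := u1 0 1; have := u1 1 0; rewrite !subr0 => u10 u01.
  have -> : uval u 0 0 * uval u 1 1 - uval u 0 1 * uval u 1 0 - 1 =
    uval u 1 1 * (uval u 0 0 - 1) + (uval u 1 1 - 1) - uval u 0 1 * uval u 1 0 by ring.
  apply: absvalB_lt; last by apply: absval_mul_lt => //; exact: ltW.
  apply: absvalD_lt => //; apply: absval_mul_lt => //.
  by rewrite (absval_near1 (u11 : absF (uval u 1 1 - 1) < 1)).
pose dV : Ind := MkInd dI.
have subW : submodule sigma setT [set a *: dV | a in setT].
  split=> [|_ _ [a _ <-] [b _ <-]|b _ _ [a _ <-]|g _ [a _ <-]].
  - by exists 0; rewrite ?scale0r.
  - by exists (a + b); rewrite ?scalerDl.
  - by exists (b * a); rewrite ?scalerA.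
  - exists (a * xch chi1 (\det (uval g))) => //; apply/val_inj/funext => h.
    rewrite -[LHS]/(a * xch chi1 (\det (uval g)) * xch chi1 (\det (uval h))).
    rewrite -[RHS]/(a * xch chi1 (\det (uval (h * g)%g))) detM xchM.
    by rewrite -mulrA [xch chi1 (\det (uval g)) * _]mulrC.
have d1 : dV 1%g = 1 by rewrite -[LHS]/(xch chi1 (\det (1%:M : 'M[F]_2))) det1 xch1.
case: (irr.2 _ subW) => WE.
  have : [set a *: dV | a in setT] dV by exists 1; rewrite ?scale1r.
  rewrite WE /= => d0; have : dV 1%g = 0 by rewrite d0.
  by rewrite d1 => /eqP; rewrite oner_eq0.
(* If the line were everything, [edge] would be a multiple of chi1 o det; but it is 1 at the
   identity and 0 at [flip], where chi1 o det does not vanish. *)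
have [a _ aE] : [set a *: dV | a in setT] (edge tame1 tame2) by rewrite WE.
have a1 : a = 1.
  have : (a *: dV) 1%g = edge tame1 tame2 1%g by rewrite aE.
  by rewrite IndZ d1 mulr1 -lower_unip0 edge_lower // absval0 ler01.
have := edge_flip pi_unif tame1 tame2 (t := 0); rewrite absval0 ler01 => /(_ isT).
rewrite -aE a1 scale1r -[dV _]/(xch chi1 _) => /eqP.
rewrite (lower_flipE pi_unif) det_mx2 mul0r sub0r mulr1; apply/negP.
by rewrite xch_neq0 oppr_eq0 (unif_neq0 pi_unif).
Qed.

End Reducibility.

Theorem theorem1p1
  (R : realType)
  (F : fieldType) (absF : nonarch_absval R F)
  (F_local : nonarch_local_field absF)
  (F_char0 : [pchar F] =i pred0)
  (p : nat) (p_prime : prime p) (p_residue : absF p%:R < 1)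
  (pi : unitg F) (pi_unif : uniformizer absF (uval pi))
  (q : nat) (q_card : (residue_ring absF (uval pi) #= `I_q)%card)
  (E : closedFieldType) (iota : {rmorphism F -> E})
  (E_alg : forall x : E, algebraicOver iota x)
  (absE : nonarch_absval R E)
  (absE_ext : forall x : F, absE (iota x) = absF x)
  (omega : {multiplicative unitg F -> unitg E})
  (omega_unram : unramified absF omega)
  (omega_pi : uval (omega pi) = q%:R^-1)
  (chi1 chi2 : {multiplicative unitg F -> unitg E})
  (chi1_smooth : smooth_character absF chi1)
  (chi2_smooth : smooth_character absF chi2)
  (m : int) (n : nat) :
  let sigma := Ind_repn absF chi1 chi2 in
  let tau := det_Sym_repn iota m n in
  forall (V : lmodType E) (t : {bilinear dhomog 2 E n -> Ind absF chi1 chi2 -> V})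
    (rho : repn (GL2 F) V) (rho_tensor : tensor_repn tau sigma t rho),
  let piE := iota (uval pi) in
  let lambda := uval (chi1 pi) * piE ^ m in
  let mu := uval (omega pi) * uval (chi2 pi) * piE ^ m in
  irreducible sigma ->
  absE (lambda * mu * q%:R * piE ^+ n) = 1 ->
  absE lambda <= absE (q%:R^-1 * piE ^- n) ->
  absE mu <= absE (q%:R^-1 * piE ^- n) ->
  (unramified absF chi1 /\ unramified absF chi2 /\ (n < q)%N) \/
  (tamely_ramified absF chi1 (uval pi) /\ tamely_ramified absF chi2 (uval pi) /\
     n = 0%N) ->
  exists V0 : set V, integral_structure rho absE V0.
Proof.
move=> sigma tau V t rho rho_tensor piE lambda mu irr unit_cond lambda_le mu_le cases.
have [D] := digits_exist pi_unif q_card.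
pose c1 : E := uval (chi1 pi); pose c2 : E := uval (chi2 pi).
have c1E : xch chi1 (uval pi) = c1 := xch_uval chi1 pi.
have c2E : xch chi2 (uval pi) = c2 := xch_uval chi2 pi.
have pi0 := unif_neq0 pi_unif.
have piE0 : piE != 0 by rewrite fmorph_eq0.
have pm0 : piE ^ m != 0 by rewrite expfz_neq0.
have c10 : c1 != 0 by rewrite -c1E xch_neq0.
have c20 : c2 != 0 by rewrite -c2E xch_neq0.
have q0 : (q%:R : E) != 0.
  apply/eqP => q0; move/eqP: unit_cond; rewrite q0 mulr0 mul0r absval0.
  by rewrite eq_sym oner_eq0.
(* [mu'] is [q%:R * mu]: the unramified twist by [omega] is removed. *)
pose mu' := c2 * piE ^ m.
have muE : mu = q%:R^-1 * mu' by rewrite /mu omega_pi mulrA.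
have unitE : absE (lambda * mu' * piE ^+ n) = 1.
  rewrite -unit_cond muE; congr (absE _).
  by move: (lambda) (mu') (piE ^+ n) => x y w; field.
have lambda0 : lambda != 0 by rewrite mulf_neq0.
have mu'0 : mu' != 0 by rewrite mulf_neq0.
have pn0 : piE ^+ n != 0 by rewrite expf_neq0.
have bound x : absE x <= absE (q%:R^-1 * piE ^- n) -> absE (q%:R * x * piE ^+ n) <= 1.
  move=> xb; have -> : 1 = absE (q%:R * (q%:R^-1 * piE ^- n) * piE ^+ n).
    by rewrite mulrA divff // mul1r mulVf // absval1.
  rewrite ![absE (_ * piE ^+ n)]absvalM ler_wpM2r ?absval_ge0 //.
  by rewrite ![absE (q%:R * _)]absvalM ler_wpM2l ?absval_ge0.
(* By (i), the inverse of [lambda] has the size of [q%:R * mu * piE ^+ n], so the bound (ii) on [mu]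
   becomes integrality of [lambda^-1]. The bound on [lambda] turns into [mu'_ge] in the same way. *)
have lambda_ge : absE lambda^-1 <= 1.
  have -> : absE lambda^-1 = absE (q%:R * mu * piE ^+ n).
    rewrite -[LHS]mulr1 -unitE -absvalM muE; congr (absE _).
    by field; rewrite lambda0 q0.
  exact: bound.
have mu'_ge : absE (q%:R * mu'^-1) <= 1.
  have -> : absE (q%:R * mu'^-1) = absE (q%:R * lambda * piE ^+ n).
    rewrite -[LHS]mulr1 -unitE -absvalM; congr (absE _).
    by field; rewrite mu'0.
  exact: bound.
have central : absE (central_val iota m n (uval pi) *
    (xch chi1 (uval pi) * xch chi2 (uval pi))) = 1.
  rewrite -unitE /central_val c1E c2E rmorphM expfzMl -/piE; congr (absE _).
  rewrite /lambda /mu' -/c1; move: (piE ^ m) (piE ^+ n) => x y; ring.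
have [tame1 tame2] : (forall x, absF (x - 1) < 1 -> xch chi1 x = 1) /\
    (forall x, absF (x - 1) < 1 -> xch chi2 x = 1).
  case: cases => [[u1 [u2 _]]|[t1 [t2 _]]]; last by split; apply: (xch_tame pi_unif).
  by split; apply: (xch_tame pi_unif); apply: (unramified_tame pi_unif).
(* Stated for equality on units, so as to serve case (1) and also the part of case (2) where the
   characters agree on units. *)
have unram_ratio : (forall x, absF x = 1 -> xch chi1 x = xch chi2 x) -> (n < q)%N ->
    exists V0 : set V, integral_structure rho absE V0.
  move=> same nq; have c12 := irreducible_neq pi_unif tame1 tame2 irr same.
  have c1_ge : absE ((xch chi1 (uval pi))^-1 * iota (uval pi) ^ (- m)) <= 1.
    by rewrite c1E -invr_expz -invfM.
  have c2_ge : absE (q%:R * (xch chi2 (uval pi))^-1 * iota (uval pi) ^ (- m)) <= 1.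
    by rewrite c2E -invr_expz -mulrA -invfM.
  apply: (integral_structure_of_states pi_unif F_char0 absE_ext tame1 tame2 rho_tensor irr
    central (D := D) (fwd := @unram_fwd F (uval pi) E iota chi1 chi2 m n)
    (bwd := @unram_bwd F (uval pi) E iota chi1 chi2 m n)
    (step := unram_step (uval pi) D iota chi1 chi2 m nq) (ok := @unram_ok R E absE n)
    (s0 := unram_init E n) (s1 := unram_opp (uval pi) iota chi1 chi2 m n)
    (C := unram_bound (uval pi) iota absE chi1 chi2 m n) (P0 := mono E 0)).
  - exact: unram_fwd_lin.
  - exact: (unram_ok_step pi_unif).
  - by move=> s P _; apply: (unram_fwd_split pi_unif).
  - by move=> s i P _; apply: (unram_bwd_step pi_unif).
  - exact: unram_ok_init.
  - exact: unram_ok_opp.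
  - by move=> P; apply: (unram_bwd_init pi_unif).
  - by move=> P; apply: (unram_bwd_opp pi_unif).
  - by move=> s P; apply: (unram_fwd_bound pi_unif).
  - by move=> s P; apply: (unram_bwd_bound pi_unif).
  - exact: integral_mono.
  - exact: (unram_fwd_init_neq0 pi_unif).
case: cases => [[u1 [u2 nq]]|[_ [_ n0]]].
  by apply: unram_ratio => // x x1; rewrite !(xch_unramified _ x1).
have q_gt0 : (0 < q)%N by rewrite lt0n; apply: contraNneq q0 => ->.
(* Otherwise [y0] is a unit at which the ratio is not 1, as the character sums require. *)
have [same|/existsNP[y0 /not_implyP[y1 /eqP eta_y0]]] :=
    pselect (forall x, absF x = 1 -> xch chi1 x = xch chi2 x).
  by apply: unram_ratio; rewrite ?n0.
subst n.
have lam_mu : absE (xch chi1 (uval pi) * piE ^ m * (xch chi2 (uval pi) * piE ^ m)) = 1.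
  by rewrite -unitE c1E c2E expr0 mulr1.
have lam_ge : absE (xch chi1 (uval pi) * piE ^ m)^-1 <= 1 by rewrite c1E.
have mu_ge : absE (q%:R * (xch chi2 (uval pi) * piE ^ m)^-1) <= 1 by rewrite c2E.
(* The choice of the distinguished child is arbitrary. *)
pose r0 := Ordinal q_gt0.
apply: (integral_structure_of_states pi_unif F_char0 absE_ext tame1 tame2 rho_tensor irr
  central (D := D) (fwd := @ram_fwd E) (bwd := @ram_bwd E)
  (step := ram_step (uval pi) D iota chi1 chi2 m r0) (ok := @ram_ok R E absE)
  (s0 := ram_init E) (s1 := ram_opp (uval pi) iota chi1 chi2 m) (C := 1) (P0 := mono E 0)).
- exact: ram_fwd_lin.
- by move=> s i; apply: ram_ok_step.
- by move=> s P _; apply: (ram_fwd_split pi_unif D iota tame1 tame2 y1 eta_y0).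
- by move=> s i P _; apply: (ram_bwd_step pi_unif D iota tame1 tame2 y1 eta_y0).
- exact: ram_ok_init.
- exact: ram_ok_opp.
- exact: ram_bwd_init.
- exact: ram_bwd_opp.
- exact: ram_fwd_bound.
- exact: ram_bwd_bound.
- exact: integral_mono.
- exact: ram_fwd_init_neq0.
Qed.
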